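(* Let $F$ be a field of characteristic $p>0$. Let $b_1,\ldots,b_r,b\in F\setminus F^p$ be such that $\{b_1,\ldots,b_r\}$ is $p$-independent and $b\in F^p(b_1,\ldots,b_r)$. Let $m_1,\ldots,m_r,m\in\mathbb N$ with $m\leq m_i$ for all $i=1,\ldots,r$, and set $E=F\big(\sqrt[p^{m_1}]{b_1},\ldots,\sqrt[p^{m_r}]{b_r},\sqrt[p^{m}]{b}\big)$. \begin{enumerate} \item[(a)] If there exists $t\in\mathbb N$ with $t\geq m$ and $b\in F^{p^t}(b_1,\ldots,b_r)$, then $E=F\big(\sqrt[p^{m_1}]{b_1},\ldots,\sqrt[p^{m_r}]{b_r}\big)$; in particular $E/F$ is modular, $\Omega^n(E/F)=\sum_{i=1}^r \mathrm{d} b_i\wedge\Omega^{n-1}(F)=\operatorname{ann}\Omega^n_F(\mathrm{d} b_1\wedge\cdots\wedge\mathrm{d} b_r)$ and $\nu_n(E/F)=\operatorname{ann}\nu^n_F(\mathrm{d} b_1\wedge\cdots\wedge\mathrm{d} b_r)$, and if moreover $F^{p-1}=F$ then $\nu_n(E/F)=\big[\tfrac{\mathrm{d} x}{x}\mid x\in F^p(b_1,\ldots,b_r)^*\big]\wedge\nu_{n-1}(F)$. \item[(b)] Suppose no $t\geq m$ as in (a) exists, and let $t\in\{1,\ldots,m-1\}$ be maximal with $b\in F^{p^t}(b_1,\ldots,b_r)$. Write $b=\sum_{i=(i_1,\ldots,i_r)\in T}x_i^{p^t}b_1^{i_1}\cdots b_r^{i_r}$ with $x_i\in F$ and $T=\{0,\ldots,p^t-1\}^r$,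 and set $S=\{x_i\mid i\in T\}$. Then $$\Omega^n(E/F)=\operatorname{ann}\Omega^n_F(\mathrm{d} b_1\wedge\cdots\wedge\mathrm{d} b_r\wedge\mathrm{d} S)\quad\text{and}\quad \nu_n(E/F)=\operatorname{ann}\nu^n_F(\mathrm{d} b_1\wedge\cdots\wedge\mathrm{d} b_r\wedge\mathrm{d} S).$$ \end{enumerate}
   Context: $F$ is a field of characteristic $p>0$. $\Omega^1(F)$ is the $F$-vector space generated by symbols $\mathrm{d} a$ ($a\in F$) subject to $\mathrm{d}(a+b)=\mathrm{d} a+\mathrm{d} b$, $\mathrm{d}(ab)=a\,\mathrm{d} b+b\,\mathrm{d} a$; $\Omega^n(F)=\bigwedge^n_F\Omega^1(F)$ for $n\ge1$, $\Omega^0(F)=F$, $\Omega^n(F)=0$ for $n<0$. The map $\mathrm{d}:\Omega^{n-1}(F)\to\Omega^n(F)$ is given by $x\,\mathrm{d} a_1\wedge\cdots\wedge\mathrm{d} a_{n-1}\mapsto \mathrm{d} x\wedge\mathrm{d} a_1\wedge\cdots\wedge \mathrm{d} a_{n-1}$. A subset $A\subset F$ is $p$-independent if $[F^p(a_1,\ldots,a_k):F^p]=p^k$ for every finite subset $\{a_1,\ldots,a_k\}\subset A$. The Artin–Schreier map $\wp:\Omega^n(F)\to\Omega^n(F)/\mathrm{d}\Omega^{n-1}(F)$ is the additive map $x\frac{\mathrm{d} a_1}{a_1}\wedge\cdots\wedge\frac{\mathrm{d} a_n}{a_n}\mapsto (x^p-x)\frac{\mathrm{d} a_1}{a_1}\wedge\cdots\wedge\frac{\mathrm{d}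 a_n}{a_n}\bmod \mathrm{d}\Omega^{n-1}(F)$, and $\nu_n(F)=\ker\wp$ (it is additively generated by the logarithmic forms $\frac{\mathrm{d} a_1}{a_1}\wedge\cdots\wedge\frac{\mathrm{d} a_n}{a_n}$, $a_i\in F^*$; in particular $\nu_0(F)=\mathbb F_p$, $\nu_m(F)=0$ for $m<0$). For nonempty $S_1,\ldots,S_k\subset F$, $\mathrm{d} S_1\wedge\cdots\wedge\mathrm{d} S_k=\{\mathrm{d} s_1\wedge\cdots\wedge\mathrm{d} s_k\mid s_i\in S_i\}\subset\Omega^k(F)$, and a single element $s$ in a slot stands for $\{s\}$. For nonempty $U\subset\Omega^k(F)$: $\operatorname{ann}\Omega^n_F(U)=\{\omega\in\Omega^n(F)\mid \omega\wedge u=0\ \forall u\in U\}$ and $\operatorname{ann}\nu^n_F(U)=\operatorname{ann}\Omega^n_F(U)\cap\nu_n(F)$. For a field extension $K/F$, $\Omega^n(K/F)$ is the kernel of the natural map $\Omega^n(F)\to\Omega^n(K)$ and $\nu_n(K/F)=\Omega^n(K/F)\cap\nu_n(F)$. $[\,\cdots]$ denotes the additive subgroup generated by the indicated elements, and for an additive group $X$ of $s$-forms and a group $Y$ of $(n-s)$-forms, $X\wedge Y$ is the additive subgroup generated by all $x\wedge y$. A purely inseparable extension is modular if it is of the form $F(\sqrt[p^{n_1}]{c_1},\ldots,\sqrt[p^{n_k}]{c_k})$ with $\{c_1,\ldots,c_k\}$ $p$-independent. *)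

(* Defs.v *)
From HB Require Import structures.
From mathcomp Require Import all_boot all_order all_algebra.
Set Implicit Arguments. Unset Strict Implicit. Unset Printing Implicit Defensive.
Import GRing.Theory.
Local Open Scope ring_scope.

(* A formal term (x, [:: a_1; ...; a_n]) stands for x da_1 /\ ... /\ da_n;
   a formal sum (fsum) is a finite list of such terms. *)
Definition fterm (F : fieldType) := (F * seq F)%type.
Definition fsum (F : fieldType) := seq (fterm F).

Definition fdeg {F : fieldType} (n : nat) (w : fsum F) : bool :=
  all (fun t => size t.2 == n) w.

Definition fcoef {F : fieldType} (w : fsum F) (a : seq F) : F :=
  \sum_(t <- w | t.2 == a) t.1.

Definition fscale {F : fieldType} (c : F) (w : fsum F) : fsum F :=
  [seq (c * t.1, t.2) | t <- w].
Definition fopp {F : fieldType} (w : fsum F) : fsum F := fscale (-1) w.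

Definition fwedge {F : fieldType} (w1 w2 : fsum F) : fsum F :=
  [seq (t1.1 * t2.1, t1.2 ++ t2.2) | t1 <- w1, t2 <- w2].

Definition fdiff {F : fieldType} (w : fsum F) : fsum F :=
  [seq (1, t.1 :: t.2) | t <- w].

Definition fd {F : fieldType} (a : F) : fsum F := [:: (1, [:: a])].

Definition fdlog {F : fieldType} (x : F) (a : seq F) : fterm F :=
  (x * \prod_(c <- a) c^-1, a).

(* Defining relations of Omega^n(F) = /\^n_F Omega^1(F), as a quotient of the
   free F-module on n-tuples of elements of F: additivity and Leibniz rule in
   each slot, and vanishing on tuples with two equal entries. *)
Inductive frel {F : fieldType} (n : nat) : fsum F -> Prop :=
| FR_add (u v : seq F) (a c : F) : (size u + size v).+1 = n ->
    frel n [:: (1, u ++ (a + c) :: v); (-1, u ++ a :: v); (-1, u ++ c :: v)]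
| FR_mul (u v : seq F) (a c : F) : (size u + size v).+1 = n ->
    frel n [:: (1, u ++ (a * c) :: v); (- a, u ++ c :: v); (- c, u ++ a :: v)]
| FR_alt (w : seq F) (i j : nat) : size w = n -> (i < j < n)%N ->
    nth 0 w i = nth 0 w j -> frel n [:: (1, w)].

Definition fzero {F : fieldType} (n : nat) (w : fsum F) : Prop :=
  exists gs : seq (F * fsum F),
    (forall g, g \in gs -> frel n g.2) /\
    forall a, fcoef w a = fcoef (flatten [seq fscale g.1 g.2 | g <- gs]) a.

Definition feq {F : fieldType} (n : nat) (w1 w2 : fsum F) : Prop :=
  fzero n (w1 ++ fopp w2).

(* representatives of Omega^{n-1}(F) (which is 0 when n = 0) *)
Definition omega_low {F : fieldType} (n : nat) (w : fsum F) : Prop :=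
  if n is k.+1 then fdeg k w else w = [::].

(* nu_n(F) = ker of the Artin-Schreier map
   wp : x dlog a_1../\dlog a_n |-> (x^p - x) dlog a_1../\dlog a_n mod dOmega^{n-1} *)
Definition nu {F : fieldType} (p : nat) (n : nat) (w : fsum F) : Prop :=
  fdeg n w /\
  exists reps : seq (F * seq F),
    all (fun r => (size r.2 == n) && all (fun c => c != 0) r.2) reps /\
    feq n w [seq fdlog r.1 r.2 | r <- reps] /\
    exists eta : fsum F, omega_low n eta /\
      feq n [seq fdlog (r.1 ^+ p - r.1) r.2 | r <- reps] (fdiff eta).

(* representatives of nu_{n-1}(F) (which is 0 when n = 0) *)
Definition nu_low {F : fieldType} (p : nat) (n : nat) (w : fsum F) : Prop :=
  if n is k.+1 then nu p k w else w = [::].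

Definition fmap {F E : fieldType} (f : {rmorphism F -> E}) (w : fsum F) : fsum E :=
  [seq (f t.1, map f t.2) | t <- w].

Definition OmegaRel {F E : fieldType} (f : {rmorphism F -> E}) (n : nat)
    (w : fsum F) : Prop :=
  fdeg n w /\ fzero n (fmap f w).

Definition nuRel {F E : fieldType} (p : nat) (f : {rmorphism F -> E}) (n : nat)
    (w : fsum F) : Prop :=
  OmegaRel f n w /\ nu p n w.

Definition annOmega {F : fieldType} (n k : nat) (U : fsum F -> Prop)
    (w : fsum F) : Prop :=
  fdeg n w /\ forall u, U u -> fzero (n + k) (fwedge w u).

Definition annNu {F : fieldType} (p n k : nat) (U : fsum F -> Prop)
    (w : fsum F) : Prop :=
  annOmega n k U w /\ nu p n w.

Definition is_subfield {F : fieldType} (K : F -> Prop) : Prop :=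
  [/\ K 0, K 1, (forall x y, K x -> K y -> K (x - y)),
      (forall x y, K x -> K y -> K (x * y)) & (forall x, K x -> K x^-1)].

Definition gen_field {F : fieldType} (A : F -> Prop) (x : F) : Prop :=
  forall K, is_subfield K -> (forall y, A y -> K y) -> K x.

Definition in_powgen {F : fieldType} (q : nat) {r : nat} (b : 'I_r -> F)
    (x : F) : Prop :=
  gen_field (fun y => (exists z, y = z ^+ q) \/ (exists i, y = b i)) x.

(* p-independence of the (distinct) family b_1, ..., b_r:
   [F^p(b_1..b_r) : F^p] = p^r, i.e. the p^r monomials b^i, i in {0..p-1}^r,
   are linearly independent over F^p. *)
Definition pindep {F : fieldType} (p : nat) {r : nat} (b : 'I_r -> F) : Prop :=
  forall c : {ffun 'I_r -> 'I_p} -> F,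
    \sum_(i : {ffun 'I_r -> 'I_p}) c i ^+ p * \prod_(k < r) b k ^+ i k = 0 ->
    forall i, c i = 0.

Definition modular_ext {F E : fieldType} (p : nat) (f : {rmorphism F -> E}) : Prop :=
  exists (k : nat) (c : 'I_k -> F) (ns : 'I_k -> nat) (g : 'I_k -> E),
    [/\ pindep p c, (forall j, g j ^+ (p ^ ns j)%N = f (c j)) &
        forall e : E, gen_field (fun y => (exists z, y = f z) \/ (exists j, y = g j)) e].

Definition fdbs {F : fieldType} {r : nat} (b : 'I_r -> F) : seq F :=
  [seq b i | i <- enum 'I_r].

Definition sum_db_wedge {F : fieldType} (n : nat) {r : nat} (b : 'I_r -> F)
    (w : fsum F) : Prop :=
  fdeg n w /\ exists eta : 'I_r -> fsum F, (forall i, omega_low n (eta i)) /\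
    feq n w (flatten [seq fwedge (fd (b i)) (eta i) | i <- enum 'I_r]).

Definition dlog_wedge_nu {F : fieldType} (p n : nat) {r : nat} (b : 'I_r -> F)
    (w : fsum F) : Prop :=
  fdeg n w /\ exists l : seq (bool * F * fsum F),
    (forall e, e \in l -> [/\ in_powgen p b e.1.2, e.1.2 != 0 & nu_low p n e.2]) /\
    feq n w (flatten [seq fscale (if e.1.1 then -1 else 1)
                          (fwedge [:: fdlog 1 [:: e.1.2]] e.2) | e <- l]).

(* Main.v *)
Require Import Defs.
From HB Require Import structures.
From mathcomp Require Import all_boot all_order all_algebra ring.
From mathcomp Require Import perm generic_quotient.
From mathcomp Require Import boolp classical_sets.
Set Implicit Arguments. Unset Strict Implicit. Unset Printing Implicit Defensive.
Import GRing.Theory.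
Local Open Scope ring_scope.

(** A form [x da_1 /\ ... /\ da_n] is evaluated on derivations [D_1, ..., D_n] as
    [x * det (D_i a_j)], and a form is zero iff all its evaluations are: the entries lie in
    [F^p(c_1, ..., c_N)] for a p-independent family [c] possessing dual derivations.  Hence
    [omega] dies in [E] iff it is killed by all tuples of derivations [F -> E] that extend to [E].

    The derivations extending to [G = F(beta_1, ..., beta_r)] are those killing the [b_i].  In (a)
    this is all of [E].  In (b), [y = beta0^(p^(m-t)) = sum_i x_i beta^(i p^(ms-t))] lies in [G],
    and is not a p-th power there by maximality of [t]; so the extra condition is
    that the derivation kills [y], and since the monomials in [beta] involved are independent
    over [F], annihilating [dy] amounts to annihilating every [dx_i].

    For the logarithmic description when [F^(p-1) = F] we follow Kato.  Decompose the
    coefficients of [omega = sum_S w_S dlog c_S] under the commuting derivations [c_k d/dc_k].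
    Membership in [nu_n] forces the weight-0 part of [w_S] to be [w_S^p], and closedness forces
    the other weights of a maximal [w_S] to have their top index in [S].  Then [w_S] splits as a
    product of logarithmic derivatives [c_s d_s(y_s) / y_s] with [y_s] in [F^p(c_1, ..., c_s)], by
    Jacobson's formula for the p-th power of [D + a]; subtracting [dlog y] for these [y] lowers
    the maximal [S].  The first index of [S] belongs to the [b_i], so the first [y] is in
    [F^p(b_1, ..., b_r)]. *)

(** * Purely inseparable field theory *)

(** In (b) the extra condition on a derivation is one equation,
    [sum_i beta^(i p^(ms-t)) d(x_i) = 0], whose coefficients lie in [E] rather than [F]. This is why
    derivations [F -> E] and their [E]-linear combinations are used, although the forms live over
    [F]. The equation cuts out a hyperplane: an arbitrary tuple of derivations killing the [b_i] is
    brought by an invertible matrix over [E] to one with at most one member outside it, and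
    conversely a tuple inside it is completed by one derivation outside it. Intermediate fields are
    predicates on a fixed field, and a derivation is extended by enlarging its graph; the real issue
    is that the graph stays single-valued, and each time this is a linear independence statement,
    for powers of a radical or for monomials in the [beta_i]. In the logarithmic part, Jacobson's
    formula enters because [a -> (D + a)^p 1] is additive: whether a function is a logarithmic
    derivative can then be read off its weights. The hypothesis [F^(p-1) = F] serves at one point,
    the extraction of a root that separates the last factor from the others in a product of
    logarithmic derivatives. *)

Section Frobenius.
Variables (p : nat) (F : fieldType) (hp : p \in [pchar F]).
Implicit Types (x y : F) (k : nat).

Lemma pchar_gt0 : (0 < p)%N.
Proof. exact: prime_gt0 (pcharf_prime hp). Qed.

Lemma frobD k x y : (x + y) ^+ (p ^ k)%N = x ^+ (p ^ k)%N + y ^+ (p ^ k)%N.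
Proof.
apply: exprDn_pchar; rewrite (eq_pnat _ (pcharf_eq hp)).
by rewrite pnatX pnat_id ?(pcharf_prime hp).
Qed.

Lemma frob0 k : (0 : F) ^+ (p ^ k)%N = 0.
Proof. by rewrite expr0n expn_eq0 (gtn_eqF pchar_gt0). Qed.

Lemma frobN k x : (- x) ^+ (p ^ k)%N = - x ^+ (p ^ k)%N.
Proof. by apply/eqP; rewrite -subr_eq0 opprK -frobD addNr frob0. Qed.

Lemma frobB k x y : (x - y) ^+ (p ^ k)%N = x ^+ (p ^ k)%N - y ^+ (p ^ k)%N.
Proof. by rewrite frobD frobN. Qed.

Lemma frob_sum k (I : Type) (s : seq I) (P : pred I) (g : I -> F) :
  (\sum_(i <- s | P i) g i) ^+ (p ^ k)%N = \sum_(i <- s | P i) g i ^+ (p ^ k)%N.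
Proof. by apply: (big_morph (fun x => x ^+ (p ^ k)%N) (frobD k) (frob0 k)). Qed.

Lemma frob_inj k : injective (fun x : F => x ^+ (p ^ k)%N).
Proof.
move=> x y /eqP; rewrite -subr_eq0 -frobB expf_eq0 subr_eq0.
by case/andP=> _ /eqP.
Qed.

End Frobenius.

Section Subfields.
Variable F : fieldType.
Implicit Types (A K : F -> Prop) (x y : F).

Lemma gen_fieldP A : is_subfield (gen_field A).
Proof.
split.
- by move=> K [].
- by move=> K [].
- by move=> x y hx hy K hK hA; case: (hK) => _ _ h _ _; apply: h; [apply: hx|apply: hy].
- by move=> x y hx hy K hK hA; case: (hK) => _ _ _ h _; apply: h; [apply: hx|apply: hy].
- by move=> x hx K hK hA; case: (hK) => _ _ _ _ h; apply: h; apply: hx.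
Qed.

Lemma mem_gen_field A x : A x -> gen_field A x.
Proof. by move=> hx K _; apply. Qed.

Section Closure.
Variables (K : F -> Prop) (hK : is_subfield K).

Lemma subfield0 : K 0. Proof. by case: hK. Qed.
Lemma subfield1 : K 1. Proof. by case: hK. Qed.
Lemma subfieldB x y : K x -> K y -> K (x - y). Proof. by case: hK => _ _ h _ _; apply: h. Qed.
Lemma subfieldM x y : K x -> K y -> K (x * y). Proof. by case: hK => _ _ _ h _; apply: h. Qed.
Lemma subfieldV x : K x -> K x^-1. Proof. by case: hK => _ _ _ _; apply. Qed.
Lemma subfieldN x : K x -> K (- x).
Proof. by move=> hx; rewrite -sub0r; apply: subfieldB => //; apply: subfield0. Qed.
Lemma subfieldD x y : K x -> K y -> K (x + y).
Proof. by move=> hx hy; rewrite -[y]opprK; apply: subfieldB => //; apply: subfieldN. Qed.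
Lemma subfieldX n x : K x -> K (x ^+ n).
Proof.
move=> hx; elim: n => [|n IH]; first by rewrite expr0; apply: subfield1.
by rewrite exprS; apply: subfieldM.
Qed.
Lemma subfield_sum (I : Type) (s : seq I) (P : pred I) (g : I -> F) :
  (forall i, P i -> K (g i)) -> K (\sum_(i <- s | P i) g i).
Proof. by move=> hg; elim/big_ind: _ => //; [apply: subfield0|apply: subfieldD]. Qed.
Lemma subfield_prod (I : Type) (s : seq I) (P : pred I) (g : I -> F) :
  (forall i, P i -> K (g i)) -> K (\prod_(i <- s | P i) g i).
Proof. by move=> hg; elim/big_ind: _ => //; [apply: subfield1|apply: subfieldM]. Qed.
Lemma subfield_nat n : K n%:R.
Proof. by elim: n => [|n IH]; [apply: subfield0 | rewrite -natr1; apply: subfieldD => //; apply: subfield1]. Qed.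
End Closure.

Lemma gen_field_min A K x : is_subfield K -> (forall y, A y -> K y) -> gen_field A x -> K x.
Proof. by move=> hK hA; apply. Qed.

(* For a purely inseparable situation closure under inverses is automatic:
   [x^-1 = x^(q-1) * (x^q)^-1]. *)
Lemma subfield_of_powers (q : nat) K : (0 < q)%N ->
  K 1 -> (forall x y, K x -> K y -> K (x - y)) ->
  (forall x y, K x -> K y -> K (x * y)) -> (forall x, K x -> K (x ^+ q)^-1) ->
  is_subfield K.
Proof.
move=> q0 K1 KB KM KV; split=> //; first by rewrite -(subrr 1); apply: KB.
have KX n x : K x -> K (x ^+ n) by move=> hx; elim: n => [//|n IH]; rewrite exprS; apply: KM.
move=> x hx; case: (eqVneq x 0) => [->|x0]; first by rewrite invr0 -(subrr 1); apply: KB.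
suff -> : x^-1 = x ^+ q.-1 * (x ^+ q)^-1 by apply: KM; [apply: KX|apply: KV].
by rewrite -{2}(prednK q0) exprS invfM mulrCA mulfV ?mulr1 // expf_neq0.
Qed.

End Subfields.

Lemma subfield_preim (F E : fieldType) (h : F -> E) (K : E -> Prop) :
  is_subfield K -> h 0 = 0 -> h 1 = 1 -> {morph h : x y / x - y} ->
  {morph h : x y / x * y} -> {morph h : x / x^-1} -> is_subfield (fun x => K (h x)).
Proof.
move=> hK h0 h1 hB hM hV; split.
- by rewrite h0; apply: subfield0.
- by rewrite h1; apply: subfield1.
- by move=> x y hx hy; rewrite hB; apply: subfieldB.
- by move=> x y hx hy; rewrite hM; apply: subfieldM.
- by move=> x hx; rewrite hV; apply: subfieldV.
Qed.

Definition mono (R : comNzRingType) (r : nat) (b : 'I_r -> R) (e : 'I_r -> nat) : R :=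
  \prod_(k < r) b k ^+ e k.

Section Monomials.
Variables (R : comNzRingType) (r : nat) (b : 'I_r -> R).

Lemma monoD (e e' : 'I_r -> nat) : mono b (fun k => e k + e' k)%N = mono b e * mono b e'.
Proof. by rewrite /mono -big_split; apply: eq_bigr => k _; rewrite exprD. Qed.

Lemma monoM (e : 'I_r -> nat) q : mono b (fun k => e k * q)%N = mono b e ^+ q.
Proof. by rewrite /mono -prodrXl; apply: eq_bigr => k _; rewrite exprM. Qed.

Lemma eq_mono (e e' : 'I_r -> nat) : e =1 e' -> mono b e = mono b e'.
Proof. by move=> h; apply: eq_bigr => k _; rewrite h. Qed.

Lemma mono0 : mono b (fun=> 0%N) = 1.
Proof. by rewrite /mono big1. Qed.

Lemma mono_delta k : mono b (fun l => (l == k) : nat) = b k.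
Proof.
rewrite /mono (bigD1 k) //= eqxx expr1 big1 ?mulr1 // => l /negbTE ->.
by rewrite expr0.
Qed.

End Monomials.

Lemma rmorph_mono (R S : comNzRingType) (f : {rmorphism R -> S}) r (b : 'I_r -> R) e :
  f (mono b e) = mono (f \o b) e.
Proof. by rewrite /mono rmorph_prod; apply: eq_bigr => k _; rewrite rmorphXn. Qed.

Section PowGen.
Variables (p : nat) (F : fieldType) (hp : p \in [pchar F]).
Variables (r : nat) (b : 'I_r -> F).
Let p0 : (0 < p)%N := pchar_gt0 hp.

Lemma powgenP q : is_subfield (in_powgen q b).
Proof. exact: gen_fieldP. Qed.

Lemma powgen_pow q (z : F) : in_powgen q b (z ^+ q).
Proof. by apply: mem_gen_field; left; exists z. Qed.

Lemma powgen_gen q k : in_powgen q b (b k).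
Proof. by apply: mem_gen_field; right; exists k. Qed.

Lemma powgen_mono q e : in_powgen q b (mono b e).
Proof.
by apply: (subfield_prod (powgenP q)) => k _; apply: (subfieldX (powgenP q)); apply: powgen_gen.
Qed.

Lemma powgen_le s t (x : F) : (s <= t)%N -> in_powgen (p ^ t)%N b x -> in_powgen (p ^ s)%N b x.
Proof.
move=> st; apply: gen_field_min; first exact: powgenP.
move=> y [[z ->]|[k ->]]; last exact: powgen_gen.
by rewrite -(subnK st) expnD exprM; apply: powgen_pow.
Qed.

Lemma powgen_frob s k (x : F) : in_powgen (p ^ s)%N b x ->
  in_powgen (p ^ (s + k))%N b (x ^+ (p ^ k)%N).
Proof.
apply: (@gen_field_min _ _ (fun x => in_powgen (p ^ (s + k))%N b (x ^+ (p ^ k)%N))).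
  apply: (subfield_preim (powgenP _)); rewrite ?(frob0 hp) ?expr1n //.
  - by move=> u v; rewrite (frobB hp).
  - by move=> u v; rewrite exprMn.
  - by move=> u; rewrite exprVn.
move=> y [[z ->]|[j ->]]; first by rewrite -exprM -expnD; apply: powgen_pow.
by apply: (subfieldX (powgenP _)); apply: powgen_gen.
Qed.

Definition modexp (e : 'I_r -> nat) : {ffun 'I_r -> 'I_p} :=
  [ffun k => Ordinal (ltn_pmod (e k) p0)].

Lemma mono_modexp (e : 'I_r -> nat) :
  mono b e = mono b (fun k => e k %/ p)%N ^+ p * mono b (fun k => modexp e k).
Proof. by rewrite -monoM -monoD; apply: eq_mono => k; rewrite ffunE /= -divn_eq. Qed.

(** The sums on the right form a ring [K] with [A^p <= K <= A], where [A = F^(p^M)(b)]. An element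
    of [K] is inverted inside [A], and the [p]-th power of that inverse falls back into [K], so [K]
    is a field containing the generators. *)
Lemma powgen_coords M x : in_powgen (p ^ M.+1)%N b x ->
  exists g : {ffun 'I_r -> 'I_p} -> F,
    (forall i, in_powgen (p ^ M)%N b (g i)) /\
    x = \sum_i g i ^+ p * mono b (fun k => i k).
Proof.
pose A := in_powgen (p ^ M)%N b.
have hA : is_subfield A by exact: powgenP.
pose K x := exists g : {ffun 'I_r -> 'I_p} -> F,
    (forall i, A (g i)) /\ x = \sum_i g i ^+ p * mono b (fun k => i k).
have fB (u v : F) : (u - v) ^+ p = u ^+ p - v ^+ p by rewrite -{1 2 3}(expn1 p) (frobB hp).
have f0 : (0 : F) ^+ p = 0 by rewrite -(expn1 p) (frob0 hp).
have KB u v : K u -> K v -> K (u - v).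
  move=> [g [hg ->]] [g' [hg' ->]]; exists (fun i => g i - g' i); split.
    by move=> i; apply: (subfieldB hA).
  by rewrite -sumrB; apply: eq_bigr => i _; rewrite fB mulrBl.
have K1 (g : F) e : A g -> K (g ^+ p * mono b e).
  move=> hg; exists (fun i => if i == modexp e then g * mono b (fun k => e k %/ p)%N else 0).
  split=> [i|].
    case: ifP => _; last exact: (subfield0 hA).
    by apply: (subfieldM hA) => //; apply: powgen_mono.
  rewrite (bigD1 (modexp e)) //= eqxx big1 ?addr0; last first.
    by move=> i /negbTE ->; rewrite f0 mul0r.
  by rewrite exprMn -mulrA -mono_modexp.
have K0 : K 0.
  exists (fun=> 0); split=> [i|]; first exact: (subfield0 hA).
  by rewrite big1 // => i _; rewrite f0 mul0r.
have KD u v : K u -> K v -> K (u + v).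
  by move=> hu hv; rewrite -[v]opprK -(sub0r v); apply: (KB) => //; apply: (KB).
have KM u v : K u -> K v -> K (u * v).
  move=> [g [hg ->]] [g' [hg' ->]]; rewrite big_distrlr /=.
  elim/big_ind: _ => // i _; elim/big_ind: _ => // j _.
  by rewrite mulrACA -exprMn -monoD; apply: (K1); apply: (subfieldM hA).
have KA y : A y -> K (y ^+ p).
  by move=> hy; rewrite -[_ ^+ p]mulr1 -(mono0 b); apply: (K1).
have AK y : K y -> A y.
  move=> [g [hg ->]]; apply: (subfield_sum hA) => // i _; apply: (subfieldM hA) => //.
    exact: (subfieldX hA).
  exact: powgen_mono.
have hK : is_subfield K.
  apply: (subfield_of_powers p0) => //; last first.
    by move=> y hy; rewrite -exprVn; apply: KA; apply: (subfieldV hA); apply: AK.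
  by rewrite -(expr1n F p); apply: KA; apply: (subfield1 hA).
apply: (gen_field_min hK) => y [[z ->]|[k ->]].
  by rewrite expnSr exprM; apply: KA; apply: powgen_pow.
by rewrite -[b k]mul1r -(expr1n F p) -(mono_delta b k); apply: (K1); apply: (subfield1 hA).
Qed.

Hypothesis hind : pindep p b.

(** Independence makes coordinates unique, and [z ^+ p] is visibly [z ^+ p] times the trivial
    monomial. So [z] is its coordinate there, and coordinates lie in the smaller field. *)
Lemma powgen_root M (z : F) : in_powgen (p ^ M.+1)%N b (z ^+ p) -> in_powgen (p ^ M)%N b z.
Proof.
move=> /powgen_coords [g [hg eqz]].
pose o : {ffun 'I_r -> 'I_p} := modexp (fun=> 0%N).
have f0 : (0 : F) ^+ p = 0 by rewrite -(expn1 p) (frob0 hp).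
have fB (u v : F) : (u - v) ^+ p = u ^+ p - v ^+ p by rewrite -{1 2 3}(expn1 p) (frobB hp).
have mo : mono b (fun k => o k) = 1.
  by rewrite -(mono0 b); apply: eq_mono => k; rewrite ffunE /= mod0n.
pose c i := g i - (if i == o then z else 0).
have hc : \sum_i c i ^+ p * \prod_(k < r) b k ^+ i k = 0.
  rewrite (eq_bigr (fun i : {ffun 'I_r -> 'I_p} => g i ^+ p * mono b (fun k => i k)
        - (if i == o then z else 0) ^+ p * mono b (fun k => i k))); last first.
    by move=> i _; rewrite fB mulrBl.
  rewrite sumrB -eqz (bigD1 o) //= eqxx mo mulr1 big1 ?addr0 ?subrr // => i /negbTE ->.
  by rewrite f0 mul0r.
have := hind hc o; rewrite /c eqxx => /eqP; rewrite subr_eq0 => /eqP <-.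
exact: hg.
Qed.

Lemma powgen_roots M k (z : F) :
  in_powgen (p ^ (M + k))%N b (z ^+ (p ^ k)%N) -> in_powgen (p ^ M)%N b z.
Proof.
elim: k z => [|k IH] z; first by rewrite addn0 expn0 expr1.
by rewrite addnS [(p ^ k.+1)%N]expnSr exprM => /powgen_root /IH.
Qed.

(** Induction on [t] by base-[p] digits: terms are grouped by their exponents modulo [p],
    independence kills each group, and inside a group the quotients by [p] are again distinct. The
    index type is free because the lemma serves both for a full box of exponents and for exponents
    stretched by powers of [p]. *)
Lemma pindep_pow t (T : eqType) (s : seq T) (e : T -> 'I_r -> nat) (Phi : T -> F) :
  uniq s -> {in s, forall x k, (e x k < p ^ t)%N} ->
  {in s &, forall x y, e x =1 e y -> x = y} ->
  \sum_(x <- s) Phi x ^+ (p ^ t)%N * mono b (e x) = 0 -> {in s, forall x, Phi x = 0}.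
Proof.
elim: t s e => [|t IH] s e us lt inj sum0 x xs.
  have e0 y : y \in s -> y = x.
    move=> ys; apply: inj => // k.
    by move: (lt _ ys k) (lt _ xs k); rewrite expn0 !ltnS !leqn0 => /eqP -> /eqP ->.
  move: sum0; rewrite (bigD1_seq x) //= big_seq_cond big1 ?addr0; last first.
    by move=> y /andP[ys]; rewrite (e0 y ys) eqxx.
  rewrite expn0 expr1 (@eq_mono _ _ _ _ (fun=> 0%N)) ?mono0 ?mulr1 // => k.
  by move: (lt _ xs k); rewrite expn0 ltnS leqn0 => /eqP.
pose dv y k := (e y k %/ p)%N.
pose cl (rho : {ffun 'I_r -> 'I_p}) := [seq y <- s | modexp (e y) == rho].
pose c rho := \sum_(y <- cl rho) Phi y ^+ (p ^ t)%N * mono b (dv y).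
have hc : \sum_rho c rho ^+ p * \prod_(k < r) b k ^+ rho k = 0.
  rewrite -[RHS]sum0 [RHS](partition_big (fun y => modexp (e y)) xpredT) //=.
  apply: eq_bigr => rho _; rewrite /c /cl big_filter.
  rewrite -[X in _ ^+ X](expn1 p) (frob_sum hp) big_distrl /=.
  apply: eq_bigr => y /eqP <-.
  by rewrite expn1 exprMn -exprM -expnSr (mono_modexp (e y)) mulrA.
apply: (IH (cl (modexp (e x))) dv).
- exact: filter_uniq.
- move=> y; rewrite mem_filter => /andP[_ ys] k.
  by rewrite /dv ltn_divLR // -expnSr; apply: lt.
- move=> y z; rewrite !mem_filter => /andP[/eqP hy ys] /andP[/eqP hz zs] hdv.
  apply: inj => // k; rewrite (divn_eq (e y k) p) (divn_eq (e z k) p) -/(dv y k) hdv.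
  congr (_ + _)%N; move/ffunP/(_ k): hy; move/ffunP/(_ k): hz; rewrite !ffunE.
  by move=> /(congr1 val) /= -> /(congr1 val) /= ->.
- exact: (hind hc (modexp (e x))).
- by rewrite mem_filter eqxx.
Qed.

End PowGen.

(** * Derivations as graphs *)

Section RadicalAdjunction.
Variables (E : fieldType) (K : E -> Prop) (hK : is_subfield K).

Definition coefs_in (P : {poly E}) := forall i, K P`_i.

Lemma coefs_inB P Q : coefs_in P -> coefs_in Q -> coefs_in (P - Q).
Proof. by move=> hP hQ i; rewrite coefB; apply: (subfieldB hK). Qed.

Lemma coefs_inM P Q : coefs_in P -> coefs_in Q -> coefs_in (P * Q).
Proof.
move=> hP hQ i; rewrite coefM; apply: (subfield_sum hK) => j _.
exact: (subfieldM hK).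
Qed.

Lemma coefs_inC c : K c -> coefs_in c%:P.
Proof. by move=> hc i; rewrite coefC; case: ifP => // _; apply: (subfield0 hK). Qed.

Lemma coefs_inXn n : coefs_in 'X^n.
Proof. by move=> i; rewrite coefXn; apply: (subfield_nat hK). Qed.

(** Division in [K[X]], carried out in [{poly E}] because [K] is only a predicate; [T] cancels the
    top coefficient. Only the remainder is reused, so only its coefficients are tracked. *)
Lemma monic_division (Q A : {poly E}) : Q \is monic -> coefs_in Q -> coefs_in A ->
  exists S B, [/\ coefs_in B, A = S * Q + B & (size B < size Q)%N].
Proof.
move=> mQ hQ; have [m sQ] : exists m, size Q = m.+1.
  by exists (size Q).-1; rewrite prednK // size_poly_gt0 monic_neq0.
move: {2}(size A) (leqnn (size A)) => n; elim: n A => [|n IH] A sA hA.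
  by exists 0, A; split => //; [rewrite mul0r add0r | rewrite sQ ltnS (leq_trans sA)].
case: (ltnP n m) => [nm|mn].
  by exists 0, A; split => //; [rewrite mul0r add0r | rewrite sQ ltnS (leq_trans sA)].
pose T := (A`_n)%:P * 'X^(n - m).
case: (IH (A - T * Q)).
- apply/leq_sizeP => j nj; rewrite coefB /T -mulrA coefCM coefXnM ltnNge.
  rewrite (leq_trans (leq_subr _ _) nj) /=.
  case: (ltngtP n j) nj => // [nj _|<- _].
    rewrite (nth_default _ (leq_trans sA nj)) [Q`_ _]nth_default ?mulr0 ?subrr //.
    by rewrite sQ ltn_subRL subnK.
  rewrite subKn //.
    have := monicP mQ; rewrite /lead_coef sQ /= => ->.
    by rewrite mulr1 subrr.
- apply: (coefs_inB hA (coefs_inM (coefs_inM (coefs_inC (hA n)) (coefs_inXn _)) hQ)).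
move=> S [B [hB eqA sB]]; exists (S + T), B; split=> //.
by rewrite mulrDl addrAC -eqA subrK.
Qed.

Variables (p : nat) (hp : p \in [pchar E]) (a : E).
Hypotheses (Kap : K (a ^+ p)) (nKa : ~ K a).

(** A monic relation [Q] of least degree divides [X^p - a^p = (X - a)^p], so it is [(X - a)^k] with
    [0 < k < p]. Its coefficient in degree [k - 1] is [- k a], and [k] is invertible, which would
    put [a] in [K]. Minimality comes from the induction on the size, which kills the remainder of
    the division. *)
Lemma radical_free (P : {poly E}) : coefs_in P -> (size P <= p)%N -> P.[a] = 0 -> P = 0.
Proof.
move: {2}(size P) (leqnn (size P)) => n; elim: n P => [|n IH] P sP hP spP Pa0.
  by apply/eqP; rewrite -size_poly_leq0.
apply: contrapT => /eqP P0.
pose Q := (lead_coef P)^-1%:P * P.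
have lP0 : (lead_coef P)^-1 != 0 by rewrite invr_eq0 lead_coef_eq0.
have sQ : size Q = size P by rewrite /Q size_Cmul.
have mQ : Q \is monic.
  by apply/monicP; rewrite /Q lead_coefM lead_coefC mulVf // lead_coef_eq0.
have hQ : coefs_in Q.
  exact: (coefs_inM (coefs_inC (subfieldV hK (hP _))) hP).
have Qa0 : Q.[a] = 0 by rewrite hornerM Pa0 mulr0.
have Xp : 'X^p - (a ^+ p)%:P = ('X - a%:P) ^+ p :> {poly E}.
  have hp' : p \in [pchar {poly E}] by rewrite (rmorph_pchar (@polyC E)).
  have := exprDn_pchar 'X (- a%:P) (n := p) (R := {poly E}).
  rewrite pnatE ?(pcharf_prime hp) // => /(_ hp') ->; rewrite polyC_exp; congr (_ + _).
  apply/eqP; rewrite -subr_eq0 -opprD -polyC_exp -polyCN -polyC_exp -polyCD.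
  by rewrite -{2}(expn1 p) (frobN hp) expn1 subrr oppr0.
have [S [B [hB eqB sB]]] : exists S B,
    [/\ coefs_in B, 'X^p - (a ^+ p)%:P = S * Q + B & (size B < size Q)%N].
  exact: (monic_division mQ hQ (coefs_inB (coefs_inXn p) (coefs_inC Kap))).
have B0 : B = 0.
  apply: IH => //.
  - by rewrite -ltnS (leq_trans sB) // sQ.
  - by rewrite (leq_trans (ltnW sB)) // sQ.
  - move/(congr1 (horner^~ a)): eqB; rewrite [RHS]hornerD hornerM Qa0 mulr0 add0r => <-.
    by rewrite hornerD hornerN hornerC hornerXn subrr.
have /dvdp_exp_XsubCP [k kp] : Q %| ('X - a%:P) ^+ p.
  by rewrite -Xp eqB B0 addr0 dvdp_mull.
rewrite eqp_monic ?monic_exp ?monicXsubC // => /eqP Qk.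
have k0 : k != 0%N.
  apply/eqP => k0; move: Qa0; rewrite Qk k0 expr0 hornerE => /eqP.
  by rewrite oner_eq0.
have kltp : (k < p)%N.
  by move: spP; rewrite -sQ Qk size_exp_XsubC.
have := @coefPn_prod_XsubC _ (nseq k a); rewrite size_nseq => /(_ k0).
rewrite !big_nseq iter_addr_0 iter_mulr_1 => eqc.
have : K (- (a *+ k)).
  have -> : - (a *+ k) = Q`_k.-1.
    by rewrite -eqc Qk.
  exact: hQ.
move=> /(subfieldN hK); rewrite opprK -mulr_natr => Kak; apply: nKa.
have kn0 : k%:R != 0 :> E.
  rewrite -(dvdn_pcharf hp); apply/negP => /dvdn_leq; rewrite lt0n k0 => /(_ isT).
  by rewrite leqNgt kltp.
rewrite -(mulfK kn0 a); apply: (subfieldM hK) => //; apply: (subfieldV hK).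
exact: subfield_nat.
Qed.

End RadicalAdjunction.

(* A derivation defined on a subring of [E] is encoded by its graph, i.e. a
   subring of the dual numbers [E[eps]] on which the projection to [E] is injective. *)
Definition der_graph (E : fieldType) (R : E -> E -> Prop) : Prop :=
  [/\ R 1 0, (forall x u y v, R x u -> R y v -> R (x - y) (u - v)),
      (forall x u y v, R x u -> R y v -> R (x * y) (x * v + y * u)) &
      (forall u, R 0 u -> u = 0)].

Definition dom (E : fieldType) (R : E -> E -> Prop) (x : E) : Prop := exists u, R x u.

Section Graphs.
Variables (E : fieldType) (p : nat) (hp : p \in [pchar E]).
Variable R : E -> E -> Prop.
Hypothesis hR : der_graph R.

Lemma graph1 : R 1 0. Proof. by case: hR. Qed.
Lemma graphB x u y v : R x u -> R y v -> R (x - y) (u - v). Proof. by case: hR => _ h _ _; apply: h. Qed.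
Lemma graphM x u y v : R x u -> R y v -> R (x * y) (x * v + y * u).
Proof. by case: hR => _ _ h _; apply: h. Qed.
Lemma graph_fun0 u : R 0 u -> u = 0. Proof. by case: hR => _ _ _; apply. Qed.
Lemma graph0 : R 0 0. Proof. by rewrite -{1}(subrr 1) -{1}(subrr 0); apply: graphB; apply: graph1. Qed.
Lemma graphN x u : R x u -> R (- x) (- u).
Proof. by move=> h; rewrite -(sub0r x) -(sub0r u); apply: graphB => //; apply: graph0. Qed.
Lemma graphD x u y v : R x u -> R y v -> R (x + y) (u + v).
Proof. by move=> h h'; rewrite -[y]opprK -[v]opprK; apply: graphB => //; apply: graphN. Qed.
Lemma graph_fun x u v : R x u -> R x v -> u = v.
Proof.
by move=> h h'; apply/eqP; rewrite -subr_eq0; apply/eqP/graph_fun0; rewrite -(subrr x); apply: graphB.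
Qed.
Lemma graph_sum (I : Type) (s : seq I) (P : pred I) (g d : I -> E) :
  (forall i, P i -> R (g i) (d i)) -> R (\sum_(i <- s | P i) g i) (\sum_(i <- s | P i) d i).
Proof. by move=> h; elim/big_ind2: _ => //; [apply: graph0|move=> *; apply: graphD]. Qed.
Lemma dom_subfield : (forall x, dom R x -> exists n, (0 < n)%N /\ dom R (x ^+ n)^-1) ->
  is_subfield (dom R).
Proof.
move=> hV.
have D1 : dom R 1 by exists 0; apply: graph1.
have DB x y : dom R x -> dom R y -> dom R (x - y).
  by move=> [u h] [v h']; exists (u - v); apply: graphB.
have DM x y : dom R x -> dom R y -> dom R (x * y).
  by move=> [u h] [v h']; exists (x * v + y * u); apply: graphM.
split=> // [|x hx]; first by exists 0; apply: graph0.
case: (hV _ hx) => n [n0 hn].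
case: (eqVneq x 0) => [->|x0]; first by rewrite invr0; exists 0; apply: graph0.
have DX k : dom R (x ^+ k) by elim: k => [//|k IH]; rewrite exprS; apply: DM.
suff -> : x^-1 = x ^+ n.-1 * (x ^+ n)^-1 by apply: DM.
by rewrite -{2}(prednK n0) exprS invfM mulrCA mulfV ?mulr1 // expf_neq0.
Qed.

(** With [Q] carrying the derivatives of the coefficients of [P], this is the Leibniz rule for
    [P.[a]] when [a] is given the derivative [e]. *)
Definition adj (a e x u : E) : Prop := exists P Q : {poly E},
  [/\ forall i, R P`_i Q`_i, x = P.[a] & u = Q.[a] + P^`().[a] * e].

Variables (a e : E).
Hypotheses (hdom : is_subfield (dom R)) (Rap : R (a ^+ p) 0) (nRa : ~ dom R a).

(** Replacing [X^p] by the constant [a ^+ p] changes none of the three values: [X^p] has derivative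
    zero in characteristic [p], and [a ^+ p] has derivative 0 in [R], so pairs of coefficients stay
    in [R]. Degrees below [p] are what [radical_free] can treat. *)
Lemma adj_reduce (P Q : {poly E}) : (forall i, R P`_i Q`_i) ->
  exists P1 Q1 : {poly E}, [/\ forall i, R P1`_i Q1`_i, (size P1 <= p)%N,
    P1.[a] = P.[a], Q1.[a] = Q.[a] & P1^`().[a] = P^`().[a]].
Proof.
move: {2}(size P) (leqnn (size P)) => n.
elim: n P Q => [|n IH] P Q sP h; first by exists P, Q; split=> //; apply: leq_trans sP _.
case: (leqP (size P) p) => [sp|ps]; first by exists P, Q.
pose c := a ^+ p.
pose red (A : {poly E}) := take_poly p A + c *: drop_poly p A.
have redE A : (red A).[a] = A.[a].
  by rewrite -{2}(poly_take_drop p A) !hornerE mulrC.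
have redD A : (red A)^`().[a] = A^`().[a].
  have d0 : ('X^p : {poly E})^`() = 0.
    by rewrite derivXn -mulr_natr -polyC_natr (pcharf0 hp) polyC0 mulr0.
  rewrite -{2}(poly_take_drop p A) !derivD derivM derivZ d0 mulr0 addr0.
  by rewrite !hornerE mulrC.
have p0 := pchar_gt0 hp.
case: (IH (red P) (red Q)).
- rewrite /red; apply: (leq_trans (size_polyD _ _)); rewrite geq_max.
  rewrite (leq_trans (size_take_poly _ _)) /=; last by rewrite -ltnS (leq_trans ps).
  apply: (leq_trans (size_scale_leq _ _)); rewrite size_drop_poly leq_subLR.
  by apply: (leq_trans sP); rewrite -add1n leq_add2r.
- move=> i; rewrite !coefD !coefZ !coef_take_poly !coef_drop_poly.
  apply: graphD; first by case: ifP => _ //; apply: graph0.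
  by have := graphM Rap (h (i + p)%N); rewrite mulr0 addr0.
by move=> P1 [Q1 [h1 s1 e1 e2 e3]]; exists P1, Q1; split=> //; rewrite ?e1 ?e2 ?e3 ?redE ?redD.
Qed.

Lemma adj_sub x u : R x u -> adj a e x u.
Proof.
move=> h; exists x%:P, u%:P; split; rewrite ?hornerC //.
  by move=> i; rewrite !coefC; case: ifP => _ //; apply: graph0.
by rewrite derivC horner0 mul0r addr0.
Qed.

Lemma adj_gen : adj a e a e.
Proof.
exists 'X, 0; split; rewrite ?hornerX //; last by rewrite derivX !hornerE.
by move=> i; rewrite coefX coef0; case: (i == _); [apply: graph1|apply: graph0].
Qed.

Lemma adj_graph : der_graph (adj a e).
Proof.
split.
- by apply: adj_sub; apply: graph1.
- move=> x u y v [P [Q [h -> ->]]] [P' [Q' [h' -> ->]]]; exists (P - P'), (Q - Q'); split.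
  + by move=> i; rewrite !coefB; apply: graphB.
  + by rewrite !hornerE.
  + by rewrite derivB !hornerE; ring.
- move=> x u y v [P [Q [h -> ->]]] [P' [Q' [h' -> ->]]].
  exists (P * P'), (P * Q' + P' * Q); split.
  + move=> i; rewrite [P' * Q]mulrC coefD !coefM -big_split /=; apply: graph_sum => j _.
    by rewrite [Q`_j * _]mulrC; apply: graphM.
  + by rewrite hornerE.
  + by rewrite derivM !hornerE; ring.
- move=> u [P [Q [h eqP ->]]].
  have [P1 [Q1 [h1 s1 e1 e2 e3]]] := adj_reduce h.
  have P10 : P1 = 0.
    apply: (radical_free hdom hp _ nRa) => //; first by exists 0.
    - by move=> i; exists (Q1`_i).
    - by rewrite e1.
  rewrite -e2 -e3 P10 derivC horner0 mul0r addr0.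
  suff -> : Q1 = 0 by rewrite horner0.
  apply/polyP => i; rewrite coef0; apply: graph_fun0.
  by have := h1 i; rewrite P10 coef0.
Qed.

Lemma adj_pow x : dom (adj a e) x -> dom R (x ^+ p).
Proof.
move=> [u [P [Q [h -> _]]]]; rewrite horner_coef -[X in _ ^+ X](expn1 p) (frob_sum hp).
apply: (subfield_sum hdom) => i _; rewrite expn1 exprMn -exprM mulnC exprM.
apply: (subfieldM hdom); apply: (subfieldX hdom); last by exists 0.
by exists Q`_i.
Qed.

Lemma adj_dom : is_subfield (dom (adj a e)).
Proof.
split.
- by exists 0; apply: adj_sub; apply: graph0.
- by exists 0; apply: adj_sub; apply: graph1.
- move=> x y [u h] [v h']; exists (u - v); case: adj_graph => _ H _ _; exact: H.
- move=> x y [u h] [v h']; exists (x * v + y * u); case: adj_graph => _ _ H _; exact: H.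
- move=> x hx.
  case: (eqVneq x 0) => [->|x0]; first by rewrite invr0; exists 0; apply: adj_sub; apply: graph0.
  have p0 := pchar_gt0 hp.
  have -> : x^-1 = x ^+ p.-1 * (x ^+ p)^-1.
    by rewrite -{2}(prednK p0) exprS invfM mulrCA mulfV ?mulr1 // expf_neq0.
  have [v hv] : dom R (x ^+ p)^-1 by apply: (subfieldV hdom); apply: adj_pow.
  have [u hu] : dom (adj a e) (x ^+ p.-1).
    elim: p.-1 => [|n [u hu]]; first by exists 0; apply: adj_sub; apply: graph1.
    case: hx => w hw; rewrite exprS; exists (x * u + x ^+ n * w).
    by case: adj_graph => _ _ H _; apply: H.
  exists (x ^+ p.-1 * v + (x ^+ p)^-1 * u).
  by case: adj_graph => _ _ H _; apply: H => //; apply: adj_sub.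
Qed.

End Graphs.

Definition derivation (F E : fieldType) (f D : F -> E) : Prop :=
  (forall x y, D (x + y) = D x + D y) /\ (forall x y, D (x * y) = f x * D y + f y * D x).

Section Derivations.
Variables (p : nat) (F E : fieldType) (hp : p \in [pchar F]).
Variables (f : {rmorphism F -> E}) (D : F -> E).
Hypothesis hD : derivation f D.

Lemma derD x y : D (x + y) = D x + D y. Proof. by case: hD. Qed.
Lemma derM x y : D (x * y) = f x * D y + f y * D x. Proof. by case: hD. Qed.
Lemma der0 : D 0 = 0.
Proof. by apply: (addrI (D 0)); rewrite -derD !addr0. Qed.
Lemma der1 : D 1 = 0.
Proof. by apply: (addrI (D 1)); rewrite addr0 -{3}(mulr1 1) derM rmorph1 !mul1r. Qed.
Lemma derN x : D (- x) = - D x.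
Proof. by apply/eqP; rewrite -addr_eq0 -derD addNr der0. Qed.
Lemma derB x y : D (x - y) = D x - D y.
Proof. by rewrite derD derN. Qed.
Lemma der_sum (I : Type) (s : seq I) (P : pred I) (g : I -> F) :
  D (\sum_(i <- s | P i) g i) = \sum_(i <- s | P i) D (g i).
Proof. exact: (big_morph D derD der0). Qed.
Lemma derX x n : D (x ^+ n) = f x ^+ n.-1 *+ n * D x.
Proof.
elim: n => [|n IH]; first by rewrite der1 mul0r.
rewrite exprS derM IH; case: n {IH} => [|n] /=.
  by rewrite expr0 rmorph1 mulr0n mul0r mulr0 add0r.
by rewrite mulrA mulrnAr -exprS rmorphXn [in RHS]mulrSr mulrDl.
Qed.
Lemma derXp x : D (x ^+ p) = 0.
Proof. by rewrite derX -mulr_natr -(rmorph_nat f) (pcharf0 hp) rmorph0 mulr0 mul0r. Qed.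
Lemma derXpn x n : (0 < n)%N -> D (x ^+ (p ^ n)%N) = 0.
Proof. by case: n => // n _; rewrite expnSr exprM derXp. Qed.
Lemma der_sign n x : D ((-1) ^+ n * x) = (-1) ^+ n * D x.
Proof.
rewrite -(signr_odd F) -(signr_odd E); case: (odd n); rewrite /= ?expr1 ?expr0.
  by rewrite !mulN1r derN.
by rewrite !mul1r.
Qed.

Lemma der_kernel : is_subfield (fun x => D x = 0).
Proof.
split.
- exact: der0.
- exact: der1.
- by move=> x y hx hy; rewrite derB hx hy subrr.
- by move=> x y hx hy; rewrite derM hx hy !mulr0 addr0.
- move=> x hx; case: (eqVneq x 0) => [->|x0]; first by rewrite invr0 der0.
  have := derM x x^-1; rewrite mulfV // der1 hx mulr0 addr0 => /eqP.
  by rewrite eq_sym mulf_eq0 fmorph_eq0 (negbTE x0) /= => /eqP.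
Qed.

Lemma derV x : x != 0 -> D x^-1 = - f x ^- 2 * D x.
Proof.
move=> x0; have fx0 : f x != 0 by rewrite fmorph_eq0.
apply: (mulfI fx0); have := derM x x^-1; rewrite mulfV // der1 fmorphV => /eqP.
rewrite eq_sym addr_eq0 => /eqP ->; rewrite expr2 invfM !mulNr mulrN !mulrA mulfV //.
by rewrite mul1r.
Qed.

Lemma der_powgen0 q r (b : 'I_r -> F) : (forall z, D (z ^+ q) = 0) -> (forall k, D (b k) = 0) ->
  forall x, in_powgen q b x -> D x = 0.
Proof.
move=> hq hb x; apply: (gen_field_min der_kernel) => y [[z ->]|[k ->]]; first exact: hq.
exact: hb.
Qed.

End Derivations.

Lemma der_comp (F E : fieldType) (f : {rmorphism F -> E}) D :
  derivation idfun D -> derivation f (D \o f : F -> E).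
Proof. by move=> [hD hM]; split=> x y /=; rewrite ?rmorphD ?rmorphM ?hD ?hM. Qed.

Lemma der_compl (F E : fieldType) (f : {rmorphism F -> E}) D :
  derivation idfun D -> derivation f (f \o D : F -> E).
Proof. by move=> [hD hM]; split=> x y /=; rewrite ?hD ?hM ?rmorphD ?rmorphM. Qed.

Lemma der_lincomb (F E : fieldType) (f : {rmorphism F -> E}) (I : Type) (s : seq I)
  (c : I -> E) (D : I -> F -> E) : (forall i, derivation f (D i)) ->
  derivation f (fun x => \sum_(i <- s) c i * D i x).
Proof.
move=> hD; split=> x y.
  by rewrite -big_split; apply: eq_bigr => i _; rewrite (derD (hD i)) mulrDr.
rewrite !mulr_sumr -big_split; apply: eq_bigr => i _; rewrite (derM (hD i)) mulrDr.
by congr (_ + _); rewrite mulrCA.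
Qed.

Lemma der_subZ (F E : fieldType) (f : {rmorphism F -> E}) (c : E) (D D' : F -> E) :
  derivation f D -> derivation f D' -> derivation f (fun x => D x - c * D' x).
Proof.
move=> hD hD'; split=> x y; first by rewrite (derD hD) (derD hD'); ring.
by rewrite (derM hD) (derM hD'); ring.
Qed.

Lemma der_scale (F E : fieldType) (f : {rmorphism F -> E}) (c : E) (D : F -> E) :
  derivation f D -> derivation f (fun x => c * D x).
Proof.
move=> hD; split=> x y; first by rewrite (derD hD) mulrDr.
by rewrite (derM hD); ring.
Qed.

(** * Existence of derivations: Zorn's lemma and towers of radicals *)

Section Extension.
Variables (p : nat) (E : fieldType) (hp : p \in [pchar E]).

Lemma graph_total (R : E -> E -> Prop) : der_graph R -> (forall x, dom R x) ->
  exists D : E -> E, derivation idfun D /\ forall x u, R x u -> D x = u.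
Proof.
move=> hR tot; have [D hD] := choice tot.
exists D; split=> [|x u h]; last exact: (graph_fun hR (hD x) h).
split=> x y; apply: (graph_fun hR (hD _)).
  by apply: (graphD hR).
by apply: (graphM hR).
Qed.

Lemma graph_extend (R : E -> E -> Prop) : der_graph R -> (forall x, R (x ^+ p) 0) ->
  exists D : E -> E, derivation idfun D /\ forall x u, R x u -> D x = u.
Proof.
move=> hR Rp.
(* Joining [R] to every candidate makes [R] itself the bound of the empty chain; for the same reason
   [C'] adds the empty set to the chain. *)
pose U (A : set (E * E)) x u := R x u \/ A (x, u).
have [|A [gA maxA]] := @Zorn_bigcup _ (fun A => der_graph (U A)).
  move=> C CG tot.
  pose C' := fun X : set (E * E) => C X \/ X = set0.
  have gC X : C' X -> der_graph (U X).
    move=> [/CG //|->].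
    split=> [|x u y v [h|[]] [h'|[]]|x u y v [h|[]] [h'|[]]|u [h|[]]] //.
    - by left; apply: graph1.
    - by left; apply: graphB.
    - by left; apply: graphM.
    - exact: (graph_fun0 hR h).
  have one x u : U (\bigcup_(X in C) X)%classic x u -> exists2 X, C' X & U X x u.
    move=> [h|[X CX h]]; first by exists set0; [right|left].
    by exists X; [left|right].
  have two x u y v : U (\bigcup_(X in C) X)%classic x u -> U (\bigcup_(X in C) X)%classic y v ->
      exists X, [/\ C' X, U X x u & U X y v].
    move=> /one [X hX hx] /one [Y hY hy].
    have sub (A B : set (E * E)) z w : (A `<=` B)%classic -> U A z w -> U B z w.
      by move=> AB [h|h]; [left|right; apply: AB].
    case: (hX) => [CX|X0].
      case: (hY) => [CY|Y0].
        case: (tot _ _ CX CY) => XY; first by exists Y; split=> //; apply: sub XY _.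
        by exists X; split=> //; apply: sub XY _.
      by exists X; split=> //; apply: sub hy; rewrite Y0.
    by exists Y; split=> //; apply: sub hx; rewrite X0.
  have up X x u : C' X -> U X x u -> U (\bigcup_(X in C) X)%classic x u.
    by move=> [CX|->] [h|h]; [left|right; exists X|left|case: h].
  split.
  - by left; apply: graph1.
  - by move=> x u y v /two h /h [X [/[dup] cX /gC gX h1 h2]]; apply: (up _ _ _ cX); apply: (graphB gX).
  - by move=> x u y v /two h /h [X [/[dup] cX /gC gX h1 h2]]; apply: (up _ _ _ cX); apply: (graphM gX).
  - by move=> u /one [X /gC gX h]; apply: (graph_fun0 gX h).
have sdom : is_subfield (dom (U A)).
  apply: (dom_subfield gA) => x _; exists p; split; first exact: (pchar_gt0 hp).
  by exists 0; left; rewrite -exprVn.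
case: (pselect (forall x, dom (U A) x)) => [tot|].
  by have [D [hD hDU]] := graph_total gA tot; exists D; split=> // x u h; apply: hDU; left.
move=> /existsNP [a na].
pose B : set (E * E) := [set z : E * E | adj (U A) a 0 z.1 z.2]%classic.
have Uap : U A (a ^+ p) 0 by left.
have gB : der_graph (adj (U A) a 0) by apply: (adj_graph hp).
case: (maxA B).
  split=> [[x u] h|BA]; first by apply: (adj_sub gA); right.
  by apply: na; exists 0; right; apply: BA; apply: (adj_gen gA).
have sR x u : U B x u -> adj (U A) a 0 x u.
  by move=> [h|//]; apply: (adj_sub gA); left.
split.
- by right; apply: (graph1 gB).
- by move=> x u y v /sR h /sR h'; right; apply: (graphB gB).
- by move=> x u y v /sR h /sR h'; right; apply: (graphM gB).
- by move=> u /sR; apply: (graph_fun0 gB).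
Qed.

(** The zero derivation on [K] is first extended to [a] with value 1, which is possible since
    [a ^+ p] lies in [K] and [a] does not, and then to all of [E]. *)
Lemma der_separate (K : E -> Prop) (a : E) : is_subfield K -> (forall x, K (x ^+ p)) -> ~ K a ->
  exists D : E -> E, [/\ derivation idfun D, forall x, K x -> D x = 0 & D a = 1].
Proof.
move=> hK Kp nKa; pose R x u := K x /\ u = 0 :> E.
have gR : der_graph R.
  split=> [|x u y v [h ->] [h' ->]|x u y v [h ->] [h' ->]|u []] //.
  - by split=> //; apply: (subfield1 hK).
  - by split; [apply: (subfieldB hK)|rewrite subrr].
  - by split; [apply: (subfieldM hK)|rewrite !mulr0 addr0].
have dR x : dom R x -> K x by move=> [u []].
have hdom : is_subfield (dom R).
  apply: (dom_subfield gR) => x /dR hx; exists 1%N; split=> //; exists 0; split=> //.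
  by rewrite expr1; apply: (subfieldV hK).
have Rap : R (a ^+ p) 0 by [].
have nRa : ~ dom R a by move/dR.
have gA := adj_graph hp gR 1 hdom Rap nRa.
have [|D [hD hDR]] := graph_extend gA.
  by move=> x; apply: (adj_sub gR).
exists D; split=> // [x hx|]; first by apply: hDR; apply: (adj_sub gR).
by apply: hDR; apply: (adj_gen gR).
Qed.

(** The radicals are adjoined from the bottom, [a1] first, with derivative 0. A [p]-th root of [a1]
    in the enlarged domain has its [p]-th power in the old one by [adj_pow], so [a1] would already
    have been there; thus the absence of roots is inherited by the next level. *)
Lemma graph_tower s (R : E -> E -> Prop) (a : E) :
  der_graph R -> is_subfield (dom R) -> R (a ^+ (p ^ s)%N) 0 ->
  (forall z, dom R z -> z ^+ p <> a ^+ (p ^ s)%N) ->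
  exists R' : E -> E -> Prop, [/\ der_graph R', forall x u, R x u -> R' x u, R' a 0 &
    is_subfield (dom R')].
Proof.
elim: s R => [|s IH] R gR hdom Ra noroot.
  by exists R; split=> //; move: Ra; rewrite expr1.
pose a1 := a ^+ (p ^ s)%N.
have a1p : a ^+ (p ^ s.+1)%N = a1 ^+ p by rewrite expnSr exprM.
rewrite a1p in Ra noroot.
have nRa : ~ dom R a1 by move=> /noroot.
have [|R' [g' s' r' d']] := IH (adj R a1 0) (adj_graph hp gR 0 hdom Ra nRa)
   (adj_dom hp gR 0 hdom Ra nRa) (adj_gen gR a1 0).
  move=> z /(adj_pow hp hdom Ra) h eqz.
  by apply: nRa; rewrite /a1 -eqz.
by exists R'; split=> // x u h; apply: s'; apply: (adj_sub gR).
Qed.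

End Extension.

Definition dual_system (F : fieldType) N (c : 'I_N -> F) (D : 'I_N -> F -> F) : Prop :=
  (forall k, derivation idfun (D k)) /\ (forall k l, D k (c l) = (k == l)%:R).

Section FiniteBases.
Variables (p : nat) (F : fieldType) (hp : p \in [pchar F]).

(** [der_separate] yields the derivation dual to [b k] once [b k] is outside the field generated by
    the [p]-th powers and the other [b l]; an expression for [b k] in that field would be a linear
    relation between monomials. *)
Lemma pindep_dual r (b : 'I_r -> F) : pindep p b -> exists D, dual_system b D.
Proof.
move=> hind; have p1 : (1 < p)%N := prime_gt1 (pcharf_prime hp).
have f0 : (0 : F) ^+ p = 0 by rewrite -(expn1 p) (frob0 hp).
have fB (u v : F) : (u - v) ^+ p = u ^+ p - v ^+ p by rewrite -{1 2 3}(expn1 p) (frobB hp).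
have hd k : exists D, derivation idfun D /\ forall l, D (b l) = (k == l)%:R.
  pose K := gen_field (fun y => (exists z, y = z ^+ p) \/ exists2 l, l != k & y = b l).
  have hK : is_subfield K by apply: gen_fieldP.
  have nK : ~ K (b k).
    move=> h.
    (* Setting entry [k] to 0 removes [b k] from the generators but keeps the index type, so that
       [powgen_coords] applies. Monomials involving index [k] vanish at [b'], whence the test in
       [c]. *)
    pose b' (l : 'I_r) := if l == k then 0 else b l.
    have hb' : in_powgen (p ^ 1)%N b' (b k).
      apply: (gen_field_min (powgenP _ _)) h => y [[z ->]|[l lk ->]].
        by rewrite -[X in _ ^+ X](expn1 p); apply: powgen_pow.
      by have := @powgen_gen _ _ b' (p ^ 1)%N l; rewrite /b' (negbTE lk).
    have [g [_ eqb]] := powgen_coords hp hb'.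
    pose e := modexp hp (fun l => (l == k) : nat).
    have ek : e k = 1%N :> nat by rewrite ffunE /= eqxx modn_small.
    pose c (i : {ffun 'I_r -> 'I_p}) := (if (i k : nat) == 0%N then g i else 0) - (i == e)%:R.
    suff /(_ e) : forall i, c i = 0.
      by rewrite /c ek /= eqxx sub0r => /eqP; rewrite oppr_eq0 oner_eq0.
    apply: hind.
    rewrite (eq_bigr (fun i : {ffun 'I_r -> 'I_p} => g i ^+ p * mono b' (fun l => i l)
          - (i == e)%:R * mono b (fun l => i l))); last first.
      move=> i _; rewrite /c fB mulrBl; congr (_ - _); last first.
        by case: (i == e); rewrite ?expr1n ?f0.
      case: (eqVneq (i k : nat) 0%N) => [ik|ik].
        congr (_ * _); apply: eq_bigr => l _; rewrite /b'.
        by case: (eqVneq l k) => [->|//]; rewrite ik !expr0.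
      rewrite f0 mul0r /mono (bigD1 k) //= /b' eqxx expr0n (negbTE ik).
      by rewrite mul0r mulr0.
    rewrite sumrB -eqb (bigD1 e) //= eqxx mul1r big1 ?addr0; last first.
      by move=> i /negbTE ->; rewrite mul0r.
    rewrite -[b k](mono_delta b k); apply/eqP; rewrite subr_eq0; apply/eqP.
    by apply: eq_mono => l; rewrite ffunE /= modn_small //; case: (_ == _) => //; apply: ltnW.
  have [|D [hD hDK hDb]] := der_separate hp hK _ nK.
    by move=> x; apply: mem_gen_field; left; exists x.
  exists D; split=> // l; case: (eqVneq k l) => [<- //|kl].
  by apply: hDK; apply: mem_gen_field; right; exists l => //; rewrite eq_sym.
by have [D hD] := choice hd; exists D; split=> [k|k l]; case: (hD k).
Qed.

(** [D0] is dual to the new element [x] and kills the [c l]; subtracting [D l x * D0] from [D l]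
    makes it kill [x] and leaves its values on [c] unchanged. *)
Lemma dual_cons N (c : 'I_N -> F) D x : dual_system c D -> ~ in_powgen p c x ->
  exists (c' : 'I_N.+1 -> F) D', [/\ dual_system c' D',
    (forall (k : 'I_N) (k' : 'I_N.+1), k' = k :> nat -> c' k' = c k) & c' ord_max = x].
Proof.
move=> [hD hDc] nx.
have [|D0 [hD0 hD0c hD0x]] := der_separate hp (powgenP c p) _ nx.
  by move=> y; apply: powgen_pow.
pose c' (k : 'I_N.+1) := if unlift ord_max k is Some l then c l else x.
pose D' (k : 'I_N.+1) := if unlift ord_max k is Some l
  then fun y => D l y - D l x * D0 y else D0.
exists c', D'; split.
- split=> [k|k l]; rewrite /D'.
    by case: unliftP => [k' _|_] //; apply: (der_subZ (f := idfun)).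
  case: unliftP => [k' ->|->]; rewrite /c'; case: unliftP => [l' ->|->].
  + rewrite hDc (hD0c (c l')) ?mulr0 ?subr0; last exact: powgen_gen.
    by rewrite (inj_eq lift_inj).
  + by rewrite hD0x mulr1 subrr eq_sym (negbTE (neq_lift _ _)).
  + by rewrite hD0c ?(negbTE (neq_lift _ _)) //; apply: powgen_gen.
  + by rewrite hD0x eqxx.
- move=> k k' eqk; rewrite /c'; case: unliftP => [l eql|eql].
    by congr c; apply: val_inj; rewrite /= -eqk eql /= /bump leqNgt ltn_ord add0n.
  by move: (ltn_ord k); rewrite -eqk eql /= ltnn.
- by rewrite /c' unlift_none.
Qed.

(** A finite stand-in for a [p]-basis: the entries of [s] are adjoined one at a time, when they lie
    outside the field generated so far. The [b i] keep the first [r] positions, on which the later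
    arguments with ordered index sets rely. *)
Lemma dual_exists r (b : 'I_r -> F) (s : seq F) : pindep p b ->
  exists N (c : 'I_N -> F) D, [/\ (r <= N)%N, dual_system c D,
    (forall (i : 'I_r) (k : 'I_N), k = i :> nat -> c k = b i) &
    {in s, forall x, in_powgen p c x}].
Proof.
move=> hind; elim: s => [|x s [N [c [D [rN hD hc hs]]]]].
  have [D hD] := pindep_dual hind.
  by exists r, b, D; split=> // i k eqk; congr b; apply: val_inj.
case: (pselect (in_powgen p c x)) => [hx|nx].
  by exists N, c, D; split=> // y; rewrite inE => /orP[/eqP -> //|]; apply: hs.
have [c' [D' [hD' hc' hx]]] := dual_cons hD nx.
exists N.+1, c', D'; split=> //; first exact: leqW.
  move=> i k eqk; have iN : (i < N)%N by apply: leq_trans rN.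
  by rewrite (hc' (Ordinal iN)) //; apply: hc.
move=> y; rewrite inE => /orP[/eqP ->|/hs].
  by rewrite -hx; apply: powgen_gen.
apply: (gen_field_min (powgenP _ _)) => z [[w ->]|[k ->]]; first exact: powgen_pow.
by rewrite -(hc' k (widen_ord (leqnSn N) k)) //; apply: powgen_gen.
Qed.

End FiniteBases.

(** * The module of differential forms *)

Section Coefficients.
Variable F : fieldType.
Implicit Types (w : fsum F) (c : F) (a : seq F).

Lemma fcoef_cat w1 w2 a : fcoef (w1 ++ w2) a = fcoef w1 a + fcoef w2 a.
Proof. by rewrite /fcoef big_cat. Qed.

Lemma fcoef_scale c w a : fcoef (fscale c w) a = c * fcoef w a.
Proof. by rewrite /fcoef /fscale big_map mulr_sumr. Qed.

Lemma fscale_cat c w1 w2 : fscale c (w1 ++ w2) = fscale c w1 ++ fscale c w2.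
Proof. by rewrite /fscale map_cat. Qed.

Lemma fscale_flatten c ws : fscale c (flatten ws) = flatten (map (fscale c) ws).
Proof. by rewrite /fscale map_flatten. Qed.

Lemma fscaleA c c' w : fscale c (fscale c' w) = fscale (c * c') w.
Proof. by rewrite /fscale -map_comp; apply: eq_map => t /=; rewrite mulrA. Qed.

Lemma fdeg_cat n w1 w2 : fdeg n (w1 ++ w2) = fdeg n w1 && fdeg n w2.
Proof. exact: all_cat. Qed.

Lemma fdeg_scale n c w : fdeg n (fscale c w) = fdeg n w.
Proof. exact: all_map. Qed.

Lemma fdeg_wedge n k w1 w2 : fdeg n w1 -> fdeg k w2 -> fdeg (n + k) (fwedge w1 w2).
Proof.
move=> /allP h1 /allP h2; apply/allP => t /allpairsP [[t1 t2] [/h1 /eqP s1 /h2 /eqP s2 ->]].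
by rewrite /= size_cat s1 s2.
Qed.

Lemma fdeg_diff n w : fdeg n w -> fdeg n.+1 (fdiff w).
Proof. by rewrite /fdeg all_map. Qed.

Lemma fzero_ext n w1 w2 : fcoef w1 =1 fcoef w2 -> fzero n w1 -> fzero n w2.
Proof. by move=> h [gs [hgs eqw]]; exists gs; split=> // a; rewrite -h. Qed.

Lemma fzero_nil n : fzero (F := F) n [::].
Proof. by exists [::]. Qed.

Lemma fzero_cat n w1 w2 : fzero n w1 -> fzero n w2 -> fzero n (w1 ++ w2).
Proof.
move=> [gs [hgs eqw]] [gs' [hgs' eqw']]; exists (gs ++ gs'); split.
  by move=> g; rewrite mem_cat => /orP[/hgs|/hgs'].
by move=> a; rewrite map_cat flatten_cat !fcoef_cat eqw eqw'.
Qed.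

Lemma fzero_scale n c w : fzero n w -> fzero n (fscale c w).
Proof.
move=> [gs [hgs eqw]]; exists [seq (c * g.1, g.2) | g <- gs]; split.
  by move=> g /mapP [g' /hgs h ->].
move=> a; rewrite fcoef_scale eqw -fcoef_scale fscale_flatten -!map_comp.
by congr (fcoef (flatten _) a); apply: eq_map => g /=; rewrite fscaleA.
Qed.

Lemma fzero_rel n (g : fsum F) : Defs.frel n g -> fzero n g.
Proof.
move=> hg; exists [:: (1, g)]; split; first by move=> g'; rewrite inE => /eqP ->.
by move=> a; rewrite /= cats0 fcoef_scale mul1r.
Qed.

Lemma feq_refl n w : feq n w w.
Proof.
apply: (fzero_ext _ (fzero_nil n)) => a.
by rewrite fcoef_cat fcoef_scale mulN1r subrr /fcoef big_nil.
Qed.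

Lemma feq_sym n w1 w2 : feq n w1 w2 -> feq n w2 w1.
Proof.
move=> /(fzero_scale (-1)); apply: fzero_ext => a.
by rewrite fcoef_scale !fcoef_cat !fcoef_scale; ring.
Qed.

Lemma feq_trans n w1 w2 w3 : feq n w1 w2 -> feq n w2 w3 -> feq n w1 w3.
Proof.
move=> h /(fzero_cat h); apply: fzero_ext => a.
by rewrite !fcoef_cat !fcoef_scale; ring.
Qed.

End Coefficients.

Section Quotient.
Local Open Scope quotient_scope.
Variables (F : fieldType) (n : nat).

Definition feqb (w1 w2 : seq (F * seq F)) : bool := `[< feq n w1 w2 >].

Lemma feqb_refl : reflexive feqb.
Proof. by move=> w; apply/asboolP/feq_refl. Qed.
Lemma feqb_sym : symmetric feqb.
Proof. by move=> w1 w2; apply/asboolP/asboolP => /feq_sym. Qed.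
Lemma feqb_trans : transitive feqb.
Proof. by move=> w1 w2 w3 /asboolP h /asboolP h'; apply/asboolP/(feq_trans h h'). Qed.

Canonical feqb_equiv := EquivRel feqb feqb_refl feqb_sym feqb_trans.

Definition Omega := {eq_quot feqb_equiv}.
HB.instance Definition _ : EqQuotient _ feqb_equiv Omega := EqQuotient.on Omega.
HB.instance Definition _ := Choice.on Omega.

Definition cls (w : fsum F) : Omega := \pi_Omega (w : seq (F * seq F)).

Lemma cls_eq w1 w2 : cls w1 = cls w2 <-> feq n w1 w2.
Proof.
split=> [/eqquotP /asboolP //|h]; apply/eqquotP.
exact/asboolP.
Qed.

Lemma cls_repr (x : Omega) : cls (repr x) = x.
Proof. exact: reprK. Qed.

Lemma repr_cls w : feq n (repr (cls w)) w.
Proof. by apply/cls_eq; rewrite cls_repr. Qed.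

Lemma cls_ext w1 w2 : fcoef w1 =1 fcoef w2 -> cls w1 = cls w2.
Proof.
move=> h; apply/cls_eq; apply: (fzero_ext _ (fzero_nil F n)) => a.
by rewrite fcoef_cat fcoef_scale mulN1r h subrr /fcoef big_nil.
Qed.

Definition Oadd (x y : Omega) := cls (repr x ++ repr y).
Definition Oopp (x : Omega) := cls (fopp (repr x)).
Definition Oscale (c : F) (x : Omega) := cls (fscale c (repr x)).

Lemma cls_add w1 w2 : cls (w1 ++ w2) = Oadd (cls w1) (cls w2).
Proof.
apply/cls_eq; have h1 := repr_cls w1; have h2 := repr_cls w2.
move: (fzero_scale (-1) (fzero_cat h1 h2)); apply: fzero_ext => a.
by rewrite !(fcoef_cat, fcoef_scale); ring.
Qed.

Lemma cls_scl c w : cls (fscale c w) = Oscale c (cls w).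
Proof.
apply/cls_eq; have h1 := repr_cls w.
move: (fzero_scale (- c) h1); apply: fzero_ext => a.
by rewrite !(fcoef_cat, fcoef_scale); ring.
Qed.

Lemma OaddA : associative Oadd.
Proof.
move=> x y z; rewrite -[x]cls_repr -[y]cls_repr -[z]cls_repr -!cls_add.
by rewrite catA.
Qed.
Lemma OaddC : commutative Oadd.
Proof.
move=> x y; rewrite -[x]cls_repr -[y]cls_repr -!cls_add; apply: cls_ext => a.
by rewrite !fcoef_cat addrC.
Qed.
Lemma Oadd0 : left_id (cls [::]) Oadd.
Proof. by move=> x; rewrite -[x]cls_repr -!cls_add. Qed.
Lemma OaddN : left_inverse (cls [::]) Oopp Oadd.
Proof.
move=> x; rewrite /Oopp -[x in Oadd _ x]cls_repr -!cls_add; apply: cls_ext => a.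
by rewrite fcoef_cat fcoef_scale mulN1r addNr /fcoef big_nil.
Qed.

HB.instance Definition _ := GRing.isZmodule.Build Omega OaddA OaddC Oadd0 OaddN.

Lemma OscaleA a b (v : Omega) : Oscale a (Oscale b v) = Oscale (a * b) v.
Proof. by rewrite -[v]cls_repr -!cls_scl fscaleA. Qed.
Lemma Oscale1 : left_id 1 Oscale.
Proof. by move=> v; rewrite -[v]cls_repr -!cls_scl; apply: cls_ext => a; rewrite fcoef_scale mul1r. Qed.
Lemma OscaleDr : right_distributive Oscale +%R.
Proof.
move=> c x y; rewrite -[x]cls_repr -[y]cls_repr -[LHS]/(Oscale c (Oadd _ _)).
by rewrite -cls_add -!cls_scl -[RHS]/(Oadd _ _) -cls_add fscale_cat.
Qed.
Lemma OscaleDl (v : Omega) : {morph Oscale^~ v : a b / a + b}.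
Proof.
move=> a b /=; rewrite -[v]cls_repr -!cls_scl -[RHS]/(Oadd _ _) -cls_add.
by apply: cls_ext => s; rewrite fcoef_cat !fcoef_scale mulrDl.
Qed.

HB.instance Definition _ :=
  GRing.Zmodule_isLmodule.Build F Omega OscaleA Oscale1 OscaleDr OscaleDl.

Definition gen (a : seq F) : Omega := cls [:: (1, a)].

Lemma clsE w : cls w = \sum_(t <- w) t.1 *: gen t.2.
Proof.
elim: w => [|t w IH]; first by rewrite big_nil.
rewrite big_cons -IH -cat1s cls_add; congr (_ + _).
by rewrite /gen -[RHS]/(Oscale _ _) -cls_scl /= mulr1; case: t.
Qed.

Lemma cls0 w : fzero n w <-> cls w = 0.
Proof.
rewrite -[0 : Omega]/(cls [::]) cls_eq /feq cats0; exact: iff_refl.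
Qed.

Lemma genD u v a c : (size u + size v).+1 = n ->
  gen (u ++ (a + c) :: v) = gen (u ++ a :: v) + gen (u ++ c :: v).
Proof.
move=> /(FR_add a c)/fzero_rel/cls0; rewrite clsE !big_cons big_nil /= addr0.
by rewrite !scaleN1r scale1r => /eqP; rewrite -opprD subr_eq0 => /eqP.
Qed.

Lemma genM u v a c : (size u + size v).+1 = n ->
  gen (u ++ (a * c) :: v) = a *: gen (u ++ c :: v) + c *: gen (u ++ a :: v).
Proof.
move=> /(FR_mul a c)/fzero_rel/cls0; rewrite clsE !big_cons big_nil /= addr0.
by rewrite !scaleNr scale1r => /eqP; rewrite -opprD subr_eq0 => /eqP.
Qed.

Lemma gen_alt s : size s = n -> ~~ uniq s -> gen s = 0.
Proof.
move=> hs /(uniqPn 0) [i [j [ij js eqs]]].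
have h : Defs.frel n [:: (1, s)] by apply: (FR_alt hs _ eqs); rewrite ij -hs js.
exact/cls0/fzero_rel.
Qed.

Lemma gen_swap u v x y : (size u + size v).+2 = n ->
  gen (u ++ x :: y :: v) = - gen (u ++ y :: x :: v).
Proof.
move=> hn; have alt z : gen (u ++ z :: z :: v) = 0.
  apply: gen_alt; first by rewrite size_cat /= !addnS.
  by rewrite cat_uniq /= inE eqxx !andbF.
have h := alt (x + y); rewrite genD /= ?addnS // in h.
rewrite -(cat_rcons x u) -(cat_rcons y u) !genD ?size_rcons ?addSn // !cat_rcons !alt in h.
by apply/eqP; rewrite -addr_eq0; rewrite add0r addr0 in h; rewrite h.
Qed.

Lemma gen_insert s1 s2 x : exists e : F, forall u, (size u + (size s1 + size s2)).+1 = n ->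
  gen (u ++ x :: s1 ++ s2) = e *: gen (u ++ s1 ++ x :: s2).
Proof.
elim: s1 => [|y s1 [e IH]]; first by exists 1 => u _; rewrite scale1r.
exists (- e) => u hu; rewrite /= gen_swap; last by rewrite -hu /= size_cat !addnS.
by rewrite -!(cat_rcons y u) IH ?scaleNr // size_rcons -hu /= addSn addnS.
Qed.

(** The sign is left as an unnamed scalar [e], but it is chosen before the prefix [u], so that one
    scalar serves all terms of a sum. *)
Lemma gen_perm s1 s2 : perm_eq s1 s2 -> exists e : F, forall u, (size u + size s1)%N = n ->
  gen (u ++ s1) = e *: gen (u ++ s2).
Proof.
elim: s1 s2 => [|x s1 IH] s2.
  by rewrite perm_sym => /perm_nilP ->; exists 1 => u _; rewrite scale1r.
move=> hp; have xs2 : x \in s2 by rewrite -(perm_mem hp) mem_head.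
case/splitPr: xs2 hp => s3 s4.
rewrite perm_sym -[x :: s4]cat1s perm_catCA /= perm_cons perm_sym => hp'.
have [e1 h1] := IH _ hp'; have [e2 h2] := gen_insert s3 s4 x.
exists (e1 * e2) => u /= hu.
rewrite -cat_rcons h1; last by rewrite size_rcons addSnnS.
by rewrite cat_rcons h2 ?scalerA // -hu (perm_size hp') size_cat addnS.
Qed.

End Quotient.

(** * Evaluation of forms on derivations *)

Section Evaluation.
Variables (F E : fieldType) (f : {rmorphism F -> E}).
Implicit Types (h : seq F -> E) (w : fsum F).

Definition ev h w : E := \sum_(t <- w) f t.1 * h t.2.

(** The relations [frel] transported to [E]: on sequences of length [n], such an [h] amounts to an
    [f]-semilinear map from [Omega^n(F)] to [E], computed on formal sums by [ev h]. *)
Definition altder n h : Prop :=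
  [/\ forall u v a c, (size u + size v).+1 = n ->
        h (u ++ (a + c) :: v) = h (u ++ a :: v) + h (u ++ c :: v),
      forall u v a c, (size u + size v).+1 = n ->
        h (u ++ (a * c) :: v) = f a * h (u ++ c :: v) + f c * h (u ++ a :: v) &
      forall s i j, size s = n -> (i < j < n)%N -> nth 0 s i = nth 0 s j -> h s = 0].

Lemma ev_cat h w1 w2 : ev h (w1 ++ w2) = ev h w1 + ev h w2.
Proof. by rewrite /ev big_cat. Qed.

Lemma ev_scale h c w : ev h (fscale c w) = f c * ev h w.
Proof. by rewrite /ev big_map mulr_sumr; apply: eq_bigr => t _; rewrite /= rmorphM mulrA. Qed.

Lemma ev_flatten h ws : ev h (flatten ws) = \sum_(w <- ws) ev h w.
Proof.
elim: ws => [|w ws IH]; first by rewrite /ev !big_nil.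
by rewrite /= ev_cat IH big_cons.
Qed.

Lemma ev_coef h w (s : seq (seq F)) : uniq s -> {subset map snd w <= s} ->
  ev h w = \sum_(a <- s) f (fcoef w a) * h a.
Proof.
move=> us sub; under eq_bigr => a _ do rewrite /fcoef rmorph_sum mulr_suml.
rewrite (exchange_big_dep xpredT) //= /ev big_seq [RHS]big_seq; apply: eq_bigr => t tw.
rewrite -big_filter (bigD1_seq t.2) ?filter_uniq //=; last first.
  by rewrite mem_filter eqxx sub //; apply: map_f.
rewrite big_seq_cond big1 ?addr0 // => a.
by rewrite mem_filter => /andP[/andP[/eqP -> _]]; rewrite eqxx.
Qed.

Lemma ev_ext h w1 w2 : fcoef w1 =1 fcoef w2 -> ev h w1 = ev h w2.
Proof.
move=> eqw; pose s := undup (map snd w1 ++ map snd w2).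
rewrite (@ev_coef h w1 s) ?undup_uniq //; last by move=> a; rewrite mem_undup mem_cat => ->.
rewrite (@ev_coef h w2 s) ?undup_uniq //; last by move=> a; rewrite mem_undup mem_cat orbC => ->.
by apply: eq_bigr => a _; rewrite eqw.
Qed.

Lemma ev_fzero n h w : altder n h -> fzero n w -> ev h w = 0.
Proof.
move=> [hA hM hX] [gs [hgs /ev_ext ->]]; rewrite ev_flatten big_map big_seq big1 // => g /hgs hg.
rewrite ev_scale; suff -> : ev h g.2 = 0 by rewrite mulr0.
case: hg => [u v a c hn|u v a c hn|s i j hs ij eqs]; rewrite /ev !big_cons big_nil /= ?addr0.
- by rewrite hA // rmorph1 rmorphN rmorph1; ring.
- by rewrite hM // rmorph1 !rmorphN; ring.
- by rewrite (hX _ _ _ hs ij eqs) mulr0.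
Qed.

Lemma ev_feq n h w1 w2 : altder n h -> feq n w1 w2 -> ev h w1 = ev h w2.
Proof.
move=> hh /(ev_fzero hh); rewrite ev_cat ev_scale rmorphN rmorph1 mulN1r => /eqP.
by rewrite subr_eq0 => /eqP.
Qed.

Lemma altder_catl n k h s : size s = k -> altder (k + n) h -> altder n (fun a => h (s ++ a)).
Proof.
move=> sk [hA hM hX]; split.
- by move=> u v a c hn; rewrite !catA hA // size_cat sk -hn addnS addnA.
- by move=> u v a c hn; rewrite !catA hM // size_cat sk -hn addnS addnA.
- move=> a i j sa /andP[ij jn] eqa; apply: (hX _ (k + i)%N (k + j)%N).
  + by rewrite size_cat sk sa.
  + by rewrite !ltn_add2l ij.
  + by rewrite !nth_cat sk !ltnNge !leq_addr /= !addKn.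
Qed.

Lemma altder_catr n k h s : size s = k -> altder (n + k) h -> altder n (fun a => h (a ++ s)).
Proof.
move=> sk [hA hM hX]; split.
- by move=> u v a c hn; rewrite -!catA !cat_cons hA // size_cat sk -hn addSn addnA.
- by move=> u v a c hn; rewrite -!catA !cat_cons hM // size_cat sk -hn addSn addnA.
- move=> a i j sa /andP[ij jn] eqa; apply: (hX _ i j).
  + by rewrite size_cat sk sa.
  + by rewrite ij ltn_addr.
  + by rewrite !nth_cat sa jn (ltn_trans ij jn).
Qed.

Lemma ev_wedge1l h c s w : ev h (fwedge [:: (c, s)] w) = f c * ev (fun a => h (s ++ a)) w.
Proof.
rewrite /fwedge /= cats0 /ev big_map mulr_sumr; apply: eq_bigr => t _ /=.
by rewrite rmorphM mulrA.
Qed.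

Lemma ev_wedge1r h c s w : ev h (fwedge w [:: (c, s)]) = f c * ev (fun a => h (a ++ s)) w.
Proof.
rewrite /fwedge /ev /= mulr_sumr; elim: w => [|t w IH]; first by rewrite !big_nil.
by rewrite /= !big_cons IH /= rmorphM; ring.
Qed.

Lemma ev_eq0 h w : (forall t, t \in w -> h t.2 = 0) -> ev h w = 0.
Proof. by move=> h0; rewrite /ev big_seq big1 // => t /h0 ->; rewrite mulr0. Qed.

Lemma eq_ev h h' w : (forall t, t \in w -> h t.2 = h' t.2) -> ev h w = ev h' w.
Proof. by move=> hh; rewrite /ev !big_seq; apply: eq_bigr => t /hh ->. Qed.

Definition emx n (D : 'I_n -> F -> E) (a : seq F) : 'M[E]_n :=
  \matrix_(j, i) D i (nth 0 a j).

Definition dm n (D : 'I_n -> F -> E) (a : seq F) : E := \det (emx D a).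

Lemma emx_slot n (D : 'I_n -> F -> E) u v x y (j : 'I_n) : size u <> j ->
  row j (emx D (u ++ x :: v)) = row j (emx D (u ++ y :: v)).
Proof.
move=> uj; apply/rowP => i; rewrite !mxE !nth_cat; case: ifP => // /negbT.
rewrite -leqNgt leq_eqVlt => /orP[/eqP //|uj']; case: (j - size u)%N (subn_gt0 (size u) j) => //.
by rewrite uj'.
Qed.

Lemma altder_dm n (D : 'I_n -> F -> E) : (forall i, derivation f (D i)) -> altder n (dm D).
Proof.
move=> hD.
have row'_slot u v x y (j : 'I_n) : size u = j ->
    row' j (emx D (u ++ x :: v)) = row' j (emx D (u ++ y :: v)).
  move=> uj; apply/row_matrixP => k.
  apply/rowP => i; have /rowP/(_ i) : row (lift j k) (emx D (u ++ x :: v)) =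
     row (lift j k) (emx D (u ++ y :: v)).
    by apply: emx_slot; rewrite uj => /eqP eqj; move: (neq_lift j k); rewrite -val_eqE eqj.
  by rewrite !mxE.
split.
- move=> u v a c hn; have uj : (size u < n)%N by rewrite -hn ltnS leq_addr.
  pose j := Ordinal uj.
  rewrite /dm (@determinant_multilinear _ _ _ (emx D (u ++ a :: v)) (emx D (u ++ c :: v)) j 1 1).
  + by rewrite !mul1r.
  + by apply/rowP => i; rewrite !mxE !nth_cat ltnn subnn /= (derD (hD i)) !mul1r.
  + exact: row'_slot.
  + exact: row'_slot.
- move=> u v a c hn; have uj : (size u < n)%N by rewrite -hn ltnS leq_addr.
  pose j := Ordinal uj.
  apply: (@determinant_multilinear _ _ _ (emx D (u ++ c :: v)) (emx D (u ++ a :: v)) j).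
  + by apply/rowP => i; rewrite !mxE !nth_cat ltnn subnn /= (derM (hD i)).
  + exact: row'_slot.
  + exact: row'_slot.
- move=> s i j hs /andP[ij jn] eqs; have iN := ltn_trans ij jn.
  apply: (@determinant_alternate _ _ _ (Ordinal iN) (Ordinal jn)).
    by rewrite -val_eqE /= ltn_eqF.
  by move=> k; rewrite !mxE /= eqs.
Qed.

End Evaluation.

Lemma ev_fmap (F E : fieldType) (f : {rmorphism F -> E}) n (D : 'I_n -> E -> E) w : fdeg n w ->
  ev idfun (dm D) (fmap f w) = ev f (dm (fun i => D i \o f)) w.
Proof.
move=> /allP dw; rewrite /ev big_map big_seq [RHS]big_seq; apply: eq_bigr => t /dw /eqP st.
congr (_ * \det _); apply/matrixP => j i; rewrite !mxE /= (nth_map 0) ?st //.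
Qed.

Lemma ev_compl (F E : fieldType) (f : {rmorphism F -> E}) n (D : 'I_n -> F -> F) w :
  ev f (dm (fun i => f \o D i)) w = f (ev idfun (dm D) w).
Proof.
rewrite /ev rmorph_sum; apply: eq_bigr => t _; rewrite rmorphM; congr (_ * _).
by rewrite /dm -det_map_mx; congr (\det _); apply/matrixP => j i; rewrite !mxE.
Qed.

(** * Expansion of forms in a dual system *)

Section Expansion.
Variables (p : nat) (F : fieldType) (hp : p \in [pchar F]).
Variables (N : nat) (c : 'I_N -> F) (D : 'I_N -> F -> F).
Hypothesis hD : dual_system c D.

Lemma vder_powgen0 (V : lmodType F) (d : F -> V) :
  (forall x y, d (x + y) = d x + d y) -> (forall x y, d (x * y) = x *: d y + y *: d x) ->
  (forall k, d (c k) = 0) -> forall x, in_powgen p c x -> d x = 0.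
Proof.
move=> dD dM dc.
have d0 : d 0 = 0 by apply: (addrI (d 0)); rewrite -dD !addr0.
have d1 : d 1 = 0 by apply: (addrI (d 1)); rewrite addr0 -{3}(mulr1 1) dM !scale1r.
have dN x : d (- x) = - d x by apply/eqP; rewrite -addr_eq0 -dD addNr d0.
have dX x n : d (x ^+ n) = (x ^+ n.-1 *+ n) *: d x.
  elim: n => [|n IH]; first by rewrite d1 scale0r.
  rewrite exprS dM IH; case: n {IH} => [|n] /=.
    by rewrite expr0 mulr0n scale0r scaler0 add0r.
  by rewrite scalerA mulrnAr -exprS [in RHS]mulrSr scalerDl.
have ker : is_subfield (fun x => d x = 0).
  split=> //.
  - by move=> x y hx hy; rewrite dD dN hx hy subrr.
  - by move=> x y hx hy; rewrite dM hx hy !scaler0 addr0.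
  - move=> x hx; case: (eqVneq x 0) => [->|x0]; first by rewrite invr0.
    have := dM x x^-1; rewrite mulfV // d1 hx scaler0 addr0 => /eqP.
    by rewrite eq_sym scaler_eq0 (negbTE x0) /= => /eqP.
move=> x; apply: (gen_field_min ker) => y [[z ->]|[k ->]]; last exact: dc.
by rewrite dX -mulr_natr (pcharf0 hp) mulr0 scale0r.
Qed.

(** Both sides are derivations in [a] with values in the module [Omega^n], and they agree at every
    [c k]; so their difference vanishes on the field generated by [c] and the [p]-th powers. *)
Lemma gen_slot n u v a : (size u + size v).+1 = n -> in_powgen p c a ->
  gen n (u ++ a :: v) = \sum_k D k a *: gen n (u ++ c k :: v).
Proof.
case: hD => hder hdc hn ha; apply/eqP; rewrite -subr_eq0; apply/eqP.
pose d a := gen n (u ++ a :: v) - \sum_k D k a *: gen n (u ++ c k :: v).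
apply: (@vder_powgen0 _ d) ha => [x y|x y|l].
- rewrite /d genD //; under eq_bigr => k _ do rewrite (derD (hder k)) scalerDl.
  by rewrite big_split /= opprD addrACA.
- rewrite /d genM //; under eq_bigr => k _ do rewrite (derM (hder k)) scalerDl -!scalerA.
  by rewrite big_split /= opprD -!scaler_sumr !scalerBr addrACA.
- rewrite /d (bigD1 l) //= hdc eqxx scale1r big1 ?addr0 ?subrr // => k /negbTE kl.
  by rewrite hdc kl scale0r.
Qed.

Lemma gen_expand n s : {in s, forall x, in_powgen p c x} ->
  exists ys : seq (F * seq 'I_N), all (fun l => size l.2 == size s) ys /\
    forall u, (size u + size s)%N = n ->
      gen n (u ++ s) = \sum_(l <- ys) l.1 *: gen n (u ++ map c l.2).
Proof.
elim: s => [|a s IH] hs.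
  by exists [:: (1, [::])]; split=> // u _; rewrite big_seq1 scale1r.
have [|ys [sz hys]] := IH; first by move=> x xs; apply: hs; rewrite inE xs orbT.
exists [seq (l.1 * D k a, k :: l.2) | l <- ys, k <- enum 'I_N]; split.
  apply/allP => t /allpairsP [[l k] [/= /(allP sz) sl _ ->]].
  by rewrite /= eqSS.
move=> u /= hu; rewrite -cat_rcons hys; last by rewrite size_rcons addSnnS.
rewrite big_allpairs_dep /= big_seq [RHS]big_seq; apply: eq_bigr => l /(allP sz)/eqP sl.
rewrite cat_rcons gen_slot; [|by rewrite size_map sl -addnS|by apply: hs; rewrite mem_head].
by rewrite scaler_sumr big_enum; apply: eq_bigr => k _; rewrite scalerA.
Qed.

Definition dlist (J : {set 'I_N}) n : 'I_n -> F -> F :=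
  fun i => nth (fun=> 0) [seq D k | k <- enum J] i.

Lemma dlist_der J n i : derivation idfun (@dlist J n i).
Proof.
case: hD => hder _; rewrite /dlist; case: (ltnP i (size [seq D k | k <- enum J])) => h.
  have /mapP [k _ ->] := mem_nth (fun=> 0) h; exact: hder.
by rewrite nth_default //; split=> x y; rewrite ?mulr0 addr0.
Qed.

Lemma dlist_nth (J : {set 'I_N}) n (i : 'I_n) k0 : #|J| = n -> @dlist J n i = D (nth k0 (enum J) i).
Proof. by move=> hJ; rewrite /dlist (nth_map k0) // -cardE hJ. Qed.

Lemma dm_dlist (J J' : {set 'I_N}) n : #|J| = n -> #|J'| = n ->
  dm (@dlist J n) (map c (enum J')) = (J == J')%:R.
Proof.
move=> hJ hJ'; case: hD => _ hdc.
have eJ : size (enum J) = n by rewrite -cardE.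
have eJ' : size (enum J') = n by rewrite -cardE.
case: eqP => [<-|/eqP neJ].
  rewrite /dm (_ : emx _ _ = 1%:M) ?det1 //; apply/matrixP => j i; rewrite !mxE.
  have [k0 _] : exists k0 : 'I_N, true.
    have /card_gt0P [k _] : (0 < #|J|)%N by rewrite hJ (leq_ltn_trans _ (ltn_ord j)).
    by exists k.
  rewrite (dlist_nth _ k0) // (nth_map k0) ?eJ // hdc nth_uniq ?eJ ?enum_uniq //.
  by rewrite eq_sym.
have [k kJ kJ'] : exists2 k, k \in J & k \notin J'.
  apply/subsetPn; apply: contra neJ => sub.
  by rewrite eqEcard sub hJ hJ' leqnn.
have ik : (index k (enum J) < n)%N by rewrite -eJ index_mem mem_enum.
rewrite /dm (expand_det_col _ (Ordinal ik)) big1 // => j _.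
rewrite !mxE (dlist_nth _ k) //= nth_index ?mem_enum // (nth_map k) ?eJ' // hdc.
case: eqP => [ek|]; last by rewrite mul0r.
have : nth k (enum J') j \in J' by rewrite -mem_enum mem_nth // eJ'.
by rewrite -ek (negbTE kJ').
Qed.

Definition expansion n (w : fsum F) : fsum F :=
  [seq (ev idfun (dm (@dlist J n)) w, map c (enum J)) | J <- enum [pred J : {set 'I_N} | #|J| == n]].

Lemma cls_expansion n (y : {set 'I_N} -> F) :
  cls n [seq (y J, map c (enum J)) | J <- enum [pred J : {set 'I_N} | #|J| == n]] =
  \sum_(J : {set 'I_N} | #|J| == n) y J *: gen n (map c (enum J)).
Proof. by rewrite clsE big_map big_enum. Qed.

(** Expanding every slot in the [c k] and sorting shows that some coefficients [y] exist; evaluating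
    on the dual tuples [dlist] then forces them to be those of [expansion]. *)
Lemma feq_expansion n w : fdeg n w ->
  {in w, forall t, {in t.2, forall x, in_powgen p c x}} -> feq n w (expansion n w).
Proof.
move=> /allP dw hw.
have [y hy] : exists y : {set 'I_N} -> F,
    cls n w = \sum_(J : {set 'I_N} | #|J| == n) y J *: gen n (map c (enum J)).
  suff : forall w' : fsum F, {subset w' <= w} -> exists y : {set 'I_N} -> F,
    cls n w' = \sum_(J : {set 'I_N} | #|J| == n) y J *: gen n (map c (enum J)) by apply.
  elim=> [|t w' IH] sub.
    exists (fun=> 0); rewrite clsE big_nil big1 // => J _; exact: scale0r.
  have [|y IHy] := IH; first by move=> t' ht'; apply: sub; rewrite inE ht' orbT.
  have tw : t \in w by apply: sub; rewrite mem_head.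
  have [ys [sz hys]] := gen_expand n (hw t tw).
  have st : size t.2 = n by apply/eqP/dw.
  have /choice [z hz] : forall l : F * seq 'I_N, exists e : F, size l.2 = n ->
      gen n (map c l.2) = (if uniq l.2 then e else 0) *: gen n (map c (enum [set x in l.2])).
    move=> l; case: (boolP (uniq l.2)) => ul; last first.
      exists 0 => sl; rewrite scale0r; apply: gen_alt; first by rewrite size_map.
      by apply: contra ul; apply: map_uniq.
    have pl : perm_eq (map c l.2) (map c (enum [set x in l.2])).
      apply: perm_map; apply: uniq_perm; rewrite ?enum_uniq // => x.
      by rewrite mem_enum inE.
    have [e he] := gen_perm n pl; exists e => sl; apply: (he [::]).
    by rewrite size_map.
  exists (fun J => t.1 * (\sum_(l <- ys | uniq l.2 && ([set x in l.2] == J)) l.1 * z l) + y J).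
  rewrite clsE big_cons -clsE IHy; under [RHS]eq_bigr => J _ do rewrite scalerDl.
  rewrite big_split /=; congr (_ + _).
  have := hys [::]; rewrite add0n /= => -> //.
  under [RHS]eq_bigr => J _ do rewrite -scalerA.
  rewrite -scaler_sumr; congr (_ *: _).
  under [RHS]eq_bigr => J _ do rewrite scaler_suml.
  rewrite (exchange_big_dep (fun l => uniq l.2)) /=; last by move=> J l _ /andP[].
  rewrite big_seq [RHS]big_seq_cond (big_mkcond (fun l => l \in ys)) [RHS]big_mkcond /=.
  apply: eq_bigr => l _; case: (boolP (l \in ys)) => //= lys.
  have sl : size l.2 = n by rewrite -st; apply/eqP/(allP sz).
  rewrite hz //; case: (boolP (uniq l.2)) => ul; last by rewrite scale0r scaler0.
  rewrite (bigD1 [set x in l.2]) /=; last first.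
    rewrite eqxx andbT -sl -(card_uniqP ul); apply/eqP; apply: eq_card => x.
    by rewrite inE.
  rewrite big1 ?addr0 ?scalerA // => J /andP[/andP[_ /eqP ->]].
  by rewrite eqxx.
have fy : feq n w [seq (y J, map c (enum J)) | J <- enum [pred J : {set 'I_N} | #|J| == n]].
  by apply/cls_eq; rewrite cls_expansion // hy.
have yE (J : {set 'I_N}) : #|J| == n -> ev idfun (dm (@dlist J n)) w = y J.
  move=> /eqP hJ; rewrite (ev_feq (altder_dm (f := idfun) (@dlist_der J n)) fy).
  rewrite /ev big_map big_enum (bigD1 J) /=; last by rewrite inE hJ.
  rewrite dm_dlist // eqxx mulr1 big1 ?addr0 // => J' /andP[].
  rewrite inE => /eqP hJ' /negbTE neJ.
  by rewrite dm_dlist // eq_sym neJ mulr0.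
rewrite /expansion (_ : map _ _ = [seq (y J, map c (enum J)) | J <- enum [pred J : {set 'I_N} | #|J| == n]]) //.
by apply/eq_in_map => J; rewrite mem_enum inE => /yE ->.
Qed.

Lemma fzero_dual n w : fdeg n w -> {in w, forall t, {in t.2, forall x, in_powgen p c x}} ->
  (forall J : {set 'I_N}, #|J| = n -> ev idfun (dm (@dlist J n)) w = 0) -> fzero n w.
Proof.
move=> dw hw h0; have := feq_expansion dw hw => /cls_eq eqw.
apply/cls0; rewrite eqw cls_expansion // big1 // => J /eqP hJ.
by rewrite h0 // scale0r.
Qed.

End Expansion.

Section Criterion.
Variables (p : nat) (F : fieldType) (hp : p \in [pchar F]).

Lemma pindep0 (b : 'I_0 -> F) : pindep p b.
Proof.
move=> c; have eqi (i j : {ffun 'I_0 -> 'I_p}) : i = j by apply/ffunP => - [].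
move=> + i; rewrite (bigD1 i) //= [X in _ + X]big1 ?addr0; last by move=> j; rewrite (eqi j i) eqxx.
by rewrite big_ord0 mulr1 => /eqP; rewrite expf_eq0 => /andP[_ /eqP].
Qed.

Lemma fzeroP n w : fdeg n w ->
  fzero n w <-> (forall D : 'I_n -> F -> F, (forall i, derivation idfun (D i)) -> ev idfun (dm D) w = 0).
Proof.
move=> dw; split=> [h0 D hD|h0]; first exact: (ev_fzero (altder_dm (f := idfun) hD) h0).
have [N [c [D [_ hD _ hs]]]] := dual_exists hp (flatten (map snd w)) (@pindep0 (fun=> 0)).
apply: (fzero_dual hp hD dw).
  by move=> t tw x xt; apply: hs; apply/flatten_mapP; exists t.
by move=> J _; apply: h0; apply: (dlist_der hD).
Qed.

Lemma feqP n w1 w2 : fdeg n w1 -> fdeg n w2 ->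
  feq n w1 w2 <-> (forall D : 'I_n -> F -> F, (forall i, derivation idfun (D i)) ->
     ev idfun (dm D) w1 = ev idfun (dm D) w2).
Proof.
move=> d1 d2; rewrite /feq fzeroP ?fdeg_cat ?fdeg_scale ?d1 //.
have E D : ev idfun (dm (n := n) D) (w1 ++ fopp w2) = ev idfun (dm D) w1 - ev idfun (dm D) w2.
  by rewrite ev_cat ev_scale /= mulN1r.
split=> h D hD; last by rewrite E (h D hD) subrr.
by move: (h D hD); rewrite E => /eqP; rewrite subr_eq0 => /eqP.
Qed.

End Criterion.

(** * Forms divisible by some db_i *)

Lemma enum_set_sorted N (J : {set 'I_N}) : sorted (fun i j : 'I_N => (i < j)%N) (enum J).
Proof.
rewrite /enum_mem; apply: sorted_filter; first by move=> i j k; apply: ltn_trans.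
by have := iota_ltn_sorted 0 N; rewrite -val_enum_ord sorted_map enumT.
Qed.

Lemma enum_set_head N (J : {set 'I_N}) k s l : enum J = k :: s -> l \in J -> (k <= l)%N.
Proof.
move=> eqJ lJ; have := enum_set_sorted J; rewrite eqJ /= path_sortedE; last first.
  by move=> i j m; apply: ltn_trans.
case/andP=> /allP hall _; move: lJ; rewrite -mem_enum eqJ inE => /orP[/eqP -> //|/hall].
exact: ltnW.
Qed.

Section Determinants.
Variables (F E : fieldType).

Lemma dm_row0 n (D : 'I_n -> F -> E) a j : (j < n)%N ->
  (forall i, D i (nth 0 a j) = 0) -> dm D a = 0.
Proof.
move=> jn h0; rewrite /dm (expand_det_row _ (Ordinal jn)) big1 // => i _.
by rewrite !mxE /= h0 mul0r.
Qed.

Definition joinD n k (D : 'I_n -> F -> E) (D' : 'I_k -> F -> E) (i : 'I_(n + k)) : F -> E :=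
  match split i with inl j => D j | inr j => D' j end.

Lemma joinD_der (f : F -> E) n k (D : 'I_n -> F -> E) (D' : 'I_k -> F -> E) :
  (forall i, derivation f (D i)) -> (forall i, derivation f (D' i)) ->
  forall i, derivation f (joinD D D' i).
Proof. by move=> h h' i; rewrite /joinD; case: (split i). Qed.

Lemma emx_join n k (D : 'I_n -> F -> E) (D' : 'I_k -> F -> E) a s : size a = n ->
  emx (joinD D D') (a ++ s) =
  block_mx (emx D a) (\matrix_(j < n, i < k) D' i (nth 0 a j))
           (\matrix_(j < k, i < n) D i (nth 0 s j)) (emx D' s).
Proof.
move=> sa; apply/matrixP => j i; rewrite -[j]splitK -[i]splitK.
case: (split j) => j'; case: (split i) => i' /=;
  rewrite ?block_mxEul ?block_mxEur ?block_mxEdl ?block_mxEdr !mxE /joinD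
    ?(unsplitK (inl i')) ?(unsplitK (inr i')) nth_cat sa /= ?ltn_ord //.
- by rewrite ltnNge leq_addr /= addKn.
- by rewrite ltnNge leq_addr /= addKn.
Qed.

(** Evaluation of a wedge product on a joined tuple: when the first derivations kill the second
    factor, the matrix is block triangular. *)
Lemma dm_join n k (D : 'I_n -> F -> E) (D' : 'I_k -> F -> E) a s : size a = n ->
  (forall i j, (j < k)%N -> D i (nth 0 s j) = 0) -> dm (joinD D D') (a ++ s) = dm D a * dm D' s.
Proof.
move=> sa h0; rewrite /dm emx_join //.
have -> : \matrix_(j < k, i < n) D i (nth 0 s j) = 0.
  by apply/matrixP => j i; rewrite !mxE h0.
by rewrite det_ublock.
Qed.

Lemma nth_fdbs r (b : 'I_r -> F) (k : 'I_r) : nth 0 (fdbs b) k = b k.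
Proof. by rewrite /fdbs (nth_map k) ?size_enum_ord // nth_ord_enum. Qed.

Lemma size_fdbs r (b : 'I_r -> F) : size (fdbs b) = r.
Proof. by rewrite size_map size_enum_ord. Qed.

End Determinants.

Section DbWedge.
Variables (p : nat) (F : fieldType) (hp : p \in [pchar F]).
Variables (r : nat) (b : 'I_r -> F).

Lemma ev_db_wedge (E : fieldType) (f : {rmorphism F -> E}) (h : seq F -> E) (eta : 'I_r -> fsum F) :
  ev f h (flatten [seq fwedge (fd (b i)) (eta i) | i <- enum 'I_r]) =
  \sum_i ev f (fun a => h (b i :: a)) (eta i).
Proof.
rewrite ev_flatten big_map big_enum; apply: eq_bigr => i _.
by rewrite ev_wedge1l rmorph1 mul1r.
Qed.

Lemma omega_low_deg n (w : fsum F) t : omega_low n w -> t \in w -> n = (size t.2).+1.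
Proof.
case: n => [-> //|n] /allP h /h /eqP -> //.
Qed.

Lemma sum_db_ev (E : fieldType) (f : {rmorphism F -> E}) n w (D : 'I_n -> F -> E) :
  sum_db_wedge n b w -> (forall i, derivation f (D i)) -> (forall i k, D i (b k) = 0) ->
  ev f (dm D) w = 0.
Proof.
move=> [dw [eta [low eqw]]] hD hDb; rewrite (ev_feq (altder_dm hD) eqw) ev_db_wedge.
rewrite big1 // => i _; apply: ev_eq0 => t /(omega_low_deg (low i)) hn.
by apply: (@dm_row0 _ _ _ _ _ 0%N) => [|j]; [rewrite hn|exact: hDb].
Qed.

Lemma sum_db_ann n w : sum_db_wedge n b w -> annOmega n r (fun u => u = [:: (1, fdbs b)]) w.
Proof.
move=> [dw [eta [low eqw]]]; split=> // u ->.
have du : fdeg r [:: (1 : F, fdbs b)] by rewrite /fdeg /= size_fdbs eqxx.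
apply/(fzeroP hp (fdeg_wedge dw du)) => D hD.
have aD := altder_dm (f := idfun) hD.
rewrite ev_wedge1r mul1r (ev_feq (altder_catr (size_fdbs b) aD) eqw) ev_db_wedge.
rewrite big1 // => i _; apply: ev_eq0 => t /(omega_low_deg (low i)) hn.
(* [b i] stands at position 0 and again at position [n + i], inside the appended [fdbs b]. *)
case: aD => _ _ hX; apply: (hX _ 0%N (n + i)%N).
- by rewrite /= size_cat size_fdbs hn addSn.
- by rewrite ltn_add2l ltn_ord andbT hn.
- by rewrite hn addSn /= nth_cat ltnNge leq_addr /= addKn nth_fdbs.
Qed.

Hypothesis hind : pindep p b.

(** Joining to [D] the derivations dual to [b] multiplies its value on [w] by the determinant of an
    identity matrix, and turns it into a value of [w] wedged with all the [db_i]. *)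
Lemma ann_ev n w (D : 'I_n -> F -> F) : annOmega n r (fun u => u = [:: (1, fdbs b)]) w ->
  (forall i, derivation idfun (D i)) -> (forall i k, D i (b k) = 0) -> ev idfun (dm D) w = 0.
Proof.
move=> [/allP dw /(_ _ erefl) ann] hD hDb.
have [Db [hDbd hDbb]] := pindep_dual hp hind.
have aD : altder idfun (n + r) (dm (joinD D Db)).
  by apply: (altder_dm (f := idfun)); apply: joinD_der.
have := ev_fzero aD ann; rewrite ev_wedge1r mul1r => <-.
apply: eq_ev => t /dw/eqP st; rewrite dm_join //.
  rewrite [X in _ * X](_ : _ = 1) ?mulr1 // /dm (_ : emx _ _ = 1%:M) ?det1 //.
  by apply/matrixP => j i; rewrite !mxE nth_fdbs hDbb eq_sym.
by move=> i j jr; rewrite (nth_fdbs b (Ordinal jr)).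
Qed.

(** In the expansion over a dual family beginning with [b], a set [J] of indices at least [r] gives
    derivations killing every [b k], so its coefficient is 0. Every other [J] begins with some index
    of [b], and that [db_i] is factored out at the front. *)
Lemma sum_db_criterion n w : fdeg n w ->
  (forall D : 'I_n -> F -> F, (forall i, derivation idfun (D i)) -> (forall i k, D i (b k) = 0) ->
    ev idfun (dm D) w = 0) -> sum_db_wedge n b w.
Proof.
move=> dw h0; split=> //.
have [N [c [D [rN hD hc hs]]]] := dual_exists hp (flatten (map snd w)) hind.
have := feq_expansion hp hD dw; case=> [|gs hgs].
  by move=> t tw x xt; apply: hs; apply/flatten_mapP; exists t.
have {gs hgs} eqw : feq n w (expansion c D n w) by exists gs.
(* Only the least element of [J] is looked at, so that each [J] is counted in a single [eta i]. *)
pose hd (i : 'I_r) (J : {set 'I_N}) := if enum J is k :: _ then (k == i :> nat) else false.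
pose y J := ev idfun (dm (@dlist _ _ D J n)) w.
pose eta i : fsum F := [seq (y J, map c (behead (enum J))) | J <- enum [pred J : {set 'I_N} | #|J| == n] & hd i J].
have low i : omega_low n (eta i).
  have sz t : t \in eta i -> exists2 J : {set 'I_N}, #|J| = n & hd i J /\ t = (y J, map c (behead (enum J))).
    by move=> /mapP [J]; rewrite mem_filter mem_enum inE => /andP[hJ /eqP cJ] ->; exists J.
  case: n @y @eta sz {dw h0 eqw} => [|m] y eta sz /=.
    case e: (eta i) => [//|t s]; have /sz [J] : t \in eta i by rewrite e mem_head.
    rewrite cardE => /size0nil eJ [].
    by rewrite /hd eJ.
  apply/allP => t /sz [J cJ [_ ->]] /=; rewrite size_map size_behead -cardE cJ //.
exists eta; split=> //.
apply/(feqP hp dw).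
  apply/allP => t /flattenP [_ /mapP [i _ ->] /allpairsP [[t1 t2] [/= ]]].
  rewrite inE => /eqP -> /(omega_low_deg (low i)) -> ->.
  by rewrite /=.
move=> D' hD'; rewrite (ev_feq (altder_dm (f := idfun) hD') eqw) ev_db_wedge.
rewrite {1}/ev big_map /=; under [RHS]eq_bigr => i _ do rewrite /ev big_map big_filter.
rewrite (exchange_big_dep xpredT) //= big_seq [RHS]big_seq; apply: eq_bigr => J.
rewrite mem_enum inE => /eqP cJ.
case: (pselect (exists i : 'I_r, hd i J)) => [[i hi]|nhd]; last first.
  rewrite -/(y J) [y J](_ : _ = 0) ?mul0r.
    by rewrite big1 // => i hi; case: nhd; exists i.
  apply: h0 => [i|i k]; first exact: (dlist_der hD).
  have k0 : 'I_N := widen_ord rN k.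
  rewrite (dlist_nth _ _ k0) // -(hc k (widen_ord rN k)) //.
  case: hD => _ ->; case: eqP => // eqk; case: nhd.
  have hm : nth k0 (enum J) i \in J by rewrite -mem_enum mem_nth // -cardE cJ.
  case eJ: (enum J) hm => [|k1 s] hm; first by move: hm; rewrite -mem_enum eJ.
  have k1r : (k1 < r)%N.
    apply: leq_ltn_trans (ltn_ord k); rewrite -[nat_of_ord k]/(nat_of_ord (widen_ord rN k)) -eqk eJ.
    exact: (enum_set_head eJ).
  by exists (Ordinal k1r); rewrite /hd eJ /= eqxx.
rewrite (bigD1 i) //= [X in _ + X]big1 ?addr0; last first.
  move=> j /andP[hj /negP []]; move: hi hj; rewrite /hd; case: (enum J) => // k1 s.
  by move=> /eqP e1 /eqP e2; rewrite -val_eqE /= -e1 -e2.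
congr (_ * dm _ _); move: hi; rewrite /hd; case: (enum J) => // k1 s /eqP e1.
by rewrite /= (hc i).
Qed.

End DbWedge.

(** * Extending derivations to E *)

Section ModularExtension.
Variables (p : nat) (F E : fieldType) (hp : p \in [pchar F]) (f : {rmorphism F -> E}).
Variables (r : nat) (b : 'I_r -> F) (hind : pindep p b).
Variables (ms : 'I_r -> nat) (beta : 'I_r -> E).
Hypothesis hbeta : forall i, beta i ^+ (p ^ ms i)%N = f (b i).

Let hpE : p \in [pchar E].
Proof. by rewrite (fmorph_pchar f). Qed.

Let p0 : (0 < p)%N := pchar_gt0 hp.

Notation expo := ({ffun 'I_r -> nat}).

Variables (M : nat) (msM : forall k, (ms k <= M)%N).

Definition red (e : expo) : expo := [ffun k => e k %% p ^ ms k]%N.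
Definition quo (e : expo) : expo := [ffun k => e k %/ p ^ ms k]%N.

Lemma mono_beta (e : expo) : mono beta e = f (mono b (quo e)) * mono beta (red e).
Proof.
rewrite rmorph_mono -!big_split; apply: eq_bigr => k _ /=.
by rewrite -hbeta -exprM -exprD !ffunE mulnC -divn_eq.
Qed.

Lemma mono_beta_pow (e : expo) t : (forall k, ms k <= t)%N ->
  mono beta e ^+ (p ^ t)%N = f (mono b (fun k => e k * p ^ (t - ms k))%N).
Proof.
move=> ht; rewrite -monoM rmorph_mono; apply: eq_bigr => k _ /=.
by rewrite -hbeta -exprM mulnCA -expnD subnKC.
Qed.

(** Raised to the power [p^M], the relation becomes one between monomials in [b] with exponents
    [e k * p^(M - ms k) < p^M], to which [pindep_pow] applies. *)
Lemma beta_free (s : seq expo) (U : expo -> F) : uniq s ->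
  {in s, forall (e : expo) k, (e k < p ^ ms k)%N} ->
  \sum_(e <- s) f (U e) * mono beta e = 0 -> {in s, forall e, U e = 0}.
Proof.
move=> us lt sum0.
apply: (pindep_pow hp hind (t := M) (e := fun (e : expo) k => (e k * p ^ (M - ms k))%N)) => //.
- move=> e es k; rewrite -{2}(subnKC (msM k)) expnD ltn_mul2r expn_gt0 p0 /=.
  exact: lt.
- move=> e e' es es' ee; apply/ffunP => k; apply/eqP.
  by have /eqP := ee k; rewrite eqn_mul2r expn_eq0 (gtn_eqF p0) /=.
- apply/eqP; rewrite -(fmorph_eq0 f) rmorph_sum; apply/eqP.
  transitivity ((\sum_(e <- s) f (U e) * mono beta e) ^+ (p ^ M)%N); last by rewrite sum0 (frob0 hpE).
  rewrite (frob_sum hpE); apply: eq_bigr => e _.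
  by rewrite exprMn mono_beta_pow // rmorphM rmorphXn.
Qed.

(** Stated for an additive [D] because it is used twice on the same list, for [f] and for the
    derivation [d]: both are linear over monomials in [b], so both are applied to the same reduced
    coefficients in [F]. *)
Lemma sum_beta_red (D : {additive F -> E}) (l : seq (F * expo)) :
  (forall u e, D (u * mono b e) = D u * f (mono b e)) ->
  \sum_(t <- l) D t.1 * mono beta t.2 =
  \sum_(e <- undup [seq red t.2 | t <- l])
     D (\sum_(t <- l | red t.2 == e) t.1 * mono b (quo t.2)) * mono beta e.
Proof.
move=> DM; under [RHS]eq_bigr => e _ do rewrite raddf_sum mulr_suml.
rewrite (exchange_big_dep xpredT) //= big_seq [RHS]big_seq; apply: eq_bigr => t tl.
rewrite -big_filter (bigD1_seq (red t.2)) ?filter_uniq ?undup_uniq //=; last first.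
  by rewrite mem_filter eqxx mem_undup; apply: (map_f (fun t => red t.2)).
rewrite big_seq_cond big1 ?addr0; last first.
  by move=> e; rewrite mem_filter => /andP[/andP[/eqP -> _]]; rewrite eqxx.
by rewrite DM mono_beta mulrA.
Qed.

Section Extend.
Variables (d : F -> E) (hd : derivation f d) (hdb : forall k, d (b k) = 0).

Definition beta_graph (x u : E) : Prop := exists l : seq (F * expo),
  x = \sum_(t <- l) f t.1 * mono beta t.2 /\ u = \sum_(t <- l) d t.1 * mono beta t.2.

Lemma der_mono0 e : d (mono b e) = 0.
Proof.
apply: (subfield_prod (der_kernel hd)) => k _.
by apply: (subfieldX (der_kernel hd)).
Qed.

(** After passing to reduced monomials, [beta_free] shows that the coefficients of a relation vanish
    already in [F]; hence so do their images under [d]. *)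
Lemma beta_graph_fun0 u : beta_graph 0 u -> u = 0.
Proof.
move=> [l [eq0 ->]].
pose da : {additive F -> E} := HB.pack d (GRing.isZmodMorphism.Build F E d (derB hd)).
have dM u' e : d (u' * mono b e) = d u' * f (mono b e).
  by rewrite (derM hd) der_mono0 mulr0 add0r mulrC.
rewrite -[d]/(da : F -> E) (sum_beta_red (D := da)) //.
rewrite big_seq big1 // => e he; rewrite [X in da X](_ : _ = 0) ?raddf0 ?mul0r //.
pose U e := \sum_(t <- l | red t.2 == e) t.1 * mono b (quo t.2).
apply: (beta_free (U := U) (undup_uniq [seq red t.2 | t <- l])) he.
  move=> e'; rewrite mem_undup => /mapP [t _ ->] k; rewrite ffunE.
  by rewrite ltn_mod expn_gt0 p0.
rewrite [RHS]eq0 (sum_beta_red (D := f)) // => v e'; exact: rmorphM.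
Qed.

Lemma beta_graph_base x : beta_graph (f x) (d x).
Proof.
exists [:: (x, [ffun=> 0%N])]; rewrite !big_seq1 /= (@eq_mono _ _ _ _ (fun=> 0%N)).
  by rewrite mono0 !mulr1.
by move=> k; rewrite ffunE.
Qed.

Lemma beta_graph_mono x e : beta_graph (f x * mono beta e) (d x * mono beta e).
Proof.
exists [:: (x, [ffun k => e k])]; rewrite !big_seq1 /= (@eq_mono _ _ _ _ e) //.
by move=> k; rewrite ffunE.
Qed.

Lemma beta_graphP : der_graph beta_graph.
Proof.
split; last exact: beta_graph_fun0.
- by have := beta_graph_base 1; rewrite rmorph1 (der1 hd).
- move=> x u y v [l [-> ->]] [l' [-> ->]].
  exists (l ++ [seq (- t.1, t.2) | t <- l']); rewrite !big_cat !big_map /= -!sumrN.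
  by split; congr (_ + _); apply: eq_bigr => t _; rewrite ?rmorphN ?(derN hd) mulNr.
- move=> x u y v [l [-> ->]] [l' [-> ->]].
  pose ad (e e' : expo) : expo := [ffun k => (e k + e' k)%N].
  exists [seq (t.1 * t'.1, ad t.2 t'.2) | t : F * expo <- l, t' : F * expo <- l'].
  have mE (t t' : F * expo) : mono beta (ad t.2 t'.2) = mono beta t.2 * mono beta t'.2.
    by rewrite -monoD; apply: eq_mono => k; rewrite ffunE.
  rewrite !big_allpairs_dep /= !big_distrlr /= [X in _ + X]exchange_big -big_split /=.
  split; apply: eq_bigr => t _; first by apply: eq_bigr => t' _; rewrite rmorphM mE; ring.
  by rewrite -big_split; apply: eq_bigr => t' _ /=; rewrite (derM hd) mE; ring.
Qed.

(** The exponent [p^M] clears all radicals at once. This yields inverses in the domain, and the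
    precise field containing [z] is what excludes a [p]-th root in [nonmodular_extend]. *)
Lemma beta_graph_pow x : dom beta_graph x ->
  exists2 z, in_powgen (p ^ M)%N b z & x ^+ (p ^ M)%N = f z.
Proof.
move=> [_ [l [-> _]]].
exists (\sum_(t <- l) t.1 ^+ (p ^ M)%N * mono b (fun k => t.2 k * p ^ (M - ms k))%N).
  apply: (subfield_sum (powgenP _ _)) => t _; apply: (subfieldM (powgenP _ _)).
    exact: powgen_pow.
  exact: powgen_mono.
rewrite (frob_sum hpE) rmorph_sum; apply: eq_bigr => t _.
by rewrite exprMn mono_beta_pow // rmorphM rmorphXn.
Qed.

Lemma beta_graph_dom : is_subfield (dom beta_graph).
Proof.
apply: (dom_subfield beta_graphP) => x /beta_graph_pow [z _ eqz].
exists (p ^ M)%N; rewrite expn_gt0 p0; split=> //; exists (d z^-1).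
by rewrite eqz -fmorphV; apply: beta_graph_base.
Qed.

Lemma beta_graph_gen k : beta_graph (beta k) 0.
Proof.
by have := beta_graph_mono 1 (fun l => (l == k) : nat); rewrite rmorph1 (der1 hd) mul1r mul0r mono_delta.
Qed.

Lemma modular_extend :
  (forall e : E, gen_field (fun y => (exists z, y = f z) \/ (exists i, y = beta i)) e) ->
  exists D : E -> E, derivation idfun D /\ forall x, D (f x) = d x.
Proof.
move=> hgen; have [|D [hD hDR]] := graph_total beta_graphP.
  move=> x; apply: (gen_field_min beta_graph_dom) (hgen x) => y [[z ->]|[k ->]].
    by exists (d z); apply: beta_graph_base.
  by exists 0; apply: beta_graph_gen.
by exists D; split=> // x; apply/hDR/beta_graph_base.
Qed.

Variables (m t : nat) (b0 : F) (beta0 : E).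
Hypotheses (tm : (t < m)%N) (mM : (m <= M)%N) (hm : forall i, (m <= ms i)%N).
Hypotheses (hbeta0 : beta0 ^+ (p ^ m)%N = f b0).
Hypothesis hmax : ~ in_powgen (p ^ t.+1)%N b b0.
Variable x : {ffun 'I_r -> 'I_(p ^ t)} -> F.
Hypothesis hx : b0 = \sum_(i : {ffun 'I_r -> 'I_(p ^ t)}) x i ^+ (p ^ t)%N * \prod_(k < r) b k ^+ i k.

(** The [p^t]-th root of the monomial [b^i] in [F(beta)]; [t < m <= ms k] makes [ms k - t] a genuine
    subtraction. *)
Definition bexp (i : {ffun 'I_r -> 'I_(p ^ t)}) : E :=
  mono beta (fun k => i k * p ^ (ms k - t))%N.

Let t_ms k : (t <= ms k)%N. Proof. exact: (leq_trans (ltnW tm) (hm k)). Qed.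

Lemma bexp_pow i : bexp i ^+ (p ^ t)%N = f (\prod_(k < r) b k ^+ i k).
Proof.
rewrite /bexp -monoM rmorph_prod; apply: eq_bigr => k _.
by rewrite rmorphXn -hbeta -exprM -mulnA -expnD subnK // mulnC.
Qed.

Lemma beta0_pow : beta0 ^+ (p ^ (m - t))%N = \sum_i f (x i) * bexp i.
Proof.
apply: (frob_inj hpE (k := t)); rewrite -exprM -expnD subnK ?(ltnW tm) // hbeta0 hx.
rewrite (frob_sum hpE) rmorph_sum; apply: eq_bigr => i _.
by rewrite exprMn bexp_pow rmorphM rmorphXn.
Qed.

Lemma bexp_free (U : {ffun 'I_r -> 'I_(p ^ t)} -> F) :
  \sum_i f (U i) * bexp i = 0 -> forall i, U i = 0.
Proof.
move=> sum0 i.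
apply: (pindep_pow hp hind (t := t) (s := index_enum {ffun 'I_r -> 'I_(p ^ t)})
   (e := fun i k => i k : nat)) => //.
- exact: index_enum_uniq.
- by move=> j j' _ _ jj; apply/ffunP => k; apply/val_inj/jj.
- apply/eqP; rewrite -(fmorph_eq0 f) rmorph_sum; apply/eqP.
  transitivity ((\sum_i f (U i) * bexp i) ^+ (p ^ t)%N); last by rewrite sum0 (frob0 hpE).
  rewrite (frob_sum hpE); apply: eq_bigr => j _.
  by rewrite exprMn bexp_pow rmorphM rmorphXn.
Qed.

(* [y = beta0 ^ (p^(m-t))] lies in [G = F(beta)] but, by maximality of [t], is not
   a p-th power there, so [beta0] generates an extension of [G] of degree [p^(m-t)],
   to which a derivation of [G] extends as soon as it kills [y]. *)
Lemma nonmodular_extend :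
  (forall e : E, gen_field (fun y => [\/ exists z, y = f z, exists i, y = beta i | y = beta0]) e) ->
  \sum_i d (x i) * bexp i = 0 ->
  exists D : E -> E, derivation idfun D /\ forall x, D (f x) = d x.
Proof.
move=> hgen dy0.
have R0 : beta_graph (beta0 ^+ (p ^ (m - t))%N) 0.
  rewrite beta0_pow -[X in beta_graph _ X]dy0; apply: (graph_sum beta_graphP) => i _.
  exact: beta_graph_mono.
(* A root [z] satisfies [z^(p^(t+1)) = f b0], so [beta_graph_pow] places [b0^(p^(M-t-1))] in
   [F^(p^M)(b)]. Extracting roots with [powgen_roots] puts [b0] in [F^(p^(t+1))(b)], against
   [hmax]. *)
have noroot z : dom beta_graph z -> z ^+ p <> beta0 ^+ (p ^ (m - t))%N.
  move=> /beta_graph_pow [w hw eqw] eqz; apply: hmax.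
  have zb0 : z ^+ (p ^ t.+1)%N = f b0.
    by rewrite expnS exprM eqz -exprM -expnD subnK ?(ltnW tm) // hbeta0.
  have tM : (t.+1 <= M)%N by apply: leq_trans mM.
  apply: (powgen_roots hp hind (k := (M - t.+1)%N)); rewrite subnKC //.
  suff -> : b0 ^+ (p ^ (M - t.+1))%N = w by [].
  apply: (fmorph_inj f); rewrite -eqw rmorphXn -zb0 -exprM -expnD subnKC //.
have [R' [gR' sub R'b0 dR']] := graph_tower hpE beta_graphP beta_graph_dom R0 noroot.
have [|D [hD hDR]] := graph_total gR'.
  move=> z; apply: (gen_field_min dR') (hgen z) => y [[w ->]|[k ->]|->].
  - by exists (d w); apply/sub/beta_graph_base.
  - by exists 0; apply/sub/beta_graph_gen.
  - by exists 0.
by exists D; split=> // z; apply/hDR/sub/beta_graph_base.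
Qed.

End Extend.
End ModularExtension.

(** * Forms vanishing over E *)

Lemma det_row_sum (R : comNzRingType) N (I : Type) (s : seq I) (c : I -> R)
  (X : I -> 'M[R]_N) (Y : 'M[R]_N) (j0 : 'I_N) :
  (forall i, row' j0 (X i) = row' j0 Y) ->
  (forall k, Y j0 k = \sum_(i <- s) c i * X i j0 k) ->
  \det Y = \sum_(i <- s) c i * \det (X i).
Proof.
move=> hX hY; rewrite (expand_det_row _ j0).
under eq_bigr => k _ do rewrite hY mulr_suml.
rewrite exchange_big; apply: eq_bigr => i _.
rewrite (expand_det_row (X i) j0) mulr_sumr; apply: eq_bigr => k _.
rewrite -mulrA; congr (_ * (_ * _)); rewrite /cofactor; congr (_ * \det _).
by apply/matrixP => j l; have /matrixP/(_ j (lift k l)) := hX i; rewrite !mxE => ->.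
Qed.

Lemma fwedge1 (F : fieldType) (w : fsum F) s :
  fwedge w [:: (1, s)] = [seq (t.1, t.2 ++ s) | t <- w].
Proof. by rewrite /fwedge; elim: w => //= t w ->; rewrite mulr1. Qed.

Section RelativeForms.
Variables (p : nat) (F E : fieldType) (hp : p \in [pchar F]) (f : {rmorphism F -> E}).
Variables (r : nat) (b : 'I_r -> F) (hind : pindep p b).
Variables (ms : 'I_r -> nat) (m : nat) (beta : 'I_r -> E).
Hypothesis hbeta : forall i, beta i ^+ (p ^ ms i)%N = f (b i).
Hypotheses (hm0 : (0 < m)%N) (hm : forall i, (m <= ms i)%N).

Let hpE : p \in [pchar E].
Proof. by rewrite (fmorph_pchar f). Qed.

Let M := (\max_k ms k + m)%N.
Let msM k : (ms k <= M)%N. Proof. by apply: leq_trans (leq_addr _ _); apply: leq_bigmax. Qed.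
Let mM : (m <= M)%N. Proof. exact: leq_addl. Qed.

(** Since [m <= ms i], the generators of [F^(p^m)(b)] are [p^m]-th powers of elements of [F(beta)],
    and the elements with this property form a field. Uniqueness of [p^m]-th roots identifies the
    root of [b0] so obtained with [beta0]. *)
Lemma radicand_in_powers b0 beta0 : beta0 ^+ (p ^ m)%N = f b0 -> in_powgen (p ^ m)%N b b0 ->
  gen_field (fun y => (exists z, y = f z) \/ (exists i, y = beta i)) beta0.
Proof.
set A := (fun y => _); move=> hb0 h; have gA := gen_fieldP A.
suff [e Ge /esym eqe] : exists2 e, gen_field A e & f b0 = e ^+ (p ^ m)%N.
  by rewrite (frob_inj hpE (etrans hb0 (esym eqe))).
move: h; apply: (gen_field_min (K := fun z => exists2 e, gen_field A e & f z = e ^+ (p ^ m)%N)).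
  split.
  - by exists 0; rewrite ?rmorph0 ?(frob0 hpE) //; apply: (subfield0 gA).
  - by exists 1; rewrite ?rmorph1 ?expr1n //; apply: (subfield1 gA).
  - by move=> x y [e h1 h2] [e' h1' h2']; exists (e - e'); [apply: (subfieldB gA)|rewrite rmorphB h2 h2' (frobB hpE)].
  - by move=> x y [e h1 h2] [e' h1' h2']; exists (e * e'); [apply: (subfieldM gA)|rewrite rmorphM h2 h2' exprMn].
  - by move=> x [e h1 h2]; exists e^-1; [apply: (subfieldV gA)|rewrite fmorphV h2 exprVn].
move=> y [[z ->]|[k ->]].
  by exists (f z); [apply: mem_gen_field; left; exists z|rewrite rmorphXn].
exists (beta k ^+ (p ^ (ms k - m))%N).
  by apply: (subfieldX gA); apply: mem_gen_field; right; exists k.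
by rewrite -exprM -expnD subnK // hbeta.
Qed.

Lemma OmegaRel_ev n w (d : 'I_n -> F -> E) : OmegaRel f n w ->
  (forall i, exists D : E -> E, derivation idfun D /\ forall x, D (f x) = d i x) ->
  ev f (dm d) w = 0.
Proof.
move=> [dw h0] /choice [D hD].
have := ev_fzero (altder_dm (f := idfun) (fun i => (hD i).1)) h0.
rewrite ev_fmap // => <-; apply: eq_ev => t _; congr (\det _).
by apply/matrixP => j i; rewrite !mxE /= (hD i).2.
Qed.

Lemma der_radical0 (D : E -> E) k : derivation idfun D -> D (f (b k)) = 0.
Proof.
by move=> hD; rewrite -hbeta (derXpn hpE hD) // (leq_trans hm0).
Qed.

Lemma fdeg_fmap n (w : fsum F) : fdeg n w -> fdeg n (fmap f w).
Proof. by rewrite /fdeg all_map; apply: sub_all => t /=; rewrite size_map. Qed.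

Lemma sum_db_rel n w : sum_db_wedge n b w -> OmegaRel f n w.
Proof.
move=> h; have dw := h.1; split=> //; apply/(fzeroP hpE (fdeg_fmap dw)) => D hD.
rewrite ev_fmap //; apply: (sum_db_ev h) => [i|i k]; first exact: der_comp.
exact: der_radical0.
Qed.

Lemma rel_sum_db n w :
  (forall e : E, gen_field (fun y => (exists z, y = f z) \/ (exists i, y = beta i)) e) ->
  OmegaRel f n w -> sum_db_wedge n b w.
Proof.
move=> hgen hw; apply: (sum_db_criterion hp hind hw.1) => D hD hDb.
apply: (fmorph_inj f); rewrite rmorph0 -ev_compl; apply: (OmegaRel_ev hw) => i.
apply: (modular_extend hp hind hbeta (fun k => @leq_bigmax _ ms k) _ _ hgen); first exact: der_compl.
by move=> k; rewrite /= hDb rmorph0.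
Qed.

Variables (t : nat) (b0 : F) (beta0 : E).
Hypotheses (tm : (t < m)%N) (hbeta0 : beta0 ^+ (p ^ m)%N = f b0).
Hypothesis hmax : ~ in_powgen (p ^ t.+1)%N b b0.
Variable x : {ffun 'I_r -> 'I_(p ^ t)} -> F.
Hypothesis hx : b0 = \sum_(i : {ffun 'I_r -> 'I_(p ^ t)}) x i ^+ (p ^ t)%N * \prod_(k < r) b k ^+ i k.
Hypothesis hgen : forall e : E,
  gen_field (fun y => [\/ exists z, y = f z, exists i, y = beta i | y = beta0]) e.

Let U := fun u : fsum F => exists i, u = [:: (1, rcons (fdbs b) (x i))].

Notation be := (bexp ms beta (t := t)).

(** The [n + 1] derivations need not kill [y], but their values at [y] form a single row [v], so
    after a change of basis over [E] at most one of them does not. The other [n] extend to [E]; the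
    value of [w] on them, which is 0, is the cofactor in the expansion along [v]. *)
Lemma rel_wedge_dx n w (D : 'I_n.+1 -> F -> F) i : OmegaRel f n w ->
  (forall i, derivation idfun (D i)) -> (forall i k, D i (b k) = 0) ->
  ev idfun (fun a => dm D (a ++ [:: x i])) w = 0.
Proof.
move=> hw hD hDb; have dw := hw.1.
(* All indices [i] are treated at once: it suffices that the combination with coefficients [be i]
   vanishes in [E], and this is the determinant with last row [v]. *)
apply: (bexp_free hp hind hbeta tm hm (U := fun i => ev idfun (fun a => dm D (a ++ [:: x i])) w)).
pose d k := f \o D k.
have dD k : derivation f (d k) by apply: der_compl.
pose v k := \sum_i be i * d k (x i).
pose Y a : 'M[E]_n.+1 := \matrix_(j, k) if (j < n)%N then d k (nth 0 a j) else v k.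
transitivity (\sum_(s <- w) f s.1 * \det (Y s.2)).
  under eq_bigr => l _ do rewrite rmorph_sum mulr_suml.
  rewrite exchange_big /= !big_seq; apply: eq_bigr => s sw.
  have ss : size s.2 = n by apply/eqP; move/allP: dw; apply.
  rewrite (det_row_sum (j0 := ord_max) (s := index_enum _) (c := be)
    (X := fun l => emx d (s.2 ++ [:: x l]))); last first.
  - by move=> k; rewrite !mxE ltnn; apply: eq_bigr => l _; rewrite !mxE nth_cat ss ltnn subnn.
  - move=> l; apply/matrixP => j k; rewrite !mxE nth_cat ss.
    by rewrite (_ : (lift ord_max j < n)%N) // lift_max ltn_ord.
  rewrite mulr_sumr; apply: eq_bigr => l _; rewrite rmorphM /= -mulrA; congr (_ * _).
  rewrite mulrC; congr (_ * _); rewrite /dm -det_map_mx; congr (\det _).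
  by apply/matrixP => j k; rewrite !mxE.
pose vr : 'rV[E]_n.+1 := \row_k v k.
(* Gaussian elimination on the one-row matrix [vr]: [vr *m P] is supported in the first column. *)
pose P := invmx (row_ebase vr).
have uP : \det P != 0 by rewrite -unitfE -unitmxE unitmx_inv row_ebase_unit.
have vP k : k != ord0 -> (vr *m P) 0 k = 0.
  move=> k0; rewrite -{1}(mulmx_ebase vr) mulmxK ?row_ebase_unit // mxE big_ord1 !mxE.
  by move: k0; rewrite -val_eqE /= eq_sym => /negbTE ->; rewrite mulr0.
apply: (mulIf uP); rewrite mul0r mulr_suml.
pose d' (i : 'I_n) y := \sum_k P k (lift ord0 i) * d k y.
have ev0 : ev f (dm d') w = 0.
  apply: (OmegaRel_ev hw) => l.
  apply: (nonmodular_extend hp hind hbeta msM _ _ tm mM hm hbeta0 hmax hx hgen).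
  - exact: der_lincomb.
  - by move=> k; rewrite /d' big1 // => k' _; rewrite /d /= hDb rmorph0 mulr0.
  - rewrite -[RHS](vP (lift ord0 l)) // [RHS]mxE; under eq_bigr => i' _ do rewrite /d' mulr_suml.
    rewrite exchange_big; apply: eq_bigr => k _; rewrite mxE mulr_suml.
    by apply: eq_bigr => i' _; ring.
pose kap := (vr *m P) 0 ord0.
transitivity (kap * (-1) ^+ n * ev f (dm d') w); last by rewrite ev0 mulr0.
rewrite /ev mulr_sumr; apply: eq_bigr => s _; rewrite -[LHS]mulrA -det_mulmx.
rewrite (expand_det_row _ ord_max) (bigD1 ord0) //= big1 ?addr0 => [|k k0]; last first.
  rewrite (_ : (Y s.2 *m P) ord_max k = 0) ?mul0r // -[RHS](vP k k0) !mxE.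
  by apply: eq_bigr => l _; rewrite !mxE ltnn.
have -> : (Y s.2 *m P) ord_max ord0 = kap.
  by rewrite /kap !mxE; apply: eq_bigr => l _; rewrite !mxE ltnn.
rewrite /cofactor addn0; set mi := \det _.
suff -> : mi = dm d' s.2 by ring.
rewrite /mi /dm; congr (\det _); apply/matrixP => j k; rewrite !mxE.
apply: eq_bigr => l _; rewrite !mxE mulrC.
by rewrite (_ : (lift ord_max j < n)%N) // lift_max ?ltn_ord.
Qed.

(** By [rel_wedge_dx] the wedge of [w] with [dx_i] lies in the sum of the multiples of the [db_k],
    so the product of all [db_k] kills it; moving [dx_i] to the end costs one scalar, common to all
    terms. *)
Lemma rel_ann_dx n w : OmegaRel f n w -> annOmega n r.+1 U w.
Proof.
move=> hw; have dw := hw.1; split=> // u [i ->].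
have dwi : fdeg n.+1 (fwedge w [:: (1, [:: x i])]).
  by rewrite -addn1; apply: fdeg_wedge.
have : sum_db_wedge n.+1 b (fwedge w [:: (1, [:: x i])]).
  apply: (sum_db_criterion hp hind dwi) => D hD hDb.
  by rewrite ev_wedge1r mul1r; apply: rel_wedge_dx.
move=> /(sum_db_ann hp) [_ /(_ _ erefl)].
rewrite addSnnS !fwedge1 -map_comp => /cls0 h0; apply/cls0.
have pe : perm_eq (rcons (fdbs b) (x i)) (x i :: fdbs b) by rewrite perm_rcons.
have [e he] := gen_perm (n + r.+1) pe.
rewrite -[RHS](scaler0 _ e) -h0 !clsE !big_map scaler_sumr !big_seq.
apply: eq_bigr => s sw /=; rewrite he.
  by rewrite -catA /= !scalerA mulrC.
by rewrite size_rcons size_fdbs; congr (_ + _)%N; apply/eqP; move/allP: dw; apply.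
Qed.

(** The restricted derivations [d] kill [b] and [y]. They are completed by [D2]: a derivation [D0]
    killing [b] but not [y], and duals of [b] corrected to kill [y]. The values of [w] wedged with
    the [db_k] and [dx_i] on this tuple, combined with coefficients [be i], give the value of [w] on
    [d] times the nonzero determinant of [LR]. *)
Lemma ann_dx_rel n w : annOmega n r.+1 U w -> OmegaRel f n w.
Proof.
move=> [dw ann]; split=> //; apply/(fzeroP hpE (fdeg_fmap dw)) => D hD; rewrite ev_fmap //.
pose d i := D i \o f.
have dd i : derivation f (d i) by apply: der_comp.
have db i k : d i (b k) = 0 by apply: der_radical0.
have dx j : \sum_i be i * d j (x i) = 0.
  (* [y] is a [p]-th power in [E] because [t < m], and the monomials [be i] are killed by [D j]
     because [t < ms k]; only the terms in [d j (x i)] survive. *)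
  have pw : D j (beta0 ^+ (p ^ (m - t))%N) = 0 by rewrite (derXpn hpE (hD j)) // subn_gt0.
  move: pw; rewrite (beta0_pow hp hbeta tm hm hbeta0 hx) (der_sum (hD j)) => {2}<-.
  apply: eq_bigr => i _; rewrite (derM (hD j)) /= [X in _ = _ * X + _](_ : _ = 0).
    by rewrite mulr0 add0r.
  have kD := der_kernel (hD j).
  apply: (subfield_prod kD) => k _; rewrite exprM (derXpn hpE (hD j)) //.
  by rewrite subn_gt0 (leq_trans tm).
(* If all [x i] were in [F^p(b)], the expansion of [b0] would place it in [F^(p^(t+1))(b)]. *)
have [i0 ni0] : exists i0, ~ in_powgen p b (x i0).
  apply/existsNP => hall; apply: hmax; rewrite hx.
  apply: (subfield_sum (powgenP _ _)) => i _; apply: (subfieldM (powgenP _ _)).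
    by rewrite -[t.+1]add1n; apply: (powgen_frob hp); rewrite expn1.
  exact: powgen_mono.
have [|D0 [hD0 D0b D0x]] := der_separate hp (powgenP b p) _ ni0; first by move=> y; apply: powgen_pow.
pose kap := \sum_i be i * f (D0 (x i)).
have kap0 : kap != 0.
  apply/eqP => eq0; have : D0 (x i0) = 0.
    apply: (bexp_free hp hind hbeta tm hm (U := fun i => D0 (x i))).
    by rewrite -[RHS]eq0; apply: eq_bigr => i _; rewrite mulrC.
  by rewrite D0x => /eqP; rewrite oner_eq0.
have [Db [hDb hDbb]] := pindep_dual hp hind.
pose g k := \sum_i be i * f (Db k (x i)).
(* [kap] and [g k] are the values of [D0] and [Db k] at [y], so this multiple of [D0] cancels the
   value of [Db k] there. *)
pose Db' k y := f (Db k y) - g k / kap * f (D0 y).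
have gx k : \sum_i be i * Db' k (x i) = 0.
  under eq_bigr => i _ do rewrite mulrBr mulrCA.
  by rewrite sumrB -mulr_sumr -/kap -/(g k) divfK // subrr.
pose D2 (k : 'I_r.+1) := if unlift ord_max k is Some k' then Db' k' else f \o D0.
have dD2 k : derivation f (D2 k).
  rewrite /D2; case: unliftP => [k' _|_]; last exact: der_compl.
  by apply: der_subZ; apply: (der_compl f).
pose J := joinD d D2.
have hJ k : derivation f (J k) by apply: joinD_der.
have ev0 i : ev f (fun a => dm J (a ++ rcons (fdbs b) (x i))) w = 0.
  have /ann/(ev_fzero (altder_dm hJ)) : U [:: (1, rcons (fdbs b) (x i))] by exists i.
  by rewrite ev_wedge1r rmorph1 mul1r.
pose LR : 'M[E]_r.+1 := \matrix_(j, k) if (j < r)%N then D2 k (nth 0 (fdbs b) j) else (k == ord_max)%:R * kap.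
pose Y a : 'M[E]_(n + r.+1) := block_mx (emx d a) (\matrix_(j, k) D2 k (nth 0 a j)) 0 LR.
have LR0 : \det LR != 0.
  rewrite det_trig; last first.
    apply/is_trig_mxP => j k jk; rewrite mxE.
    have jr : (j < r)%N by apply: (leq_trans jk); rewrite -ltnS.
    rewrite jr (nth_fdbs b (Ordinal jr)) /D2; case: unliftP => [k' ek|_] /=.
      rewrite /Db' hDbb D0b ?rmorph0 ?mulr0 ?subr0; last exact: powgen_gen.
      case: eqP => [ejk|_]; last by rewrite rmorph0.
      by move: jk; rewrite ek lift_max ejk /= ltnn.
    by rewrite D0b ?rmorph0 //; apply: powgen_gen.
  apply/prodf_neq0 => j _; rewrite mxE; case: ifP => jr.
    rewrite (nth_fdbs b (Ordinal jr)) /D2; case: unliftP => [k' ek|ek] /=.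
      rewrite /Db' hDbb D0b ?rmorph0 ?mulr0 ?subr0; last exact: powgen_gen.
      rewrite (_ : k' == Ordinal jr) ?rmorph1 ?oner_neq0 //.
      by apply/eqP/val_inj; rewrite /= [in RHS]ek lift_max.
    have : (r < r)%N by move: (jr); rewrite {1}ek.
    by rewrite ltnn.
  rewrite (_ : j == ord_max) ?mul1r //; apply/eqP/val_inj => /=.
  by apply/eqP; rewrite eqn_leq -ltnS ltn_ord /= leqNgt jr.
apply: (mulIf LR0); rewrite mul0r /ev mulr_suml.
transitivity (\sum_i be i * ev f (fun a => dm J (a ++ rcons (fdbs b) (x i))) w); last first.
  by rewrite big1 // => i _; rewrite ev0 mulr0.
under [RHS]eq_bigr => i _ do rewrite /ev mulr_sumr.
rewrite exchange_big !big_seq; apply: eq_bigr => s sw.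
have ss : size s.2 = n by apply/eqP; move/allP: dw; apply.
rewrite -[LHS]mulrA {1}/dm -(det_ublock _ (\matrix_(j, k) D2 k (nth 0 s.2 j))) -/(Y s.2).
rewrite (det_row_sum (j0 := rshift n ord_max) (s := index_enum _) (c := be)
   (X := fun i => emx J (s.2 ++ rcons (fdbs b) (x i)))).
- by rewrite mulr_sumr; apply: eq_bigr => i _; rewrite mulrCA.
- move=> i; rewrite /J emx_join //; apply/matrixP => j k; rewrite ![row' _ _ _ _]mxE.
  rewrite /Y; move: (lift _ _) (neq_lift (rshift n ord_max) j) => j' nj.
  rewrite -[j']splitK in nj *; rewrite -[k]splitK; case: (split j') nj => jj nj; case: (split k) => kk;
    rewrite /= ?block_mxEul ?block_mxEur ?block_mxEdl ?block_mxEdr // !mxE.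
  + have jr : (jj < r)%N.
      rewrite ltn_neqAle -ltnS ltn_ord andbT; apply: contra nj => /eqP ejj.
      by apply/eqP; congr (unsplit (inr _)); apply: val_inj.
    by rewrite nth_rcons size_fdbs jr (nth_fdbs b (Ordinal jr)) db.
  + have jr : (jj < r)%N.
      rewrite ltn_neqAle -ltnS ltn_ord andbT; apply: contra nj => /eqP ejj.
      by apply/eqP; congr (unsplit (inr _)); apply: val_inj.
    by rewrite jr nth_rcons size_fdbs jr.
- move=> k; rewrite /Y /J; under eq_bigr => i _ do rewrite emx_join //.
  rewrite -[k]splitK; case: (split k) => kk /=.
    under eq_bigr => i _ do rewrite block_mxEdl mxE nth_rcons size_fdbs ltnn eqxx.
    by rewrite block_mxEdl mxE dx.
  under eq_bigr => i _ do rewrite block_mxEdr mxE nth_rcons size_fdbs ltnn eqxx.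
  rewrite block_mxEdr mxE ltnn /D2; case: unliftP => [k' ->|->].
    by rewrite gx eq_sym (negbTE (neq_lift _ _)) mul0r.
  by rewrite eqxx mul1r.
Qed.

End RelativeForms.

(** * Jacobson's formula *)

Section Jacobson.
Variables (p : nat) (F : fieldType) (hp : p \in [pchar F]).

Lemma frob_nat n : (n%:R : F) ^+ p = n%:R.
Proof.
elim: n => [|n IH]; first by rewrite -(expn1 p) (frob0 hp).
by rewrite -natr1 -(expn1 p) (frobD hp) expr1n expn1 IH.
Qed.

Lemma natp_inj a b : (a < p)%N -> (b < p)%N -> a%:R = b%:R :> F -> a = b.
Proof.
wlog ab : a b / (a <= b)%N.
  by move=> h ha hb e; case: (leqP a b) => [|/ltnW] ab; [apply: h|apply/esym/h].
move=> ha hb /eqP; rewrite eq_sym -subr_eq0 -natrB // -(dvdn_pcharf hp) => dv.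
apply/eqP; rewrite eqn_leq ab -subn_eq0 /=; apply: contraTT dv => ne.
rewrite gtnNdvd ?lt0n //; exact: leq_ltn_trans (leq_subr _ _) hb.
Qed.

Lemma natp_neq0 a : (0 < a < p)%N -> a%:R != 0 :> F.
Proof. by case/andP=> a0 ap; rewrite -(dvdn_pcharf hp) gtnNdvd. Qed.

Lemma prod_XsubC_natp (l : F) : l ^+ p = l -> l != 0 ->
  \prod_(c <- [seq j%:R * l | j <- iota 0 p]) ('X - c%:P) = 'X^p - 'X.
Proof.
move=> lp l0; have p1 := prime_gt1 (pcharf_prime hp).
have sX : size ('X^p - 'X : {poly F}) = p.+1.
  by rewrite size_polyDl ?size_polyXn // size_polyN size_polyX.
have lX : lead_coef ('X^p - 'X : {poly F}) = 1.
  by rewrite lead_coefDl ?lead_coefXn // size_polyXn size_polyN size_polyX.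
rewrite [RHS](@all_roots_prod_XsubC _ _ [seq j%:R * l | j <- iota 0 p]) ?lX ?scale1r //.
- by rewrite sX size_map size_iota.
- apply/allP => c /mapP [j _ ->]; rewrite rootE !hornerE exprMn frob_nat lp subrr //.
- rewrite uniq_rootsE map_inj_in_uniq ?iota_uniq // => i j.
  rewrite !mem_iota !add0n /= => hi hj /(mulIf l0); exact: natp_inj.
Qed.

Variable D : F -> F.
Hypothesis hD : derivation idfun D.

Definition twist (a y : F) : F := D y + a * y.

Lemma twist_leibniz a b g h n : iter n (twist (a + b)) (g * h) =
  \sum_(k < n.+1) ('C(n, k))%:R * (iter (n - k) (twist b) g * iter k (twist a) h).
Proof.
pose A k l := iter k (twist b) g * iter l (twist a) h.
have tA c k l : D c = 0 -> twist (a + b) (c * A k l) = c * A k.+1 l + c * A k l.+1.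
  move=> Dc; rewrite /A /= /twist !(derM hD) Dc /=; ring.
have tD x y : twist (a + b) (x + y) = twist (a + b) x + twist (a + b) y.
  by rewrite /twist (derD hD); ring.
have t0 : twist (a + b) 0 = 0 by rewrite /twist (der0 hD) mulr0 addr0.
have Dn m : D m%:R = 0 by exact: (subfield_nat (der_kernel hD)).
elim: n => [|n IH]; first by rewrite big_ord_recl big_ord0 bin0 mul1r addr0.
rewrite iterS IH (big_morph _ tD t0).
under eq_bigr => k _ do rewrite -/(A _ _) tA //.
rewrite big_split /= [X in X + _]big_ord_recl [RHS]big_ord_recl /= !bin0 subn0 -addrA.
rewrite -/(A n.+1 0%N); congr (_ + _).
under [RHS]eq_bigr => k _ do rewrite /bump /= add1n subSS binS natrD mulrDl -/(A _ _).
rewrite [RHS]big_split /= [X in _ = X + _]big_ord_recr /= bin_small // mul0r addr0.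
congr (_ + _); apply: eq_bigr => k _; rewrite /bump /= add1n (subnSK (ltn_ord k)).
by rewrite /A.
Qed.

Lemma twist_leibniz_p a b g h : iter p (twist (a + b)) (g * h) =
  iter p (twist b) g * h + g * iter p (twist a) h.
Proof.
have p0 := pchar_gt0 hp.
rewrite twist_leibniz big_ord_recl /= bin0 subn0 mul1r; congr (_ + _).
case: p p0 hp => // q _ hp'.
rewrite big_ord_recr /= big1 ?add0r.
  by rewrite /bump /= add1n subnn binn mul1r.
move=> k _; rewrite /bump /= add1n (_ : ('C(q.+1, k.+1))%:R = 0 :> F) ?mul0r //.
apply/eqP; rewrite -(dvdn_pcharf hp') prime_dvd_bin ?(pcharf_prime hp') //=.
by rewrite ltnS ltn_ord.
Qed.

(** Multiplication by this function is the operator [(D + a)^p - D^p], by [twist_iter]; additivity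
    in [a] comes from the binomial formula [twist_leibniz] applied to [1 * 1]. *)
Definition jac a : F := iter p (twist a) 1.

Lemma jacD a b : jac (a + b) = jac a + jac b.
Proof. by rewrite /jac -{1}(mulr1 1) twist_leibniz_p mulr1 mul1r addrC. Qed.

Lemma jac0 : jac 0 = 0.
Proof. by apply: (addrI (jac 0)); rewrite -jacD !addr0. Qed.

Lemma jacN a : jac (- a) = - jac a.
Proof. by apply/eqP; rewrite -addr_eq0 -jacD addNr jac0. Qed.

Lemma jac_sum (I : Type) (s : seq I) (P : pred I) (g : I -> F) :
  jac (\sum_(i <- s | P i) g i) = \sum_(i <- s | P i) jac (g i).
Proof. exact: (big_morph jac jacD jac0). Qed.

Lemma twist_iter a y : iter p (twist a) y = jac a * y + iter p D y.
Proof.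
have eqD n z : iter n (twist 0) z = iter n D z.
  by elim: n => //= n ->; rewrite /twist mul0r addr0.
by rewrite -{1}(mul1r y) -{1}(add0r a) twist_leibniz_p eqD mul1r.
Qed.

Definition act a (P : {poly F}) y : F := \sum_(i < size P) P`_i * iter i (twist a) y.

Lemma act_wide a (P : {poly F}) y n : (size P <= n)%N -> act a P y = \sum_(i < n) P`_i * iter i (twist a) y.
Proof.
move=> sn; rewrite /act (big_ord_widen _ (fun i => P`_i * iter i (twist a) y) sn) big_mkcond /=.
by apply: eq_bigr => i _; case: ltnP => // h; rewrite nth_default // mul0r.
Qed.

Lemma act_XsubC a (P : {poly F}) c y : D c = 0 ->
  act a (('X - c%:P) * P) y = act a P (twist a y - c * y).
Proof.
move=> Dc.
have tB n u v : iter n (twist a) (u - c * v) = iter n (twist a) u - c * iter n (twist a) v.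
  by elim: n => //= n ->; rewrite /twist (derB hD) (derM hD) Dc /=; ring.
rewrite (@act_wide a (_ * P) _ (size P).+1); last first.
  by rewrite (leq_trans (size_polyMleq _ _)) // size_XsubC.
under eq_bigr => i _ do rewrite mulrBl coefB coefXM coefCM mulrBl.
rewrite sumrB big_ord_recl /= mul0r add0r big_ord_recr /= [P`_(size P)]nth_default //.
rewrite mulr0 mul0r addr0 -sumrB /act; apply: eq_bigr => i _.
by rewrite tB /bump /= -iterSr /=; ring.
Qed.

(** When [D g = l g], the operator [D + g - i l] sends [g^i] to [g^(i+1)], so the product
    telescopes. *)
Lemma act_prod_eigen l g i n : D l = 0 -> D g = l * g ->
  act g (\prod_(c <- [seq j%:R * l | j <- iota i n]) ('X - c%:P)) (g ^+ i) = g ^+ (i + n).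
Proof.
move=> Dl Dg; elim: n i => [|n IH] i.
  by rewrite big_nil /act size_poly1 big_ord1 coef1 mul1r addn0.
rewrite /= big_cons act_XsubC; last first.
  by apply: (subfieldM (der_kernel hD)) => //; apply: (subfield_nat (der_kernel hD)).
rewrite (_ : twist g (g ^+ i) - i%:R * l * g ^+ i = g ^+ i.+1) ?IH ?addSnnS //.
rewrite /twist (derX hD) /= Dg exprS; case: i => [|i] /=.
  by rewrite mulr0n !mul0r expr0; ring.
by rewrite -mulr_natr exprS; ring.
Qed.

Lemma act_Xp a y : act a ('X^p - 'X) y = iter p (twist a) y - twist a y.
Proof.
have p1 := prime_gt1 (pcharf_prime hp).
rewrite (@act_wide _ _ _ p.+1); last first.
  by rewrite size_polyDl ?size_polyXn // size_polyN size_polyX.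
under eq_bigr => i _ do rewrite coefB coefXn coefX mulrBl.
rewrite sumrB (bigD1 ord_max) //= eqxx mul1r big1 ?addr0; last first.
  by move=> i /negbTE; rewrite -val_eqE /= => ->; rewrite mul0r.
rewrite (bigD1 (Ordinal (ltnW p1 : (1 < p.+1)%N))) //= mul1r big1 ?addr0 //.
by move=> i /negbTE; rewrite -val_eqE /= => ->; rewrite mul0r.
Qed.

(** For [l != 0] the factors [X - j l] multiply to [X^p - X], so telescoping gives
    [(T^p - T) 1 = g^p] with [T = D + g], while [T 1 = g]. For [l = 0] the iterates are powers of
    [g], and [l^(p-1) = 0] removes the second term. *)
Lemma jac_eigen l g : D l = 0 -> l ^+ p = l -> D g = l * g -> jac g = g ^+ p + l ^+ p.-1 * g.
Proof.
move=> Dl lp Dg; case: (eqVneq l 0) => [l0|l0].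
  rewrite l0 mul0r in Dg; rewrite l0 expr0n.
  rewrite (_ : p.-1 == 0%N = false) ?mul0r ?addr0; last first.
    by case: p (prime_gt1 (pcharf_prime hp)) => [|[]].
  rewrite /jac; elim: p => //= n ->; rewrite /twist (derX hD) Dg mulr0 add0r.
  by rewrite exprS.
have -> : l ^+ p.-1 = 1.
  by apply: (mulfI l0); rewrite -exprS prednK ?lp ?mulr1 // (pchar_gt0 hp).
have := @act_prod_eigen l g 0 p Dl Dg; rewrite prod_XsubC_natp // expr0 add0n act_Xp.
rewrite /jac => <-; rewrite -[twist g 1]/(D 1 + g * 1) (der1 hD); ring.
Qed.

(** The factors are applied one by one; the last vector before 0 is an eigenvector. [S] records that
    the search stays in a given subfield. *)
Lemma act_eigenvector (S : F -> Prop) a (s : seq F) y :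
  (forall z c, S z -> c \in s -> S (twist a z - c * z)) -> {in s, forall c, D c = 0} ->
  S y -> y != 0 -> act a (\prod_(c <- s) ('X - c%:P)) y = 0 ->
  exists z c, [/\ S z, z != 0, c \in s & twist a z = c * z].
Proof.
elim: s y => [|c s IH] y St Ds Sy y0.
  by rewrite big_nil /act size_poly1 big_ord1 coef1 mul1r => e; rewrite -e eqxx in y0.
rewrite big_cons act_XsubC ?Ds ?mem_head // => h.
case: (eqVneq (twist a y - c * y) 0) => [e|ne].
  by exists y, c; rewrite mem_head; split=> //; apply/eqP; rewrite -subr_eq0 e.
have [|||z [c' [Sz z0 cs ez]]] := IH _ _ _ _ ne h.
- by move=> z c' Sz cs; apply: St => //; rewrite inE cs orbT.
- by move=> c' cs; apply: Ds; rewrite inE cs orbT.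
- by apply: St => //; rewrite mem_head.
by exists z, c'; rewrite inE cs orbT.
Qed.

(* [u = jac u] says that [T = D - u] satisfies [T^p = T] on the orbit of 1, whence [T] has an
   eigenvector with eigenvalue [j] in the prime field; multiply it by [w ^ (p - j)]. *)
Lemma log_derivative_solution (S : F -> Prop) u w : is_subfield S -> (forall z, S z -> S (D z)) ->
  S u -> S w -> w != 0 -> D w = w -> jac u = u ->
  exists y, [/\ S y, y != 0 & D y = u * y].
Proof.
move=> hS SD Su Sw w0 Dw ju.
have Sn n : S n%:R by apply: (subfield_nat hS).
have Dn n : D n%:R = 0 by apply: (subfield_nat (der_kernel hD)).
have h : act (- u) (\prod_(c <- [seq j%:R * 1 | j <- iota 0 p]) ('X - c%:P)) 1 = 0.
  rewrite prod_XsubC_natp ?expr1n ?oner_neq0 // act_Xp -/(jac _) jacN ju /twist (der1 hD); ring.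
have [||z [c [Sz z0 /mapP [j]]]] := act_eigenvector (S := S) _ _ (subfield1 hS) (oner_neq0 _) h.
- move=> z c Sz /mapP [j _ ->]; rewrite /twist mulr1 mulNr.
  apply: (subfieldB hS); last exact: (subfieldM hS).
  by apply: (subfieldB hS); [apply: SD|apply: (subfieldM hS)].
- by move=> c /mapP [j _ ->]; rewrite mulr1.
rewrite mem_iota add0n mulr1 => /= jp -> ez.
exists (z * w ^+ (p - j)); split.
- by apply: (subfieldM hS) => //; apply: (subfieldX hS).
- by rewrite mulf_neq0 // expf_neq0.
- rewrite (derM hD) (derX hD) Dw /=.
  have -> : D z = (u + j%:R) * z.
    by move/eqP: ez; rewrite /twist mulNr subr_eq => /eqP ->; ring.
  have -> : w ^+ (p - j).-1 *+ (p - j) * w = - (j%:R * w ^+ (p - j)).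
    rewrite mulrnAl -exprSr prednK ?subn_gt0 // -mulr_natl natrB ?(ltnW jp) //.
    by rewrite (pcharf0 hp) sub0r mulNr.
  ring.
Qed.

End Jacobson.

(** The operator [l j k - T k] kills the head term [j] and rescales the others, the term [i]
    separated from [j] by [k] with a nonzero factor. *)
Lemma eigen_free (F : fieldType) (N : nat) (I : eqType) (T : 'I_N -> F -> F) (l : I -> 'I_N -> F)
  (s : seq I) (g : I -> F) :
  (forall k, derivation idfun (T k)) -> (forall k k' i, T k (l i k') = 0) ->
  (forall k i, i \in s -> T k (g i) = l i k * g i) ->
  {in s &, forall i j, i != j -> exists k, l i k != l j k} -> uniq s ->
  \sum_(i <- s) g i = 0 -> {in s, forall i, g i = 0}.
Proof.
move=> Td Tl; elim: s g => [//|j s IH] g Tg sep /= /andP[js us].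
rewrite big_cons => sum0.
have gs0 : {in s, forall i, g i = 0}.
  move=> i is_; have ij : j != i by apply: contra js => /eqP ->.
  have [k lk] : exists k, l j k != l i k by apply: sep; rewrite ?inE ?eqxx ?is_ ?orbT.
  pose g' i := (l j k - l i k) * g i.
  have Tg' k' i' : i' \in s -> T k' (g' i') = l i' k' * g' i'.
    move=> is'; rewrite /g' (derM (Td k')) /= Tg; last by rewrite inE is' orbT.
    by rewrite (derB (Td k')) !Tl subrr mulr0 addr0 mulrCA.
  have sep' : {in s &, forall i j, i != j -> exists k, l i k != l j k}.
    by move=> i1 i2 h1 h2; apply: sep; rewrite inE ?h1 ?h2 orbT.
  have sum' : \sum_(i <- s) g' i = 0.
    have : T k (g j + \sum_(i <- s) g i) = 0 by rewrite sum0 (der0 (Td k)).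
    rewrite (derD (Td k)) (der_sum (Td k)) Tg ?mem_head // => h.
    under eq_bigr => i' _ do rewrite /g' mulrBl.
    rewrite sumrB -mulr_sumr; apply/eqP; rewrite subr_eq0; apply/eqP.
    have -> : \sum_(i <- s) g i = - g j by apply/eqP; rewrite -addr_eq0 addrC sum0.
    rewrite mulrN; apply/eqP; rewrite eq_sym -addr_eq0 addrC -[X in _ == X]h; apply/eqP.
    congr (_ + _); rewrite !big_seq; apply: eq_bigr => i' is'.
    by rewrite Tg // inE is' orbT.
  have /eqP := IH _ Tg' sep' us sum' i is_; rewrite mulf_eq0 subr_eq0 (negbTE lk) /=.
  by move=> /eqP.
move=> i; rewrite inE => /orP[/eqP ->|/gs0 //].
by rewrite -[RHS]sum0 big_seq [X in _ + X]big1 ?addr0 // => i' /gs0.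
Qed.

(** * Weights and logarithmic forms *)

Lemma sum_sym_alt (R : zmodType) n (G : 'I_n -> 'I_n -> R) :
  (forall a b, G b a = - G a b) -> (forall a, G a a = 0) -> \sum_a \sum_b G a b = 0.
Proof.
move=> anti diag.
have split a : \sum_b G a b = \sum_(b < n | (b < a)%N) G a b + \sum_(b < n | (a < b)%N) G a b.
  rewrite (bigID (fun b : 'I_n => (b < a)%N)) /=; congr (_ + _).
  rewrite (bigD1 a) ?ltnn //= diag add0r; apply: eq_bigl => b.
  by rewrite -leqNgt [RHS]ltn_neqAle -val_eqE /= eq_sym andbC.
under eq_bigr => a _ do rewrite split.
rewrite big_split /= [X in _ + X](exchange_big_dep xpredT) //= -big_split big1 // => a _ /=.
by rewrite -big_split big1 // => b _ /=; rewrite [G b a]anti addrN.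
Qed.

Section DerivationsOfDeterminants.
Variables (F : fieldType) (D : F -> F).
Hypothesis hD : derivation idfun D.

Lemma der_prod (I : eqType) (s : seq I) (g : I -> F) : uniq s ->
  D (\prod_(i <- s) g i) = \sum_(j <- s) D (g j) * \prod_(i <- s | i != j) g i.
Proof.
elim: s => [|x s IH] /=; first by rewrite !big_nil (der1 hD).
case/andP=> xs us; rewrite !big_cons (derM hD) /= IH // eqxx /= addrC mulrC; congr (_ * _ + _).
  rewrite big_seq [RHS]big_seq_cond; apply: eq_bigl => i.
  by case: (boolP (i \in s)) => //= is_; apply/esym; apply: contra xs => /eqP <-.
rewrite mulr_sumr !big_seq; apply: eq_bigr => j js.
have xj : x != j by apply: contra xs => /eqP ->.
by rewrite big_cons xj mulrCA.
Qed.

Lemma der_det n (A : 'M[F]_n) :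
  D (\det A) = \sum_j \det (\matrix_(i, l) if i == j then D (A i l) else A i l).
Proof.
rewrite /determinant (der_sum hD) exchange_big /=; apply: eq_bigr => s _.
rewrite (der_sign hD) -mulr_sumr; congr (_ * _).
rewrite der_prod ?index_enum_uniq //; apply: eq_bigr => j _.
rewrite [RHS](bigD1 j) //= mxE eqxx; congr (_ * _).
by apply: eq_bigr => i /negbTE ij; rewrite mxE ij.
Qed.

End DerivationsOfDeterminants.

Section Closedness.
Variables (F : fieldType).

(* The closedness of a product of closed 1-forms, written on coefficients: [al j l] is
   the [l]-th coefficient of the [j]-th form. *)
Lemma closed_det n (T : 'I_n.+1 -> F -> F) (al : 'I_n -> 'I_n.+1 -> F) :
  (forall i, derivation idfun (T i)) -> (forall j i l, T i (al j l) = T l (al j i)) ->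
  \sum_(i < n.+1) (-1) ^+ i * T i (\det (\matrix_(j < n, l < n) al j (lift i l))) = 0.
Proof.
move=> hT sym; under eq_bigr => i _ do rewrite (der_det (hT i)) mulr_sumr.
rewrite exchange_big big1 // => j _ /=.
(* A bordered matrix: row 0 selects the column [a] omitted by [lift a], and the row of [j] is the
   unit vector at [b]. Its determinant is antisymmetric in [a] and [b] while [T a (al j b)] is
   symmetric, so the double sum cancels. *)
pose Q a b : 'M[F]_n.+1 := \matrix_(i, l) if unlift ord0 i is Some i' then
   (if i' == j then (l == b)%:R else al i' l) else (l == a)%:R.
pose G a b := T a (al j b) * \det (Q a b).
transitivity (\sum_a \sum_b G a b); last first.
  apply: sum_sym_alt => [a b|a]; rewrite /G.
    rewrite sym; suff -> : Q b a = row_perm (tperm ord0 (lift ord0 j)) (Q a b).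
      rewrite row_permE det_mulmx det_perm odd_tperm (neq_lift ord0 j) expr1.
      by rewrite mulN1r mulrN.
    apply/matrixP => i l; rewrite !mxE; case: tpermP => [->|->|ne0 nej].
    - by rewrite unlift_none liftK eqxx.
    - by rewrite unlift_none liftK eqxx.
    - case: unliftP => [i' ei|ei]; last by case: ne0.
      by case: eqP => // ei'; case: nej; rewrite ei ei'.
  rewrite (@determinant_alternate _ _ _ ord0 (lift ord0 j)) ?mulr0 ?neq_lift // => l.
  by rewrite !mxE unlift_none liftK eqxx.
apply: eq_bigr => a _.
rewrite (det_row_sum (j0 := j) (s := index_enum 'I_n.+1) (c := fun b => T a (al j b))
  (X := fun b => \matrix_(i, l) if i == j then (lift a l == b)%:R else al i (lift a l))).
- rewrite mulr_sumr; apply: eq_bigr => b _; rewrite /G mulrCA; congr (_ * _).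
  rewrite (expand_det_row (Q a b) ord0) (bigD1 a) //= [X in _ + X]big1 ?addr0; last first.
    by move=> l /negbTE la; rewrite !mxE unlift_none la mul0r.
  rewrite !mxE unlift_none eqxx mul1r /cofactor add0n; congr (_ * \det _).
  by apply/matrixP => i l; rewrite !mxE liftK.
- move=> b; apply/matrixP => i l; rewrite !mxE; rewrite eq_sym (negbTE (neq_lift _ _)) //.
- move=> l; rewrite !mxE eqxx (bigD1 (lift a l)) //= !mxE !eqxx mulr1 big1 ?addr0 //.
  by move=> b /negbTE nb; rewrite !mxE eqxx eq_sym nb mulr0.
Qed.

End Closedness.

Section Weights.
Variables (p : nat) (F : fieldType) (hp : p \in [pchar F]).
Variables (N : nat) (c : 'I_N -> F) (D : 'I_N -> F -> F).
Hypothesis hD : dual_system c D.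

Notation Wt := {ffun 'I_N -> 'I_p}.
Notation L := (in_powgen p c).

Let hL : is_subfield L := powgenP c p.
Let p1 : (1 < p)%N := prime_gt1 (pcharf_prime hp).
Let p0 : (0 < p)%N := ltnW p1.

Definition th k (x : F) := c k * D k x.

Lemma th_der k : derivation idfun (th k).
Proof. by case: hD => hd _; apply: (der_scale (f := idfun)). Qed.

Lemma th_gen k l : th k (c l) = (k == l)%:R * c l.
Proof.
case: hD => _ hdc; rewrite /th hdc; case: eqP => [->|_]; last by rewrite mulr0 mul0r.
by rewrite mulr1 mul1r.
Qed.

Lemma gen_neq0 k : c k != 0.
Proof.
case: hD => hd hdc; apply/eqP => ck0; have := hdc k k.
by rewrite eqxx ck0 (der0 (hd k)) => /eqP; rewrite eq_sym oner_eq0.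
Qed.

Lemma th_pow k z : th k (z ^+ p) = 0.
Proof. exact: (derXp hp (th_der k)). Qed.

Lemma th_mono k z (e : 'I_N -> nat) :
  th k (z ^+ p * mono c e) = (e k)%:R * (z ^+ p * mono c e).
Proof.
rewrite (derM (th_der k)) /= th_pow mulr0 addr0 [RHS]mulrCA; congr (_ * _).
have ker := der_kernel (th_der k).
have rest0 : th k (\prod_(l < N | l != k) c l ^+ e l) = 0.
  apply: (subfield_prod ker) => l lk; apply: (subfieldX ker).
  by rewrite th_gen eq_sym (negbTE lk) mul0r.
rewrite /mono (bigD1 k) //= (derM (th_der k)) /= rest0 mulr0 add0r.
rewrite (derX (th_der k)) /= th_gen eqxx mul1r; case: (e k) => [|n] /=.
  by rewrite mulr0n mul0r mulr0 mul0r.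
by rewrite mulrnAl -exprSr -[X in _ * X]mulr_natl; ring.
Qed.

Definition zwt : Wt := modexp hp (fun=> 0%N).

Lemma zwtE k : zwt k = 0%N :> nat.
Proof. by rewrite ffunE /= mod0n. Qed.

Lemma zwtP (i : Wt) : i != zwt -> exists k, (i k : nat) != 0%N.
Proof.
move=> iz; apply/existsP; apply: contraNT iz => /existsPn h; apply/eqP/ffunP => k.
by apply: val_inj; rewrite /= zwtE; apply/eqP; have := h k; rewrite negbK.
Qed.

Lemma wt_neq0 (i : Wt) k : (i k : nat) != 0%N -> (i k)%:R != 0 :> F.
Proof. by move=> ik; apply: (natp_neq0 hp); rewrite lt0n ik ltn_ord. Qed.

Lemma wt_uniq (g : Wt -> F) : (forall k i, th k (g i) = (i k)%:R * g i) ->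
  \sum_i g i = 0 -> forall i, g i = 0.
Proof.
move=> hg sum0 i.
apply: (eigen_free (T := th) (l := fun (i : Wt) k => (i k)%:R : F) (s := index_enum _) th_der) => //.
- by move=> k k' j; apply: (subfield_nat (der_kernel (th_der k))).
- move=> i1 i2 _ _ i12; apply/existsP; apply: contraNT i12 => /existsPn h; apply/eqP/ffunP => k.
  by apply: val_inj; apply: (natp_inj hp); rewrite ?ltn_ord //; apply/eqP; have := h k; rewrite negbK.
- exact: index_enum_uniq.
- exact: mem_index_enum.
Qed.

Lemma cmp_exists : exists cmp : F -> Wt -> F, forall x, L x ->
  (forall i, exists z, cmp x i = z ^+ p * mono c (fun k => i k)) /\ x = \sum_i cmp x i.
Proof.
suff /choice [cmp h] : forall x, exists g : Wt -> F, L x ->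
   (forall i, exists z, g i = z ^+ p * mono c (fun k => i k)) /\ x = \sum_i g i by exists cmp.
move=> x; case: (pselect (L x)) => [Lx|nL]; last by exists (fun=> 0).
have Lx1 : in_powgen (p ^ 1)%N c x by rewrite expn1.
have [g [_ ->]] := powgen_coords hp Lx1.
by exists (fun i => g i ^+ p * mono c (fun k => i k)) => _; split=> // i; exists (g i).
Qed.

Variable cmp : F -> Wt -> F.
Hypothesis cmpP : forall x, L x ->
  (forall i, exists z, cmp x i = z ^+ p * mono c (fun k => i k)) /\ x = \sum_i cmp x i.

Lemma cmp_sum x : L x -> x = \sum_i cmp x i.
Proof. by move=> /cmpP []. Qed.

Lemma th_cmp x k i : L x -> th k (cmp x i) = (i k)%:R * cmp x i.
Proof. by move=> /cmpP [/(_ i) [z ->] _]; rewrite th_mono. Qed.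

Lemma L_cmp x i : L x -> L (cmp x i).
Proof.
move=> /cmpP [/(_ i) [z ->] _]; apply: (subfieldM hL); first exact: powgen_pow.
exact: powgen_mono.
Qed.

(** Weight spaces are independent by [eigen_free], so components are identified by exhibiting any
    decomposition into eigenvectors; most of the rules for [cmp] are obtained this way. *)
Lemma cmp_uniq x (g : Wt -> F) : L x -> (forall k i, th k (g i) = (i k)%:R * g i) ->
  x = \sum_i g i -> cmp x =1 g.
Proof.
move=> Lx hg eqx i; apply/eqP; rewrite -subr_eq0; apply/eqP.
apply: (wt_uniq (g := fun i => cmp x i - g i)) => [k j|].
  by rewrite (derB (th_der k)) hg th_cmp // mulrBr.
by rewrite sumrB -cmp_sum // -eqx subrr.
Qed.

Lemma cmpD x y i : L x -> L y -> cmp (x + y) i = cmp x i + cmp y i.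
Proof.
move=> Lx Ly; apply: (@cmp_uniq (x + y) (fun i => cmp x i + cmp y i)).
- exact: (subfieldD hL).
- by move=> k j; rewrite (derD (th_der k)) !th_cmp // mulrDr.
- by rewrite big_split -!cmp_sum.
Qed.

Lemma cmp0 i : cmp 0 i = 0.
Proof. by apply: (addrI (cmp 0 i)); rewrite -cmpD ?addr0 //; apply: (subfield0 hL). Qed.

Lemma cmpN x i : L x -> cmp (- x) i = - cmp x i.
Proof.
by move=> Lx; apply/eqP; rewrite -addr_eq0 -cmpD ?addNr ?cmp0 //; apply: (subfieldN hL).
Qed.

Lemma cmp_bigsum (I : Type) (s : seq I) (P : pred I) (g : I -> F) i : (forall j, P j -> L (g j)) ->
  cmp (\sum_(j <- s | P j) g j) i = \sum_(j <- s | P j) cmp (g j) i.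
Proof.
move=> Lg; elim: s => [|j s IH]; first by rewrite !big_nil cmp0.
rewrite !big_cons; case: ifP => // Pj; rewrite cmpD ?IH //; first exact: Lg.
exact: (subfield_sum hL).
Qed.

Lemma cmp_scale z x i : L x -> cmp (z ^+ p * x) i = z ^+ p * cmp x i.
Proof.
move=> Lx; apply: (@cmp_uniq _ (fun i => z ^+ p * cmp x i)).
- by apply: (subfieldM hL) => //; apply: powgen_pow.
- by move=> k j; rewrite (derM (th_der k)) /= th_pow mulr0 addr0 th_cmp // mulrCA.
- by rewrite -mulr_sumr -cmp_sum.
Qed.

Lemma cmp_sign n x i : L x -> cmp ((-1) ^+ n * x) i = (-1) ^+ n * cmp x i.
Proof.
move=> Lx; rewrite -signr_odd; case: (odd n); rewrite /= ?expr0 ?mul1r //.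
by rewrite expr1 !mulN1r cmpN.
Qed.

Lemma cmp_pow z i : cmp (z ^+ p) i = (i == zwt)%:R * z ^+ p.
Proof.
apply: (@cmp_uniq _ (fun i => (i == zwt)%:R * z ^+ p)).
- exact: powgen_pow.
- move=> k j; case: eqP => [->|_]; last by rewrite mul0r mulr0 (der0 (th_der k)).
  by rewrite mul1r th_pow zwtE mul0r.
- by rewrite (bigD1 zwt) //= eqxx mul1r big1 ?addr0 // => j /negbTE ->; rewrite mul0r.
Qed.

Lemma th_sum x k : L x -> th k x = \sum_(i : Wt) (i k)%:R * cmp x i.
Proof.
move=> Lx; rewrite {1}(cmp_sum Lx) (der_sum (th_der k)).
by apply: eq_bigr => i _; rewrite th_cmp.
Qed.

Lemma L_th x k : L x -> L (th k x).
Proof.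
move=> Lx; rewrite th_sum //; apply: (subfield_sum hL) => i _.
by apply: (subfieldM hL); [apply: (subfield_nat hL)|apply: L_cmp].
Qed.

Lemma cmp_th x k i : L x -> cmp (th k x) i = (i k)%:R * cmp x i.
Proof.
move=> Lx; apply: (@cmp_uniq _ (fun i : Wt => (i k)%:R * cmp x i)).
- exact: L_th.
- move=> l j; rewrite (derM (th_der l)) /= (_ : th l (j k)%:R = 0) ?mulr0 ?addr0.
    by rewrite th_cmp // mulrCA.
  exact: (subfield_nat (der_kernel (th_der l))).
- exact: th_sum.
Qed.

Lemma th_comm k l x : L x -> th k (th l x) = th l (th k x).
Proof.
move=> Lx; rewrite (th_sum k (L_th l Lx)) (th_sum l (L_th k Lx)).
by apply: eq_bigr => i _; rewrite !cmp_th // mulrCA.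
Qed.

Lemma th_iter k x : L x -> iter p (th k) x = th k x.
Proof.
move=> Lx; have Ln n : L (iter n (th k) x) by elim: n => //= n; apply: L_th.
have cn n i : cmp (iter n (th k) x) i = (i k)%:R ^+ n * cmp x i.
  by elim: n => [|n IH]; rewrite ?expr0 ?mul1r //= cmp_th // IH exprS mulrA.
rewrite (cmp_sum (Ln p)) (th_sum k Lx); apply: eq_bigr => i _.
by rewrite cn (frob_nat hp).
Qed.

Lemma th0P x k : L x -> th k x = 0 <-> (forall i : Wt, (i k : nat) != 0%N -> cmp x i = 0).
Proof.
move=> Lx; split=> [h i ik|h].
  have /eqP := cmp_th k i Lx; rewrite h cmp0 eq_sym mulf_eq0 (negbTE (wt_neq0 ik)) /=.
  by move=> /eqP.
rewrite th_sum // big1 // => i _; case: (eqVneq (i k : nat) 0%N) => [->|/h ->].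
  by rewrite mul0r.
by rewrite mulr0.
Qed.

(** [jac] is additive and each component is an eigenvector, so [jac_eigen] applies; the factor
    [(i k)^(p-1)] is 1 for nonzero weight in [k] and 0 otherwise. *)
Lemma jac_cmp u k : L u -> jac p (th k) u = u ^+ p + \sum_(i : Wt | (i k : nat) != 0%N) cmp u i.
Proof.
move=> Lu; rewrite {1}(cmp_sum Lu) (jac_sum hp (th_der k)).
have ker := der_kernel (th_der k).
rewrite (eq_bigr (fun i : Wt => cmp u i ^+ p + (i k)%:R ^+ p.-1 * cmp u i)); last first.
  move=> i _; apply: (jac_eigen hp (th_der k)); last exact: th_cmp.
    exact: (subfield_nat ker).
  exact: (frob_nat hp).
rewrite big_split /=; congr (_ + _).
  by rewrite {2}(cmp_sum Lu) -[X in _ ^+ X](expn1 p) (frob_sum hp) expn1.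
rewrite [RHS]big_mkcond; apply: eq_bigr => i _; case: eqP => /= [->|/eqP ik].
  by rewrite expr0n -subn1 subn_eq0 leqNgt p1 mul0r.
rewrite -[RHS]mul1r; congr (_ * _); apply: (mulfI (wt_neq0 ik)).
by rewrite -exprS prednK // (frob_nat hp) mulr1.
Qed.

Section LogForm.
Variables (y : F) (Ly : L y) (y0 : y != 0).

Definition lf k := th k y / y.

Lemma L_lf k : L (lf k).
Proof. by apply: (subfieldM hL); [apply: L_th|apply: (subfieldV hL)]. Qed.

Lemma lf_closed k l : th k (lf l) = th l (lf k).
Proof.
rewrite /lf (derM (th_der k)) (derM (th_der l)) /= (derV (th_der k) y0) (derV (th_der l) y0) /=.
by rewrite (th_comm k l Ly); ring.
Qed.

(** The operator [T = th k - lf k] kills [y]. Jacobson's formula for [T^p y = 0], with [th_iter] for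
    the [p]-th iterate of [th k], determines [jac]. *)
Lemma jac_lf k : jac p (th k) (lf k) = lf k.
Proof.
have t0 : twist (th k) (- lf k) y = 0 by rewrite /twist mulNr /lf divfK // subrr.
have := twist_iter hp (th_der k) (- lf k) y.
have -> : iter p (twist (th k) (- lf k)) y = 0.
  rewrite -(prednK p0) iterSr t0; elim: p.-1 => //= n ->.
  by rewrite /twist (der0 (th_der k)) mulr0 addr0.
rewrite th_iter // (jacN hp (th_der k)) mulNr => /esym/eqP; rewrite addrC subr_eq0 => /eqP e.
by apply: (mulIf y0); rewrite -e /lf divfK.
Qed.

Lemma cmp_lf_sym k l (i : Wt) : (i l)%:R * cmp (lf k) i = (i k)%:R * cmp (lf l) i.
Proof. by rewrite -(cmp_th l i (L_lf k)) -(cmp_th k i (L_lf l)) lf_closed. Qed.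

(** Comparing [jac_lf] with [jac_cmp], the components of weight 0 in [k] add up to [lf k ^+ p].
    Closedness removes those with a nonzero weight in some other [l]. *)
Lemma cmp_lf_zwt k : cmp (lf k) zwt = lf k ^+ p.
Proof.
have := jac_cmp k (L_lf k); rewrite jac_lf.
rewrite {1}(cmp_sum (L_lf k)) (bigID (fun i : Wt => (i k : nat) != 0%N)) /= addrC => /addIr <-.
rewrite (bigD1 zwt) /= ?zwtE // big1 ?addr0 // => i /andP[/negPn/eqP ik /zwtP [l il]].
have /eqP := cmp_lf_sym k l i; rewrite ik mul0r mulf_eq0 (negbTE (wt_neq0 il)) /=.
by move=> /eqP.
Qed.

(* The Cartier operator fixes logarithmic forms: [(dy/y)^p - dy/y] is exact. *)
Lemma lf_exact : exists2 e, L e & forall k, th k e = lf k ^+ p - lf k.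
Proof.
have /choice [s hs] : forall i : Wt, exists x : F, i != zwt ->
    L x /\ forall k, th k x = cmp (lf k) i.
  move=> i; case: (boolP (i == zwt)) => [_|/zwtP [l il]]; first by exists 0.
  (* A closed form of nonzero weight is integrated by dividing by a nonzero coordinate of the
     weight; [cmp_lf_sym] makes the same primitive work for every [k]. *)
  exists ((i l)%:R^-1 * cmp (lf l) i) => _; split.
    apply: (subfieldM hL); last by apply: L_cmp; apply: L_lf.
    by apply: (subfieldV hL); apply: (subfield_nat hL).
  move=> k; have ker := der_kernel (th_der k).
  rewrite (derM (th_der k)) /= (_ : th k (i l)%:R^-1 = 0) ?mulr0 ?addr0; last first.
    by apply: (subfieldV ker); apply: (subfield_nat ker).
  rewrite th_cmp; last exact: L_lf.
  by rewrite -cmp_lf_sym mulrA mulVf ?mul1r // wt_neq0.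
exists (- \sum_(i | i != zwt) s i).
  by apply: (subfieldN hL); apply: (subfield_sum hL) => i /hs [].
move=> k; rewrite (derN (th_der k)) (der_sum (th_der k)) -cmp_lf_zwt.
rewrite {2}(cmp_sum (L_lf k)) [X in _ = _ - X](bigD1 zwt) //= opprD addrA subrr sub0r.
by congr (- _); apply: eq_bigr => i /hs [_ ->].
Qed.

End LogForm.

Section Positions.
Variables (n : nat) (T : 'I_n -> F -> F) (hT : forall i, exists k, T i = th k).

Lemma pos_der i : derivation idfun (T i).
Proof. by case: (hT i) => k ->; apply: th_der. Qed.

Lemma pos_L i x : L x -> L (T i x).
Proof. by case: (hT i) => k ->; apply: L_th. Qed.

Lemma pos_comm i l x : L x -> T i (T l x) = T l (T i x).
Proof. by case: (hT i) => k ->; case: (hT l) => k' ->; apply: th_comm. Qed.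

Lemma cmp_pos i x : L x -> cmp (T i x) zwt = 0.
Proof. by case: (hT i) => k -> Lx; rewrite cmp_th // zwtE mul0r. Qed.

End Positions.

Lemma L_det n (A : 'M[F]_n) : (forall i j, L (A i j)) -> L (\det A).
Proof.
move=> LA; apply: (subfield_sum hL) => s _; apply: (subfieldM hL).
  by apply: (subfieldX hL); apply: (subfieldN hL); apply: (subfield1 hL).
by apply: (subfield_prod hL).
Qed.

(** The wedge of [de] with closed forms is the differential of [e] times the rest: the minors along
    row [j0] satisfy [closed_det], so the terms can be rewritten as [T l (e * mi l)], and a
    [th]-derivative has no component of weight zero. *)
Lemma cmp_exact_det n (T : 'I_n -> F -> F) (hT : forall i, exists k, T i = th k)
  (j0 : 'I_n) (e : F) (Z : 'M[F]_n) :
  L e -> (forall l, Z j0 l = T l e) -> (forall j l, L (Z j l)) ->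
  (forall j i l, j != j0 -> T i (Z j l) = T l (Z j i)) ->
  cmp (\det Z) zwt = 0.
Proof.
case: n T hT j0 Z => [T hT []//|n] T hT j0 Z Le Z0 LZ symZ.
pose al (j : 'I_n) l := Z (lift j0 j) l.
have sym j i l : T i (al j l) = T l (al j i) by apply: symZ; rewrite eq_sym neq_lift.
pose mi (l : 'I_n.+1) := \det (\matrix_(j < n, l' < n) al j (lift l l')).
have Lm l : L (mi l) by apply: L_det => i j; rewrite mxE; apply: LZ.
have cl := closed_det (pos_der hT) sym.
have -> : \det Z = \sum_(l < n.+1) (-1) ^+ (j0 + l) * T l (e * mi l).
  rewrite (expand_det_row _ j0).
  transitivity (\sum_(l < n.+1) ((-1) ^+ (j0 + l) * T l (e * mi l) -
      (-1) ^+ j0 * (e * ((-1) ^+ l * T l (mi l))))).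
    apply: eq_bigr => l _; rewrite Z0 /cofactor (derM (pos_der hT l)) /=.
    rewrite (_ : row' j0 (col' l Z) = \matrix_(j < n, l' < n) al j (lift l l')).
      by rewrite -/(mi l) exprD; ring.
    by apply/matrixP => j l'; rewrite !mxE.
  by rewrite sumrB -!mulr_sumr cl !mulr0 subr0.
rewrite cmp_bigsum.
  rewrite big1 // => l _; rewrite cmp_sign ?(cmp_pos hT) ?mulr0 //.
    exact: (subfieldM hL).
  by apply: (pos_L hT); apply: (subfieldM hL).
move=> l _; apply: (subfieldM hL); last by apply: (pos_L hT); apply: (subfieldM hL).
by apply: (subfieldX hL); apply: (subfieldN hL); apply: (subfield1 hL).
Qed.

Definition logmx n (T : 'I_n -> F -> F) (a : seq F) : 'M[F]_n :=
  \matrix_(j, l) (T l (nth 0 a j) / nth 0 a j).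

(** Rows are raised to the power [p] one at a time. By [lf_exact] each replacement adds a
    determinant with an exact row, invisible in weight zero; at the end the determinant is a [p]-th
    power, hence of pure weight zero. *)
Lemma cmp_log_det n (T : 'I_n -> F -> F) (hT : forall i, exists k, T i = th k) (a : seq F) :
  (forall j, (j < n)%N -> L (nth 0 a j)) -> (forall j, (j < n)%N -> nth 0 a j != 0) ->
  cmp (\det (logmx T a)) zwt = \det (logmx T a) ^+ p.
Proof.
move=> La a0.
pose X q : 'M[F]_n := \matrix_(j, l) (if (j < q)%N then logmx T a j l ^+ p else logmx T a j l).
have Llog j l : L (logmx T a j l).
  by rewrite mxE; apply: (subfieldM hL); [apply: (pos_L hT)|apply: (subfieldV hL)]; apply: La.
have LX q j l : L (X q j l) by rewrite mxE; case: ifP => // _; apply: (subfieldX hL).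
have step q : (q < n)%N -> cmp (\det (X q.+1)) zwt = cmp (\det (X q)) zwt.
  move=> qn; pose j0 := Ordinal qn.
  have [e Le he] := lf_exact (La q qn) (a0 q qn).
  pose Z : 'M[F]_n := \matrix_(j, l) (if j == j0 then T l e else X q j l).
  have LZ j l : L (Z j l) by rewrite mxE; case: ifP => // _; apply: (pos_L hT).
  have nj j : ((lift j0 j : nat) == q) = false.
    by apply/negbTE; rewrite eq_sym; exact: (neq_lift j0 j).
  have Z0 : cmp (\det Z) zwt = 0.
    apply: (cmp_exact_det (j0 := j0) (Z := Z) hT Le _ LZ) => [l|j i l jj0]; first by rewrite mxE eqxx.
    rewrite !mxE (negbTE jj0); case: ifP => _.
      by rewrite !(derXp hp (pos_der hT _)).
    case: (hT i) => k ->; case: (hT l) => k' ->.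
    by apply: lf_closed; [apply: La|apply: a0].
  rewrite (@determinant_multilinear _ _ _ (X q) Z j0 1 1).
  - by rewrite !mul1r (cmpD _ (L_det (LX q)) (L_det LZ)) Z0 addr0.
  - apply/rowP => l; rewrite !mxE /= ltnS leqnn ltnn eqxx !mul1r.
    by case: (hT l) => k ->; rewrite he addrCA subrr addr0.
  - by apply/matrixP => j l; rewrite !mxE ltnS [(lift j0 j <= q)%N]leq_eqVlt nj.
  - apply/matrixP => j l; rewrite !mxE eq_sym (negbTE (neq_lift _ _)) ltnS.
    by rewrite [(lift j0 j <= q)%N]leq_eqVlt nj.
have all q : (q <= n)%N -> cmp (\det (X q)) zwt = cmp (\det (X 0%N)) zwt.
  by elim: q => // q IH qn; rewrite step // IH // ltnW.
have X0 : X 0%N = logmx T a by apply/matrixP => j l; rewrite !mxE.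
have Xn : \det (X n) = \det (logmx T a) ^+ p.
  rewrite -(pFrobenius_autE hp) -det_map_mx; congr (\det _); apply/matrixP => j l.
  by rewrite !mxE ltn_ord.
by rewrite -X0 -(all n) // Xn cmp_pow eqxx mul1r X0.
Qed.

(** * Splitting a coefficient into logarithmic derivatives *)

Section Splitting.
Hypothesis hroot : forall y : F, exists z, z ^+ p.-1 = y.

(** This is the field [F^p(c_0, ..., c_s)], cut out by derivations so that membership can be tested
    on weights. *)
Definition upto (s : 'I_N) x := L x /\ forall k : 'I_N, (s < k)%N -> th k x = 0.

Lemma upto_subfield s : is_subfield (upto s).
Proof.
split.
- by split=> [|k _]; [apply: (subfield0 hL)|apply: (der0 (th_der k))].
- by split=> [|k _]; [apply: (subfield1 hL)|apply: (der1 (th_der k))].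
- move=> x y [Lx hx] [Ly hy]; split=> [|k sk]; first exact: (subfieldB hL).
  by rewrite (derB (th_der k)) hx // hy // subrr.
- move=> x y [Lx hx] [Ly hy]; split=> [|k sk]; first exact: (subfieldM hL).
  by rewrite (derM (th_der k)) hx // hy // !mulr0 addr0.
- move=> x [Lx hx]; split=> [|k sk]; first exact: (subfieldV hL).
  exact: (subfieldV (der_kernel (th_der k)) (hx k sk)).
Qed.

Lemma upto_th s x : upto s x -> upto s (th s x).
Proof.
move=> [Lx hx]; split=> [|k sk]; first exact: L_th.
by rewrite th_comm // hx // (der0 (th_der s)).
Qed.

Lemma const_part s x : L x ->
  \sum_(i : Wt | (i s : nat) == 0%N) cmp x i = x - iter p.-1 (th s) x.
Proof.
move=> Lx; have Ln n : L (iter n (th s) x) by elim: n => //= n; apply: L_th.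
have cn n i : cmp (iter n (th s) x) i = (i s)%:R ^+ n * cmp x i.
  by elim: n => [|n IH]; rewrite ?expr0 ?mul1r //= cmp_th // IH exprS mulrA.
rewrite {2}(cmp_sum Lx) (cmp_sum (Ln p.-1)) -sumrB big_mkcond; apply: eq_bigr => i _.
rewrite cn; case: eqP => [->|/eqP is0] /=.
  by rewrite expr0n -subn1 subn_eq0 leqNgt p1 mul0r subr0.
suff -> : (i s)%:R ^+ p.-1 = 1 :> F by rewrite mul1r subrr.
by apply: (mulfI (wt_neq0 is0)); rewrite -exprS prednK // (frob_nat hp) mulr1.
Qed.

(** The hypothesis completes [jac_cmp] to [jac u = u], which is what [log_derivative_solution] asks
    for; [c s] is the element of eigenvalue 1 used there. *)
Lemma log_primitive s u : upto s u -> \sum_(i : Wt | (i s : nat) == 0%N) cmp u i = u ^+ p ->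
  exists y, [/\ upto s y, y != 0 & th s y / y = u].
Proof.
move=> su hu; have [Lu _] := su.
have cs : upto s (c s).
  split=> [|k sk]; first exact: powgen_gen.
  by rewrite th_gen -val_eqE /= (gtn_eqF sk) mul0r.
have [||y [sy y0 ey]] := log_derivative_solution hp (th_der s) (upto_subfield s) (@upto_th s) su cs (gen_neq0 s).
- by rewrite th_gen eqxx mul1r.
- by rewrite jac_cmp // -hu {3}(cmp_sum Lu) [RHS](bigID (fun i : Wt => (i s : nat) == 0%N)).
by exists y; split=> //; rewrite ey mulfK.
Qed.

Definition top (i : Wt) (j : 'I_N) := (i j : nat) != 0%N /\ forall k : 'I_N, (j < k)%N -> i k = 0%N :> nat.

Definition splittable (S : seq 'I_N) a :=
  [/\ L a, cmp a zwt = a ^+ p & forall i, i != zwt -> cmp a i != 0 -> exists2 j, j \in S & top i j].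

Lemma splittable_upto S (s : 'I_N) a : splittable S a -> {in S, forall j : 'I_N, (j <= s)%N} -> upto s a.
Proof.
move=> [La _ ha] hS; split=> // k sk; apply/(th0P k La) => i ik.
apply/eqP; apply: contraTT isT => ci.
have iz : i != zwt by apply: contra ik => /eqP ->; rewrite zwtE.
have [j /hS js [_ /(_ k (leq_ltn_trans js sk)) ik0]] := ha i iz ci.
by rewrite ik0 in ik.
Qed.

(* Kato's splitting: with [a'] the part of [a] of weight 0 in the last variable [c_s],
   a [(p-1)]-st root [v] of [a^p / a'] satisfies the hypotheses for the remaining variables,
   while [a / v] is the logarithmic derivative in [c_s] of some [y]. *)
Lemma log_split S a : sorted (fun i j : 'I_N => (i < j)%N) S -> S != [::] -> a != 0 ->
  splittable S a -> exists l : seq ('I_N * F),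
    [/\ map fst l = S, {in l, forall t, upto t.1 t.2 /\ t.2 != 0} &
        a = \prod_(t <- l) (th t.1 t.2 / t.2)].
Proof.
elim/last_ind: S a => [//|S s IH] a srt _ a0 sa; have [La ca ha] := sa.
have ltS : {in S, forall j : 'I_N, (j < s)%N}.
  move=> j jS; move: srt; rewrite -cats1 sorted_pairwise; last by move=> x y z; apply: ltn_trans.
  by rewrite pairwise_cat => /andP[/allrelP/(_ j s jS) + _]; apply; rewrite inE.
have srtS : sorted (fun i j : 'I_N => (i < j)%N) S.
  by move: srt; rewrite -cats1 => /cat_sorted2 [].
have leS : {in rcons S s, forall j : 'I_N, (j <= s)%N}.
  by move=> j; rewrite mem_rcons inE => /orP[/eqP ->|/ltS/ltnW].
have ua : upto s a := splittable_upto sa leS.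
pose a' := \sum_(i : Wt | (i s : nat) == 0%N) cmp a i.
(* With the single index [s], a nonzero weight has top index [s]; so the part of weight 0 in [s] is
   the part of weight zero, namely [a ^+ p]. *)
case: (eqVneq S [::]) => [S0|Sn0].
  have [|y [uy y0 ey]] := @log_primitive s a ua.
    rewrite -ca (bigD1 zwt) ?zwtE //= big1 ?addr0 // => i /andP[is0 iz].
    apply/eqP; apply: contraTT is0 => ci; have [j] := ha i iz ci.
    by rewrite S0 inE => /eqP -> [].
  exists [:: (s, y)]; split; rewrite ?S0 ?big_seq1 //.
  by move=> t; rewrite inE => /eqP ->.
have La' : L a' by apply: (subfield_sum hL) => i _; apply: L_cmp.
have ca' i : cmp a' i = if (i s : nat) == 0%N then cmp a i else 0.
  apply: (@cmp_uniq a' (fun i : Wt => if (i s : nat) == 0%N then cmp a i else 0)) => //.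
    by move=> k j; case: ifP => _; [apply: th_cmp|rewrite mulr0 (der0 (th_der k))].
  by rewrite -big_mkcond.
have a'0 : a' != 0.
  apply/eqP => a'0; have := ca' zwt; rewrite a'0 cmp0 zwtE eqxx ca => /esym/eqP.
  by rewrite expf_eq0 (negbTE a0) andbF.
have [v hv] := hroot (a ^+ p / a').
have v0 : v != 0.
  have : v ^+ p.-1 != 0 by rewrite hv mulf_neq0 ?invr_eq0 // expf_neq0.
  by apply: contraNneq => ->; rewrite expr0n -subn1 subn_eq0 leqNgt p1.
(* In this form [v] is a [p]-th power times [a'], so its components are those of [a'] rescaled. It
   also says [a' / v = (a / v)^p], the hypothesis of [log_primitive] for [u = a / v]. *)
have vE : (v / a) ^+ p * a' = v.
  rewrite exprMn exprVn -{1}(prednK p0) exprS hv; field.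
  by rewrite a'0 expf_neq0.
have Lv : L v by rewrite -vE; apply: (subfieldM hL) => //; apply: powgen_pow.
have cv i : cmp v i = (v / a) ^+ p * cmp a' i by rewrite -{1}vE cmp_scale.
have sv : splittable S v.
  split=> //; first by rewrite cv ca' zwtE eqxx ca -exprMn divfK.
  move=> i iz; rewrite cv ca' mulf_eq0 negb_or => /andP[_].
  case: (eqVneq (i s : nat) 0%N) => [is0 ci|]; last by rewrite eqxx.
  have [j] := ha i iz ci; rewrite mem_rcons inE => /orP[/eqP -> []|jS tj]; last by exists j.
  by rewrite is0.
have [l [lS hl vl]] := IH v srtS Sn0 v0 sv.
have uv : upto s v by apply: (splittable_upto sv) => j /ltS/ltnW.
have thv : th s v = 0.
  apply/(th0P s Lv) => i is0; rewrite cv ca' (negbTE is0) mulr0 //.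
pose u := v^-1 * a.
have uu : upto s u.
  by apply: (subfieldM (upto_subfield s)) => //; apply: (subfieldV (upto_subfield s)).
have [|y [uy y0 ey]] := @log_primitive s u uu.
  have thV : th s v^-1 = 0 by apply: (subfieldV (der_kernel (th_der s))).
  have itM n : iter n (th s) (v^-1 * a) = v^-1 * iter n (th s) a.
    by elim: n => //= n ->; rewrite (derM (th_der s)) thV mulr0 addr0.
  rewrite const_part; last by case: uu.
  rewrite /u itM -mulrBr -const_part // -/a'.
  by rewrite -{1}vE invfM -mulrA mulVf // mulr1 -exprVn invf_div mulrC.
exists (rcons l (s, y)); split.
- by rewrite map_rcons lS.
- by move=> t; rewrite mem_rcons inE => /orP[/eqP -> //|/hl].
- by rewrite big_rcons /= ey -vl /u; field.
Qed.

End Splitting.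

Definition tl (J : {set 'I_N}) n : 'I_n -> F -> F :=
  fun i => nth (fun=> 0) [seq th k | k <- enum J] i.

Lemma tl_nth (J : {set 'I_N}) n (i : 'I_n) k0 : #|J| = n -> @tl J n i = th (nth k0 (enum J) i).
Proof. by move=> hJ; rewrite /tl (nth_map k0) // -cardE hJ. Qed.

Lemma tl_th (J : {set 'I_N}) n : #|J| = n -> forall i, exists k, @tl J n i = th k.
Proof.
move=> hJ i; have [k0 _] : exists k0, k0 \in J.
  by apply/card_gt0P; rewrite hJ (leq_ltn_trans _ (ltn_ord i)).
by exists (nth k0 (enum J) i); apply: tl_nth.
Qed.

Lemma nth_enumD1 (K : {set 'I_N}) (k k0 : 'I_N) l : k \in K ->
  nth k0 (enum (K :\ k)) l = nth k0 (enum K) (bump (index k (enum K)) l).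
Proof.
move=> kK; have -> : enum (K :\ k) = rem k (enum K).
  rewrite rem_filter ?enum_uniq // /enum_mem -filter_predI; apply: eq_filter => x /=.
  by rewrite !inE.
have ik : (index k (enum K) < size (enum K))%N by rewrite index_mem mem_enum.
rewrite remE nth_cat size_takel ?(ltnW ik) // /bump; case: ltnP => h.
  by rewrite add0n nth_take.
by rewrite nth_drop addSn subnKC // add1n.
Qed.

Lemma closed_on_sets n (K : {set 'I_N}) k0 (al : 'I_n -> 'I_N -> F) : #|K| = n.+1 ->
  (forall j k l, th k (al j l) = th l (al j k)) ->
  \sum_(k in K) (-1) ^+ index k (enum K) *
     th k (\det (\matrix_(j < n, l < n) al j (nth k0 (enum (K :\ k)) l))) = 0.
Proof.
move=> hK sym; have sK : size (enum K) = n.+1 by rewrite -cardE.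
rewrite -big_enum (big_nth k0) big_mkord sK.
have := @closed_det F n (fun i => th (nth k0 (enum K) i)) (fun j i => al j (nth k0 (enum K) i))
  (fun i => th_der _) (fun j i l => sym j _ _).
move=> h; rewrite -[RHS]h; apply: eq_bigr => i _.
rewrite index_uniq ?enum_uniq ?sK //; congr (_ * th _ (\det _)).
apply/matrixP => j l; rewrite !mxE nth_enumD1; last by rewrite -mem_enum mem_nth // sK.
by rewrite index_uniq ?enum_uniq ?sK.
Qed.

(** The coefficient of [dlog c_J] in the wedge product of the [dlog] of the entries of [ys]. *)
Definition lform n (ys : seq F) (J : {set 'I_N}) : F := \det (logmx (@tl J n) ys).

Lemma lformE n ys (J : {set 'I_N}) k0 : #|J| = n ->
  lform n ys J = \det (\matrix_(j < n, l < n) lf (nth 0 ys j) (nth k0 (enum J) l)).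
Proof.
move=> hJ; rewrite /lform; congr (\det _); apply/matrixP => j l.
by rewrite !mxE (tl_nth _ k0).
Qed.

Lemma lform_closed n ys (K : {set 'I_N}) : #|K| = n.+1 ->
  (forall j, (j < n)%N -> L (nth 0 ys j) /\ nth 0 ys j != 0) ->
  \sum_(k in K) (-1) ^+ index k (enum K) * th k (lform n ys (K :\ k)) = 0.
Proof.
move=> hK hys; have [k0 _] : exists k0, k0 \in K by apply/card_gt0P; rewrite hK.
rewrite -[RHS](@closed_on_sets n K k0 (fun j => lf (nth 0 ys j)) hK).
  apply: eq_bigr => k kK; rewrite (lformE _ k0) //.
  by apply/eqP; rewrite -eqSS -hK (cardsD1 k K) kK.
by move=> j k l; have [Ly y0] := hys j (ltn_ord j); apply: lf_closed.
Qed.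

Definition wsum (J : {set 'I_N}) : nat := (\sum_(k in J) (k : nat))%N.

Lemma wsum_nth (J : {set 'I_N}) n k0 : #|J| = n -> wsum J = (\sum_(i < n) (nth k0 (enum J) i : nat))%N.
Proof. by move=> hJ; rewrite /wsum -big_enum (big_nth k0) big_mkord -cardE hJ. Qed.

Section Triangular.
Variables (n : nat) (S : {set 'I_N}) (l : seq ('I_N * F)).
Hypotheses (cS : #|S| = n) (lS : map fst l = enum S).
Hypothesis ul : {in l, forall t, upto t.1 t.2 /\ t.2 != 0}.

Let sl : size l = n. Proof. by rewrite -(size_map fst) lS -cardE. Qed.

Lemma tri_zero k0 (j : 'I_n) (k : 'I_N) : (nth k0 (enum S) j < k)%N -> th k (nth 0 (map snd l) j) = 0.
Proof.
move=> jk; have js : (j < size l)%N by rewrite sl.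
have [[_ h] _] := ul (mem_nth (k0, 0) js).
by rewrite (nth_map (k0, 0)) // h // -(nth_map _ k0) // lS.
Qed.

(** Entry [j] is killed by [th k] for every [k] beyond the [j]-th index of [S], so a nonzero term of
    the determinant matches each index of [J] with an index of [S] at least as large. Summing gives
    [wsum J <= wsum S], and equality forces the indices to coincide. *)
Lemma lform_lower (J : {set 'I_N}) : #|J| = n -> (wsum S <= wsum J)%N -> J != S ->
  lform n (map snd l) J = 0.
Proof.
move=> cJ le neJ.
have [k0 _] : exists k0, k0 \in J.
  apply/card_gt0P; rewrite cJ lt0n; apply: contra neJ => /eqP n0.
  by move: cJ cS; rewrite n0 => /cards0_eq -> /cards0_eq ->.
rewrite (lformE _ k0) // /determinant big1 // => s _; apply/eqP; rewrite mulf_eq0; apply/orP; right.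
apply: contraNT neJ => /prodf_neq0 nz.
have sle (j : 'I_n) : (nth k0 (enum J) (s j) <= nth k0 (enum S) j)%N.
  rewrite leqNgt; apply/negP => /(@tri_zero k0) h; have := nz j isT.
  by rewrite mxE /lf h mul0r eqxx.
have sums : (\sum_(j < n) nth k0 (enum J) (s j) = \sum_(j < n) nth k0 (enum S) j)%N.
  apply/eqP; rewrite eqn_leq leq_sum //= -(wsum_nth k0 cS) (leq_trans le) //.
  by rewrite (wsum_nth k0 cJ) (reindex_perm s).
have eqs (j : 'I_n) : nth k0 (enum J) (s j) = nth k0 (enum S) j.
  have [_] := leqif_sum (fun (j : 'I_n) (_ : true) => leqif_eq (sle j)).
  by rewrite sums eqxx => /esym/forallP/(_ j)/eqP/val_inj.
rewrite eqEcard cJ cS leqnn andbT; apply/fintype.subsetP => k kJ.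
have kn : (index k (enum J) < n)%N by rewrite -cJ cardE index_mem mem_enum.
pose j := (s^-1)%g (Ordinal kn).
have := eqs j; rewrite permKV /= nth_index ?mem_enum // => ->.
by rewrite -mem_enum mem_nth // -cardE cS.
Qed.

Lemma lform_lead : lform n (map snd l) S = \prod_(t <- l) (th t.1 t.2 / t.2).
Proof.
case: (posnP n) => [n0|n_gt0].
  have -> : l = [::] by apply/size0nil; rewrite sl.
  by rewrite big_nil /lform; move: (n) n0 => ? ->; rewrite det_mx00.
have [k0 _] : exists k0, k0 \in S by apply/card_gt0P; rewrite cS.
rewrite (lformE _ k0) // det_trig; last first.
  apply/is_trig_mxP => j i ji; rewrite mxE /lf (@tri_zero k0) ?mul0r //.
  apply: (sorted_ltn_nth _ k0 (enum_set_sorted S)); rewrite ?inE -?cardE ?cS //.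
  by move=> x y z; apply: ltn_trans.
rewrite (big_nth (k0, 0)) big_mkord sl; apply: eq_bigr => j _.
rewrite mxE /lf -lS !(nth_map (k0, 0)) ?sl //.
Qed.

End Triangular.

Section Decomposition.
Hypothesis hroot : forall y : F, exists z, z ^+ p.-1 = y.
Variables (n r : nat).

(** What membership in [nu_n] and divisibility by the [db_i] leave on the coordinates along the
    [dlog c_J]; these conditions survive the subtraction of the logarithmic forms produced in the
    descent. *)
Definition log_like (om : {set 'I_N} -> F) : Prop :=
  [/\ forall J : {set 'I_N}, #|J| = n -> L (om J) /\ cmp (om J) zwt = om J ^+ p,
      forall K : {set 'I_N}, #|K| = n.+1 -> \sum_(k in K) (-1) ^+ index k (enum K) * th k (om (K :\ k)) = 0 &
      forall J : {set 'I_N}, #|J| = n -> om J != 0 -> exists2 k, k \in J & (k < r)%N].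

Definition good_list (ys : seq F) : Prop :=
  [/\ size ys = n, forall j, (j < n)%N -> L (nth 0 ys j) /\ nth 0 ys j != 0, (0 < n)%N &
      exists2 s : 'I_N, (s < r)%N & upto s (nth 0 ys 0)].

Lemma lform_log_like ys : good_list ys -> log_like (lform n ys).
Proof.
move=> [sz hys n0 [s sr us]]; split.
- move=> J cJ; have hT := tl_th cJ; split; last first.
    by apply: (cmp_log_det hT) => j /hys [].
  apply: L_det => i j; have [Ly _] := hys i (ltn_ord i); rewrite mxE.
  by apply: (subfieldM hL); [apply: (pos_L hT)|apply: (subfieldV hL)].
- by move=> K cK; apply: lform_closed.
- move=> J cJ nz; apply: contrapT => nex; case/negP: nz; apply/eqP.
  have [k0 _] : exists k0, k0 \in J by apply/card_gt0P; rewrite cJ.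
  (* The head entry is killed by [th k] for all [k >= r], so row 0 vanishes when [J] avoids the
     first [r] indices. *)
  rewrite (lformE _ k0) // (expand_det_row _ (Ordinal n0)) big1 // => l _.
  rewrite mxE /lf /=; case: us => _ ->; first by rewrite !mul0r.
  apply: (leq_trans sr); rewrite leqNgt; apply/negP => kr; apply: nex.
  exists (nth k0 (enum J) l) => //.
  by rewrite -mem_enum mem_nth // -cardE cJ.
Qed.

Lemma log_like_sub om (Y : seq (seq F)) : log_like om -> (forall ys, ys \in Y -> good_list ys) ->
  log_like (fun J => om J - \sum_(ys <- Y) lform n ys J).
Proof.
elim: Y om => [|ys Y IH] om hom hY.
  suff -> : (fun J => om J - \sum_(ys <- [::]) lform n ys J) = om by [].
  by apply: funext => J; rewrite big_nil subr0.
have -> : (fun J => om J - \sum_(ys <- ys :: Y) lform n ys J) =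
    (fun J => (om J - lform n ys J) - \sum_(ys <- Y) lform n ys J).
  by apply: funext => J; rewrite big_cons opprD addrA.
apply: IH; last by move=> zs hz; apply: hY; rewrite inE hz orbT.
have [h1 h2 h3] := hom; have [h1' h2' h3'] := lform_log_like (hY ys (mem_head _ _)).
split.
- move=> J cJ; have [LJ eJ] := h1 J cJ; have [LJ' eJ'] := h1' J cJ; split.
    exact: (subfieldB hL).
  rewrite cmpD ?cmpN ?eJ ?eJ' //; last exact: (subfieldN hL).
  by rewrite -(expn1 p) -(frobB hp).
- move=> K cK; have := h2 K cK; have := h2' K cK => e1 e2.
  under eq_bigr => k _ do rewrite (derB (th_der k)) mulrBr.
  by rewrite sumrB e1 e2 subrr.
- move=> J cJ; case: (eqVneq (om J) 0) => [->|nz _]; last exact: h3.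
  by rewrite sub0r oppr_eq0; apply: h3'.
Qed.

(* By closedness, a weight [i <> 0] of the coefficient of maximal [wsum] has its top index in [S]. *)
Lemma log_like_splittable om (S : {set 'I_N}) : log_like om -> #|S| = n ->
  (forall J : {set 'I_N}, #|J| = n -> (wsum S < wsum J)%N -> om J = 0) -> splittable (enum S) (om S).
Proof.
move=> [h1 h2 _] cS hmax; have [LS eS] := h1 S cS; split=> // i iz ci.
have [j ij tj] : exists2 j : 'I_N, (i j : nat) != 0%N & forall k : 'I_N, (j < k)%N -> i k = 0%N :> nat.
  have [k ik] := zwtP iz.
  case: (@arg_maxnP _ k (fun j : 'I_N => (i j : nat) != 0%N) (fun j => j : nat) ik) => j ij jmax.
  exists j => // k' jk; apply/eqP; apply: contraTT jk => ik'.
  by rewrite -leqNgt; apply: jmax.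
case: (boolP (j \in S)) => jS; first by exists j; rewrite ?mem_enum.
pose K := j |: S.
have cK : #|K| = n.+1 by rewrite cardsU1 jS cS.
have jK : j \in K by rewrite setU11.
have cKk k : k \in K -> #|K :\ k| = n.
  by move=> kK; apply/eqP; rewrite -eqSS -cK (cardsD1 k K) kK.
have KjS : K :\ j = S by rewrite setU1K.
have LK k : k \in K -> L ((-1) ^+ index k (enum K) * th k (om (K :\ k))).
  move=> /cKk /h1 [Lk _]; apply: (subfieldM hL); last exact: L_th.
  by apply: (subfieldX hL); apply: (subfieldN hL); apply: (subfield1 hL).
(* In weight [i] only the term of [j] survives: for [k > j] the factor [i k] is 0, and for [k < j]
   the set [K :\ k] has a larger [wsum] than [S]. *)
have := congr1 (fun x => cmp x i) (h2 K cK); rewrite /= cmp0 cmp_bigsum //.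
rewrite (bigD1 j) //= [X in _ + X]big1 ?addr0.
  rewrite KjS cmp_sign ?cmp_th //; last exact: L_th.
  move=> /eqP; rewrite !mulf_eq0 signr_eq0 (negbTE (wt_neq0 ij)) /=.
  by rewrite (negbTE ci).
move=> k /andP[kK kj]; have [Lk _] := h1 _ (cKk k kK).
rewrite cmp_sign ?cmp_th //; last exact: L_th.
case: (ltngtP j k) => [jk|kltj|/val_inj ejk]; last by rewrite ejk eqxx in kj.
  by rewrite tj // mul0r mulr0.
rewrite hmax ?cmp0 ?mulr0 ?cKk //.
have : (wsum K = wsum S + j)%N by rewrite /wsum (big_setD1 j) //= KjS addnC.
have : (wsum K = k + wsum (K :\ k))%N by rewrite /wsum (big_setD1 k).
by move=> -> /eqP; rewrite addnC => /eqP e; rewrite -(ltn_add2r k) e ltn_add2l.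
Qed.

(** Descent on a strict bound [M] for the [wsum] of nonzero coefficients. All sets at the top level
    are treated at once, since by [lform_lower] the form built for [S] has no coefficient on another
    set of the same or larger [wsum]. *)
Lemma log_like_decomposition om : log_like om -> exists Y : seq (seq F),
  (forall ys, ys \in Y -> good_list ys) /\
  forall J : {set 'I_N}, #|J| = n -> om J = \sum_(ys <- Y) lform n ys J.
Proof.
suff main M om' : log_like om' -> (forall J : {set 'I_N}, #|J| = n -> (M <= wsum J)%N -> om' J = 0) ->
    exists Y : seq (seq F), (forall ys, ys \in Y -> good_list ys) /\
      forall J : {set 'I_N}, #|J| = n -> om' J = \sum_(ys <- Y) lform n ys J.
  move=> hom; apply: (main (\max_(J : {set 'I_N}) wsum J).+1 om hom) => J _.
  by rewrite ltnNge leq_bigmax.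
elim: M om' => [|M IH] om' hom hz.
  by exists [::]; split=> // J cJ; rewrite big_nil hz.
pose P (S : {set 'I_N}) := [&& #|S| == n, wsum S == M & om' S != 0].
have /choice [Z hZ] : forall S, exists ys, P S -> [/\ good_list ys, lform n ys S = om' S &
    forall J : {set 'I_N}, #|J| = n -> (wsum S <= wsum J)%N -> J != S -> lform n ys J = 0].
  move=> S; case: (boolP (P S)) => [/and3P[/eqP cS /eqP wS nz]|_]; last by exists [::].
  have [k kS kr] : exists2 k, k \in S & (k < r)%N by case: hom => _ _; apply.
  have eS0 : enum S != [::] by apply: contraL kS => /eqP e; rewrite -mem_enum e.
  have spl : splittable (enum S) (om' S).
    by apply: log_like_splittable => // J cJ; rewrite wS; apply: hz.
  have [l [lS ul eql]] := log_split hroot (enum_set_sorted S) eS0 nz spl.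
  have sl : size l = n by rewrite -(size_map fst) lS -cardE.
  exists (map snd l) => _; split.
  - have n0 : (0 < n)%N by rewrite -cS; apply/card_gt0P; exists k.
    split=> //; first by rewrite size_map.
      move=> j jn; have jl : (j < size l)%N by rewrite sl.
      have [[Ly _] y0] := ul _ (mem_nth (k, 0) jl).
      by rewrite (nth_map (k, 0)).
    case: l lS ul {eql} sl => [|[s y] l] /= lS ul sl; first by rewrite -sl in n0.
    exists s; last by case: (ul _ (mem_head _ _)).
    exact: leq_ltn_trans (enum_set_head (esym lS) kS) kr.
  - by rewrite lform_lead.
  - by move=> J cJ; apply: lform_lower.
pose Y0 := [seq Z J | J <- enum P].
have gY0 ys : ys \in Y0 -> good_list ys.
  by move=> /mapP [S]; rewrite mem_enum => /hZ [? _ _] ->.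
have hom' := log_like_sub hom gY0.
have [|Y [gY eY]] := IH _ hom'.
  move=> J cJ MJ; rewrite big_map big_enum /=.
  case: (boolP (P J)) => PJ.
    rewrite (bigD1 J) //= [X in om' J - (_ + X)]big1; last first.
      move=> S /andP[PS SJ]; have [_ _] := hZ S PS; apply=> //; last by rewrite eq_sym.
      by case/and3P: PS => _ /eqP -> _.
    by have [_ -> _] := hZ J PJ; rewrite addr0 subrr.
  rewrite big1 ?subr0; last first.
    move=> S PS; have [_ _] := hZ S PS; apply=> //.
      by case/and3P: PS => _ /eqP -> _.
    by apply: contraNneq PJ => ->.
  move: MJ; rewrite leq_eqVlt => /orP[/eqP MJ|]; last exact: hz.
  by apply/eqP; apply: contraNT PJ => nz; rewrite /P cJ -MJ !eqxx.
exists (Y0 ++ Y); split.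
  by move=> ys; rewrite mem_cat => /orP[/gY0|/gY].
by move=> J cJ; rewrite big_cat /= -eY // addrC subrK.
Qed.

End Decomposition.


Lemma dm_tl n (J : {set 'I_N}) : #|J| = n -> exists2 z, z != 0 &
  forall a, dm (@tl J n) a = z * dm (@dlist _ _ D J n) a.
Proof.
move=> cJ; pose d : 'rV[F]_n := \row_i nth 1 (map c (enum J)) i.
exists (\prod_i d 0 i).
  apply/prodf_neq0 => i _; rewrite mxE.
  have [k0 _] : exists k0, k0 \in J.
    by apply/card_gt0P; rewrite cJ (leq_ltn_trans _ (ltn_ord i)).
  by rewrite (nth_map k0) ?gen_neq0 // -cardE cJ.
move=> a'; rewrite mulrC -det_diag -det_mulmx; congr (\det _).
apply/matrixP => j i; rewrite mul_mx_diag !mxE.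
have [k0 _] : exists k0, k0 \in J.
  by apply/card_gt0P; rewrite cJ (leq_ltn_trans _ (ltn_ord i)).
by rewrite (tl_nth _ k0) // (dlist_nth _ _ k0) // (nth_map k0) -?cardE ?cJ // mulrC.
Qed.

Lemma dm_lform n (ys : seq F) (J : {set 'I_N}) : size ys = n ->
  (\prod_(x <- ys) x^-1) * dm (@tl J n) ys = lform n ys J.
Proof.
move=> sz; pose d : 'rV[F]_n := \row_j (nth 0 ys j)^-1.
have -> : \prod_(x <- ys) x^-1 = \prod_j d 0 j.
  by rewrite (big_nth 0) big_mkord sz; apply: eq_bigr => j _; rewrite mxE.
rewrite -det_diag -det_mulmx; congr (\det _).
by apply/matrixP => j i; rewrite mul_diag_mx !mxE mulrC.
Qed.

Lemma ev_fdlog n (reps : seq (F * seq F)) (g : F -> F) (J : {set 'I_N}) :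
  (forall t, t \in reps -> size t.2 = n) ->
  ev idfun (dm (@tl J n)) [seq fdlog (g t.1) t.2 | t <- reps] = \sum_(t <- reps) g t.1 * lform n t.2 J.
Proof.
move=> sz; rewrite /ev big_map !big_seq; apply: eq_bigr => t /sz st.
by rewrite /= -mulrA dm_lform.
Qed.

(** * Coordinates of an element of nu_n *)

Section NuCoordinates.
Variables (n : nat) (reps : seq (F * seq F)) (eta : fsum F).
Hypothesis hreps : forall t, t \in reps ->
  [/\ size t.2 = n, L t.1 & forall x, x \in t.2 -> L x /\ x != 0].
Hypothesis heta : forall t, t \in eta -> [/\ n = (size t.2).+1, L t.1 & forall x, x \in t.2 -> L x].
Hypothesis hwp : feq n [seq fdlog (t.1 ^+ p - t.1) t.2 | t <- reps] (fdiff eta).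

Definition nu_coord (J : {set 'I_N}) : F := \sum_(t <- reps) t.1 * lform n t.2 J.

Let entries t : t \in reps -> forall j, (j < n)%N -> L (nth 0 t.2 j) /\ nth 0 t.2 j != 0.
Proof. by move=> /hreps [st _ ht] j jn; apply: ht; apply: mem_nth; rewrite st. Qed.

Lemma wp_coord (J : {set 'I_N}) : #|J| = n ->
  \sum_(t <- reps) (t.1 ^+ p - t.1) * lform n t.2 J = \sum_(t <- eta) dm (@tl J n) (t.1 :: t.2).
Proof.
move=> cJ; have hT := tl_th cJ.
rewrite -(ev_fdlog (fun x => x ^+ p - x)); last by move=> t /hreps [].
rewrite (ev_feq (altder_dm (f := idfun) (pos_der hT)) hwp) /ev big_map.
by apply: eq_bigr => t _; rewrite mul1r.
Qed.

Lemma L_lform t (J : {set 'I_N}) : t \in reps -> #|J| = n -> L (lform n t.2 J).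
Proof.
move=> tr cJ; apply: L_det => i j; have [Lx _] := entries tr (ltn_ord i); rewrite mxE.
by apply: (subfieldM hL); [apply: (pos_L (tl_th cJ))|apply: (subfieldV hL)].
Qed.

Lemma L_eta t j : t \in eta -> (j < n)%N -> L (nth 0 (t.1 :: t.2) j).
Proof.
move=> te jn; have [st Lt ht] := heta te.
case: j jn => [|j] //= jn; apply: ht; apply: mem_nth.
by rewrite st ltnS in jn.
Qed.

(** Weight zero of the Artin-Schreier relation: the exact side contributes nothing by
    [cmp_exact_det], and by [cmp_log_det] the terms in [t.1 ^+ p] add up to [nu_coord J ^+ p]. *)
Lemma nu_coord_cmp (J : {set 'I_N}) : #|J| = n ->
  L (nu_coord J) /\ cmp (nu_coord J) zwt = nu_coord J ^+ p.
Proof.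
move=> cJ; have hT := tl_th cJ.
have Lt t : t \in reps -> L (t.1 * lform n t.2 J).
  by move=> tr; apply: (subfieldM hL); [case: (hreps tr)|apply: L_lform].
have Lpt t : t \in reps -> L (t.1 ^+ p * lform n t.2 J).
  by move=> tr; apply: (subfieldM hL); [apply: powgen_pow|apply: L_lform].
have Le t : t \in eta -> L (dm (@tl J n) (t.1 :: t.2)).
  by move=> te; apply: L_det => i j; rewrite mxE; apply: (pos_L hT); apply: L_eta.
have LN : L (nu_coord J) by rewrite /nu_coord big_seq; apply: (subfield_sum hL).
split=> //.
have e0 : cmp (\sum_(t <- eta) dm (@tl J n) (t.1 :: t.2)) zwt = 0.
  rewrite big_seq cmp_bigsum // big1 // => t te; have [st Lt1 ht] := heta te.
  have n0 : (0 < n)%N by rewrite st.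
  apply: (cmp_exact_det (j0 := Ordinal n0) (e := t.1) hT) => //.
  - by move=> l; rewrite mxE.
  - by move=> j l; rewrite mxE; apply: (pos_L hT); apply: L_eta.
  - by move=> j i l _; rewrite !mxE; apply: (pos_comm hT); apply: L_eta.
have := wp_coord cJ => /(congr1 (fun x => cmp x zwt)); rewrite /= e0.
under eq_bigr => t _ do rewrite mulrBl.
rewrite sumrB -/(nu_coord J) cmpD; last 2 first.
- by rewrite big_seq; apply: (subfield_sum hL).
- exact: (subfieldN hL).
rewrite cmpN // => /eqP; rewrite subr_eq0 => /eqP <-.
rewrite big_seq cmp_bigsum // /nu_coord -[X in _ ^+ X](expn1 p) (frob_sum hp) [RHS]big_seq.
apply: eq_bigr => t tr; rewrite cmp_scale; last exact: L_lform.
by rewrite (cmp_log_det (tl_th cJ)) ?expn1 ?exprMn // => j /(entries tr) [].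
Qed.

(** The relation writes the form as logarithmic forms with [p]-th power coefficients minus an exact
    form, and both parts are closed. *)
Lemma nu_coord_closed (K : {set 'I_N}) : #|K| = n.+1 ->
  \sum_(k in K) (-1) ^+ index k (enum K) * th k (nu_coord (K :\ k)) = 0.
Proof.
move=> cK; have [k0 _] : exists k0, k0 \in K by apply/card_gt0P; rewrite cK.
have cKk k : k \in K -> #|K :\ k| = n.
  by move=> kK; apply/eqP; rewrite -eqSS -cK (cardsD1 k K) kK.
have eqE k : k \in K -> nu_coord (K :\ k) =
    \sum_(t <- reps) t.1 ^+ p * lform n t.2 (K :\ k) - \sum_(t <- eta) dm (@tl (K :\ k) n) (t.1 :: t.2).
  move=> kK; rewrite -wp_coord ?cKk //; under [X in _ - X]eq_bigr => t _ do rewrite mulrBl.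
  by rewrite sumrB opprB addrC subrK.
under eq_bigr => k kK do rewrite eqE // (derB (th_der k)) mulrBr !(der_sum (th_der k)) !mulr_sumr.
rewrite sumrB [X in X - _](exchange_big_dep xpredT) //= [X in _ - X](exchange_big_dep xpredT) //=.
rewrite [X in X - _]big_seq [X in X - _]big1 ?sub0r; last first.
  move=> t tr; under eq_bigr => k _ do rewrite (derM (th_der k)) /= th_pow mulr0 addr0 mulrCA.
  rewrite -mulr_sumr; under eq_bigl => i do rewrite andbT.
  by rewrite lform_closed ?mulr0 //; apply: entries.
rewrite big_seq big1 ?oppr0 // => t te.
under eq_bigl => i do rewrite andbT.
rewrite -[RHS](@closed_on_sets n K k0 (fun j k => th k (nth 0 (t.1 :: t.2) j)) cK).
  apply: eq_bigr => k kK; congr (_ * th k (\det _)); apply/matrixP => j i.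
  by rewrite !mxE (tl_nth _ k0) // cKk.
by move=> j k l; apply: th_comm; apply: L_eta.
Qed.

End NuCoordinates.

End Weights.

(** * The groups nu_n *)

Section AlternatingDerivations.
Variables (F : fieldType) (n : nat) (h : seq F -> F).
Hypothesis hh : altder idfun n h.

Lemma alt_headN v a : (size v).+1 = n -> h (- a :: v) = - h (a :: v).
Proof.
move=> sv; have [hA _ _] := hh.
have h0 : h (0 :: v) = 0.
  by apply: (addrI (h (0 :: v))); rewrite -(hA [::] v 0 0) //= !addr0.
by apply/eqP; rewrite -addr_eq0 -(hA [::] v (- a) a) //= addNr h0.
Qed.

(** The wedge of [d(x/y)] with [dy] loses its second Leibniz term; at [y = 0] the convention
    [0^-1 = 0] makes both sides vanish. *)
Lemma alt_head_dlog v x y : (size v).+2 = n ->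
  h (x * y^-1 :: y :: v) = y^-1 * h (x :: y :: v).
Proof.
move=> sv; have [hA hM hX] := hh.
case: (eqVneq y 0) => [->|y0].
  rewrite invr0 mulr0 mul0r; have := hM [::] (0 :: v) 0 0 sv.
  by rewrite /= !mul0r addr0.
have hy : h (y :: y :: v) = 0 by apply: (hX _ 0%N 1%N); rewrite //= -sv.
have h1 : h (1 :: y :: v) = 0.
  have := hM [::] (y :: v) 1 1 sv; rewrite /= mulr1 !mul1r => e.
  by apply: (addrI (h (1 :: y :: v))); rewrite addr0 -e.
have hV : h (y^-1 :: y :: v) = 0.
  have := hM [::] (y :: v) y y^-1 sv; rewrite /= mulfV // h1 hy mulr0 addr0 => /eqP.
  by rewrite eq_sym mulf_eq0 (negbTE y0) /= => /eqP.
by have := hM [::] (y :: v) x y^-1 sv; rewrite /= hV mulr0 add0r.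
Qed.

Lemma alt_swap2 v x y : (size v).+2 = n -> h (x :: y :: v) = - h (y :: x :: v).
Proof.
move=> sv; have [hA _ hX] := hh.
have hd z : h (z :: z :: v) = 0 by apply: (hX _ 0%N 1%N); rewrite //= -sv.
have := hd (x + y); rewrite (hA [::]) //= (hA [:: x]) //= ?(hA [:: y]) //= ?add1n ?hd //.
by rewrite add0r addr0 => /eqP; rewrite addr_eq0 => /eqP.
Qed.

End AlternatingDerivations.

Section NuClosure.
Variables (p : nat) (F : fieldType) (hp : p \in [pchar F]).

Lemma feq_cat n (w1 w2 v1 v2 : fsum F) : feq n w1 v1 -> feq n w2 v2 -> feq n (w1 ++ w2) (v1 ++ v2).
Proof.
move=> h1 h2; apply: fzero_ext (fzero_cat h1 h2) => a.
by rewrite !(fcoef_cat, fcoef_scale); ring.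
Qed.

Lemma feq_scale n c (w v : fsum F) : feq n w v -> feq n (fscale c w) (fscale c v).
Proof.
move=> /(fzero_scale c); apply: fzero_ext => a.
by rewrite !(fcoef_cat, fcoef_scale); ring.
Qed.

Lemma omega_low_cat n (w v : fsum F) : omega_low n w -> omega_low n v -> omega_low n (w ++ v).
Proof. by case: n => [->|n] //= h1 h2; rewrite fdeg_cat h1. Qed.

Lemma nu_feq n (w v : fsum F) : fdeg n w -> feq n w v -> nu p n v -> nu p n w.
Proof.
move=> dw wv [_ [reps [hr [vr heta]]]]; split=> //; exists reps; split=> //; split=> //.
exact: feq_trans wv vr.
Qed.

Lemma nu_nil n : nu (F := F) p n [::].
Proof.
split=> //; exists [::]; split=> //; split; first exact: feq_refl.
by exists [::]; split; [case: n|apply: feq_refl].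
Qed.

Lemma nu_cat n (w v : fsum F) : nu p n w -> nu p n v -> nu p n (w ++ v).
Proof.
move=> [dw [r1 [h1 [e1 [eta1 [l1 f1]]]]]] [dv [r2 [h2 [e2 [eta2 [l2 f2]]]]]].
split; first by rewrite fdeg_cat dw.
exists (r1 ++ r2); rewrite all_cat h1 h2; split=> //; rewrite !map_cat; split; first exact: feq_cat.
exists (eta1 ++ eta2); split; first exact: omega_low_cat.
by rewrite /fdiff map_cat; apply: feq_cat.
Qed.

Lemma fdeg_fdlog n (s : seq (F * seq F)) (g : F -> F) :
  all (fun r => (size r.2 == n) && all (fun c => c != 0) r.2) s ->
  fdeg n [seq fdlog (g r.1) r.2 | r <- s].
Proof.
move=> /allP h; apply/allP => t /mapP [r /h /andP[sr _] ->]; exact: sr.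
Qed.

Lemma fdeg_fdiff n (eta : fsum F) : omega_low n eta -> fdeg n (fdiff eta).
Proof. by case: n => [->|n] //; apply: fdeg_diff. Qed.

Lemma nu_opp n (w : fsum F) : nu p n w -> nu p n (fscale (-1) w).
Proof.
move=> [dw [reps [hr [wr [eta [low heta]]]]]]; split; first by rewrite fdeg_scale.
pose reps' := [seq (- t.1, t.2) | t <- reps].
have hr' : all (fun r => (size r.2 == n) && all (fun c => c != 0) r.2) reps'.
  by rewrite all_map.
exists reps'; split=> //; split.
  suff -> : [seq fdlog r.1 r.2 | r <- reps'] = fscale (-1) [seq fdlog r.1 r.2 | r <- reps].
    exact: feq_scale.
  rewrite /fscale -!map_comp; apply: eq_map => t.
  by rewrite /= /fdlog /= mulN1r mulNr.
pose eta' := [seq (- t.1, t.2) | t <- eta].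
have low' : omega_low n eta'.
  by move: low; rewrite /eta'; case: n {dw hr wr heta hr'} => [->|n] //=; rewrite /fdeg all_map.
exists eta'; split=> //.
apply/(feqP hp); [exact: (fdeg_fdlog (fun x => x ^+ p - x))|exact: fdeg_fdiff|].
move=> D hD; have aD := altder_dm (f := idfun) hD.
transitivity (- ev idfun (dm D) [seq fdlog (r.1 ^+ p - r.1) r.2 | r <- reps]).
  rewrite /ev !big_map -sumrN; apply: eq_bigr => t _ /=.
  by rewrite -{1}(expn1 p) (frobN hp) expn1; ring.
rewrite (ev_feq aD heta) /ev !big_map -sumrN !big_seq; apply: eq_bigr => t /(omega_low_deg low) st.
by rewrite /= !mul1r (alt_headN aD).
Qed.

Lemma feq_wedge1l n c s (w v : fsum F) : fdeg n w -> fdeg n v -> feq n w v ->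
  feq (size s + n) (fwedge [:: (c, s)] w) (fwedge [:: (c, s)] v).
Proof.
move=> dw dv wv; have ds : fdeg (size s) [:: (c, s)] by rewrite /fdeg /= eqxx.
apply/(feqP hp); [exact: fdeg_wedge|exact: fdeg_wedge|].
move=> D hD; have aD := altder_dm (f := idfun) hD.
by rewrite !ev_wedge1l (ev_feq (altder_catl (erefl _) aD) wv).
Qed.

Lemma nu_wedge n y (w : fsum F) : y != 0 -> nu p n w -> nu p n.+1 (fwedge [:: fdlog 1 [:: y]] w).
Proof.
move=> y0 [dw [reps [hr [wr [eta [low heta]]]]]].
have dy : fdeg 1 [:: fdlog 1 [:: y]] by [].
split; first by rewrite -add1n; apply: fdeg_wedge.
pose reps' := [seq (t.1, y :: t.2) | t <- reps].
have hr' : all (fun r => (size r.2 == n.+1) && all (fun c => c != 0) r.2) reps'.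
  by rewrite all_map; apply: sub_all hr => t /= /andP[st ht]; rewrite eqSS st y0.
have wE g : fwedge [:: fdlog 1 [:: y]] [seq fdlog (g r.1) r.2 | r <- reps] =
    [seq fdlog (g r.1) r.2 | r <- reps'].
  rewrite /fwedge /= cats0 -!map_comp; apply: eq_map => t.
  by rewrite /= /fdlog /= !big_cons big_nil; congr (_, _); ring.
exists reps'; split=> //; split.
  rewrite -(wE id) -add1n; apply: (feq_wedge1l _ [:: y]) => //.
  exact: (fdeg_fdlog id).
(* The sign compensates for moving [dy] in front of [d(t.1)]; the differential is then [dlog y]
   wedged with that of [eta]. *)
pose eta' := [seq (- (t.1 * y^-1), y :: t.2) | t <- eta].
have low' : omega_low n.+1 eta'.
  move: low; rewrite /eta'; case: n {dw hr wr heta hr'} => [->|n] //=.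
  by rewrite /fdeg all_map.
exists eta'; split=> //.
apply/(feqP hp); [exact: (fdeg_fdlog (fun x => x ^+ p - x))|exact: fdeg_fdiff|].
move=> D hD; have aD := altder_dm (f := idfun) hD.
rewrite -(wE (fun x => x ^+ p - x)) ev_wedge1l.
rewrite (ev_feq (altder_catl (s := [:: y]) (erefl _) aD) heta) /ev !big_map mulr_sumr !big_seq.
apply: eq_bigr => t /(omega_low_deg low) st.
rewrite /= big_cons big_nil !mul1r mulr1 (alt_headN aD) /=; last by rewrite st.
rewrite (alt_head_dlog aD) ?st // (alt_swap2 aD y) ?st //.
by rewrite mem_head mulrN.
Qed.

Lemma dlog_wedge_is_nu n r (b : 'I_r -> F) w : dlog_wedge_nu p n b w -> nu p n w.
Proof.
move=> [dw [l [hl wl]]].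
apply: (nu_feq dw wl); move: hl; elim: l {w dw wl} => [|[[s y] w] l IH] hl; first exact: nu_nil.
rewrite /=; apply: nu_cat; last by apply: IH => e el; apply: hl; rewrite inE el orbT.
have [_ /= y0 hw] := hl _ (mem_head _ _).
have h : nu p n (fwedge [:: fdlog 1 [:: y]] w).
  case: n hw {IH hl} => [|n] /= hw; first by rewrite hw; apply: nu_nil.
  exact: nu_wedge.
case: s {hl}; first exact: nu_opp.
suff -> : fscale 1 (fwedge [:: fdlog 1 [:: y]] w) = fwedge [:: fdlog 1 [:: y]] w by [].
by rewrite /fscale -[RHS]map_id; apply: eq_map => t; rewrite mul1r; case: t.
Qed.

End NuClosure.

Section NuRelative.
Variables (p : nat) (F E : fieldType) (hp : p \in [pchar F]) (f : {rmorphism F -> E}).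
Variables (r : nat) (b : 'I_r -> F) (hind : pindep p b).
Variables (ms : 'I_r -> nat) (beta : 'I_r -> E).
Hypothesis hbeta : forall i, beta i ^+ (p ^ ms i)%N = f (b i).
Hypothesis hm0 : forall i, (0 < ms i)%N.

Lemma dlog_wedge_rel n w : dlog_wedge_nu p n b w -> OmegaRel f n w.
Proof.
move=> [dw [l [hl wl]]]; split=> //.
have hpE : p \in [pchar E] by rewrite (fmorph_pchar f).
apply/(fzeroP hpE (fdeg_fmap f dw)) => D hD; rewrite ev_fmap //.
have dD i : derivation f (D i \o f) by apply: der_comp.
rewrite (ev_feq (altder_dm dD) wl) ev_flatten big_map big_seq big1 // => [[[s y] v]] /hl [/= hy y0 hv].
have Dy i : D i (f y) = 0.
  apply: (der_powgen0 (dD i)) hy => [z|k] /=; first by rewrite rmorphXn (derXp hpE (hD i)).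
  by rewrite -hbeta (derXpn hpE (hD i)).
rewrite ev_scale ev_wedge1l [X in _ * (_ * X)](_ : _ = 0) ?mulr0 //.
apply: ev_eq0 => t tv; have n0 : (0 < n)%N.
  by case: n hv {dw D hD wl dD Dy hl} => // hv; rewrite hv in tv.
by apply: (dm_row0 n0) => i; apply: Dy.
Qed.

Hypothesis hroot : forall y : F, exists z, z ^+ p.-1 = y.

Lemma nu_rel_dlog n w : sum_db_wedge n b w -> nu p n w -> dlog_wedge_nu p n b w.
Proof.
move=> hsum [dw [reps [hr [wr [eta [low heta]]]]]]; split=> //.
(* The entries and coefficients of both [reps] and [eta] must lie in [L], since the relation between
   them is analysed by weights. *)
pose s := flatten [seq t.1 :: t.2 | t <- reps ++ eta].
have [N [c [D [rN hD hc hs]]]] := dual_exists hp s hind.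
have inL t x : t \in reps ++ eta -> x \in t.1 :: t.2 -> in_powgen p c x.
  by move=> ht hx; apply: hs; apply/flatten_mapP; exists t.
have [cmp cmpP] := cmp_exists hp c.
have hreps t : t \in reps -> [/\ size t.2 = n, in_powgen p c t.1 &
    forall x, x \in t.2 -> in_powgen p c x /\ x != 0].
  move=> tr; have tre : t \in reps ++ eta by rewrite mem_cat tr.
  move/allP: hr => /(_ t tr) /andP[/eqP st /allP nz]; split=> //.
    by apply: (inL t) => //; rewrite mem_head.
  move=> x xt; split; last exact: nz.
  by apply: (inL t) => //; rewrite inE xt orbT.
have heta' t : t \in eta -> [/\ n = (size t.2).+1, in_powgen p c t.1 &
    forall x, x \in t.2 -> in_powgen p c x].
  move=> te; have tre : t \in reps ++ eta by rewrite mem_cat te orbT.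
  split; [exact: (omega_low_deg low)|by apply: (inL t) => //; rewrite mem_head|].
  by move=> x xt; apply: (inL t) => //; rewrite inE xt orbT.
have dreps : fdeg n [seq fdlog t.1 t.2 | t <- reps] by apply: (fdeg_fdlog id).
pose om := nu_coord c D n reps.
have omE (J : {set 'I_N}) : #|J| = n -> om J = ev idfun (dm (@tl _ _ c D J n)) [seq fdlog t.1 t.2 | t <- reps].
  by move=> cJ; rewrite (ev_fdlog c D id) // => t /hreps [].
have hom : log_like hp c D cmp n r om.
  split.
  - by move=> J cJ; apply: (nu_coord_cmp hp hD cmpP hreps heta' heta cJ).
  - by move=> K cK; apply: (nu_coord_closed hp hD cmpP hreps heta' heta cK).
  - move=> J cJ nz; apply: contrapT => nex; case/negP: nz; apply/eqP; rewrite omE //.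
    have dT := pos_der hD (tl_th c D cJ).
    rewrite -(ev_feq (altder_dm (f := idfun) dT) wr).
    apply: (sum_db_ev (f := idfun) hsum dT) => i k.
    rewrite (tl_nth c D _ (widen_ord rN k)) // -(hc k (widen_ord rN k)) // (th_gen hD).
    case: eqP => [ek|_]; last by rewrite mul0r.
    case: nex; exists (widen_ord rN k); last exact: (ltn_ord k).
    by rewrite -ek -mem_enum mem_nth // -cardE cJ.
have [Y [gY eY]] := log_like_decomposition hD cmpP hroot hom.
(* An element of [upto j] with [j < r] has weights supported on the first [r] indices only, so its
   components are [p]-th powers times monomials in [b]. *)
have head_in ys : ys \in Y -> in_powgen p b (nth 0 ys 0).
  move=> /gY [_ _ _ [j jr [Ly hy]]].
  rewrite (cmp_sum cmpP Ly); apply: (subfield_sum (powgenP _ _)) => i _.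
  case: (pselect (exists2 k : 'I_N, (j < k)%N & (i k : nat) != 0%N)) => [[k jk ik]|nex].
    have /(th0P hp hD cmpP k Ly)/(_ i ik) -> := hy k jk.
    exact: (subfield0 (powgenP _ _)).
  have [/(_ i) [z ->] _] := cmpP _ Ly.
  apply: (subfieldM (powgenP _ _)); first exact: powgen_pow.
  apply: (subfield_prod (powgenP _ _)) => k _.
  case: (eqVneq (i k : nat) 0%N) => [->|ik]; first by rewrite expr0; apply: (subfield1 (powgenP _ _)).
  apply: (subfieldX (powgenP _ _)).
  have kr : (k < r)%N.
    by apply: leq_ltn_trans jr; rewrite leqNgt; apply/negP => jk; apply: nex; exists k.
  by rewrite (hc (Ordinal kr) k) //; apply: powgen_gen.
have wY : feq n w [seq fdlog 1 ys | ys <- Y].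
  apply: (feq_trans wr).
  have dY : fdeg n [seq fdlog 1 ys | ys <- Y].
    by apply/allP => t /mapP [ys /gY [sz _ _ _] ->]; rewrite /= sz.
  apply: (fzero_dual hp hD); first by rewrite fdeg_cat fdeg_scale dreps.
    move=> t; rewrite mem_cat => /orP[/mapP [t' /hreps [_ _ ht] -> x /ht []] //|].
    move=> /mapP [_ /mapP [ys /gY [sz hys _ _] ->] ->] x /= /(nthP 0) [j jn <-].
    by apply: (hys j _).1; rewrite -sz.
  move=> J cJ; have [z z0 hz] := dm_tl hD cJ.
  apply: (mulfI z0); rewrite mulr0.
  transitivity (ev idfun (dm (@tl _ _ c D J n)) ([seq fdlog t.1 t.2 | t <- reps] ++ fopp [seq fdlog 1 ys | ys <- Y])).
    by rewrite /ev mulr_sumr; apply: eq_bigr => t _; rewrite hz mulrCA.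
  rewrite ev_cat ev_scale -omE // eY // mulN1r; apply/eqP; rewrite subr_eq0; apply/eqP.
  rewrite /ev big_map !big_seq; apply: eq_bigr => ys /gY [sz _ _ _].
  by rewrite -(dm_lform c D J sz) /= mul1r.
(* The flag [false] is the sign [+]. The tail is a logarithmic form with coefficient 1, and
   [1 ^+ p - 1 = 0] puts it in [nu] with an empty primitive. *)
exists [seq (false, nth 0 ys 0, [:: fdlog 1 (behead ys)]) | ys <- Y]; split.
  move=> e /mapP [ys yY ->] /=; have [sz hys n0 _] := gY ys yY.
  split; [exact: head_in|exact: (hys 0%N n0).2|].
  case: n sz hys n0 {dw hsum wr hr low heta hreps heta' dreps om omE hom gY eY wY} => // n sz hys _ /=.
  have sb : size (behead ys) = n by rewrite size_behead sz.
  split; first by rewrite /fdeg /= sb eqxx.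
  exists [:: (1, behead ys)]; split.
    rewrite /= andbT sb eqxx /=; apply/allP => x /(nthP 0) [j jn <-].
    by rewrite nth_behead; apply: (hys j.+1 _).2; rewrite -sb.
  split; first exact: feq_refl.
  exists [::]; split; first by case: (n).
  apply/cls_eq; rewrite !clsE big_cons !big_nil /= expr1n subrr mul0r scale0r addr0 //.
apply: (feq_trans wY); rewrite [X in feq n _ X](_ : _ = [seq fdlog 1 ys | ys <- Y]); first exact: feq_refl.
rewrite -map_comp; elim: (Y) gY => //= ys Y' IH gY; rewrite IH; last first.
  by move=> zs hz; apply: gY; rewrite inE hz orbT.
have [sz _ n0 _] := gY ys (mem_head _ _).
case: ys sz {gY} => [|y ys] sz; first by rewrite -sz in n0.
by rewrite /fdlog /= !big_cons big_nil; congr ((_, _) :: _); ring.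
Qed.

End NuRelative.

Theorem theorem5p4 (p : nat) (F : fieldType) (hp : p \in [pchar F])
  (r : nat) (b : 'I_r -> F) (b0 : F)
  (hbF : forall i, ~ exists y : F, y ^+ p = b i)
  (hb0F : ~ exists y : F, y ^+ p = b0)
  (hind : pindep p b)
  (hb0 : in_powgen p b b0)
  (ms : 'I_r -> nat) (m : nat) (hm0 : (0 < m)%N) (hm : forall i, (m <= ms i)%N)
  (E : fieldType) (f : {rmorphism F -> E}) (beta : 'I_r -> E) (beta0 : E)
  (hbeta : forall i, beta i ^+ (p ^ ms i)%N = f (b i))
  (hbeta0 : beta0 ^+ (p ^ m)%N = f b0)
  (hE : forall e : E, gen_field
          (fun y => [\/ exists z, y = f z, exists i, y = beta i | y = beta0]) e) :
  ((exists t, (m <= t)%N /\ in_powgen (p ^ t)%N b b0) ->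
     [/\ forall e : E, gen_field (fun y => (exists z, y = f z) \/ (exists i, y = beta i)) e,
         modular_ext p f,
         (forall (n : nat) (w : fsum F), fdeg n w ->
            (OmegaRel f n w <-> sum_db_wedge n b w) /\
            (sum_db_wedge n b w <-> annOmega n r (fun u => u = [:: (1, fdbs b)]) w)),
         (forall (n : nat) (w : fsum F), fdeg n w ->
            (nuRel p f n w <-> annNu p n r (fun u => u = [:: (1, fdbs b)]) w)) &
         ((forall y : F, exists z, z ^+ (p.-1) = y) ->
            forall (n : nat) (w : fsum F), fdeg n w ->
            (nuRel p f n w <-> dlog_wedge_nu p n b w))])
  /\
  ((~ exists t, (m <= t)%N /\ in_powgen (p ^ t)%N b b0) ->
     forall t : nat, (1 <= t < m)%N -> in_powgen (p ^ t)%N b b0 ->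
     (forall t', (t < t' < m)%N -> ~ in_powgen (p ^ t')%N b b0) ->
     forall x : {ffun 'I_r -> 'I_(p ^ t)} -> F,
       b0 = \sum_(i : {ffun 'I_r -> 'I_(p ^ t)}) x i ^+ (p ^ t)%N * \prod_(k < r) b k ^+ i k ->
       let U := fun u : fsum F => exists i, u = [:: (1, rcons (fdbs b) (x i))] in
       forall (n : nat) (w : fsum F), fdeg n w ->
         (OmegaRel f n w <-> annOmega n r.+1 U w) /\
         (nuRel p f n w <-> annNu p n r.+1 U w)).
Proof.
have ms0 i : (0 < ms i)%N := leq_trans hm0 (hm i).
split=> [[t [mt hbt]]|nt t /andP[t1 tm] hbt tmax x hx U n w dw].
  have hgen e : gen_field (fun y => (exists z, y = f z) \/ (exists i, y = beta i)) e.
    apply: (gen_field_min (gen_fieldP _)) (hE e) => y [[z ->]|[i ->]|->].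
    - by apply: mem_gen_field; left; exists z.
    - by apply: mem_gen_field; right; exists i.
    - exact: (radicand_in_powers hp hbeta hm hbeta0 (powgen_le mt hbt)).
  have rel n w : OmegaRel f n w <-> sum_db_wedge n b w.
    split; first exact: (rel_sum_db hp hind hbeta).
    exact: (sum_db_rel hp hbeta hm0 hm).
  have ann n w : sum_db_wedge n b w <-> annOmega n r (fun u => u = [:: (1, fdbs b)]) w.
    split; first exact: (sum_db_ann hp).
    move=> h; apply: (sum_db_criterion hp hind h.1) => D hD hDb.
    exact: (ann_ev hp hind h).
  split.
  - exact: hgen.
  - by exists r, b, ms, beta.
  - by move=> n w dw; split.
  - move=> n w dw; split=> [[/rel/ann h1 h2]|[/ann/rel h1 h2]]; by split.
  - move=> hroot n w dw; split=> [[/rel h1 h2]|h].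
      exact: (nu_rel_dlog hp hind hroot h1 h2).
    split; last exact: (dlog_wedge_is_nu hp h).
    exact: (dlog_wedge_rel hp hbeta ms0 h).
(* Maximality covers [t + 1 < m]; if [t + 1 = m], membership would give an exponent at least [m],
   excluded in this case. *)
have hmax : ~ in_powgen (p ^ t.+1)%N b b0.
  case: (ltnP t.+1 m) => tm'; first by apply: tmax; rewrite ltnSn.
  by move=> h; apply: nt; exists t.+1.
have rel : OmegaRel f n w <-> annOmega n r.+1 U w.
  split; first exact: (rel_ann_dx hp hind hbeta hm tm hbeta0 hmax hx hE).
  exact: (ann_dx_rel hp hind hbeta hm0 hm tm hbeta0 hmax hx).
by split=> //; split=> [[/rel h1 h2]|[/rel h1 h2]]; split.
Qed.
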